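(* Let $m\ge3$, $\lambda_m=(2\lfloor m/2\rfloor+2)\pi$, and $\omega=\lambda_m/2+2\pi$. For any $r>0$ and $c>1$, there exists an $(r,cr)$-LSH structure for the polygonal $D_2$ distance for $n$ polygons, each with at most $m$ vertices. This structure requires $O\big((n(m+2))^{1+\rho}+n_{r,c}\cdot n(m+2)\big)$ extra space, $O\big(n_{r,c}\cdot(n(m+2))^{1+\rho}\big)$ preprocessing time, and $O\big(n_{r,c}\cdot(m+2)^{1+\rho}\cdot n^{\rho}\big)$ query time, where $\rho=\frac{1}{2\sqrt c-1}$ and $n_{r,c}=\frac{8(m+2)\omega^2}{(\sqrt c-1)r^2}$.
   Context: Polygons are simple, with no three consecutive vertices collinear. For such a polygon $P$ scaled to perimeter $1$ with a reference point $O$ on its boundary, the turning function $t_P:[0,1]\to\mathbb{R}$ gives the cumulative angle between the $x$-axis and the counterclockwise tangent at the boundary point at counterclockwise arc-length $s$ from $O$ (with $t_P(0)\in[0,2\pi)$, constant on edges, changing at vertices by the signed turning angle). The $2\pi$-extension of $f:[0,1]\to\mathbb{R}$ is $f^{2\pi}(x)=f(x)$ on $[0,1]$, $f^{2\pi}(x)=f(x-1)+2\pi$ on $(1,2]$; $D_2(f,g)=\min_{\alpha\in\mathbb{R},\,u\in[0,1]}\left(\int_0^1(f^{2\pi}(x+u)+\alpha-g(x))^2dx\right)^{1/2}$, and $D_2(P,Q)=D_2(t_P,t_Q)$. An $(r,cr)$-LSH structure for a distance $d$ is a data structure storing $n$ data objects such that, for any query $q$, if some data object is at distance at most $r$ from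 $q$, then with constant probability it returns a data object at distance at most $cr$ from $q$. Complexity bounds suppress the factor $1/p_1$, hash/distance evaluation time and $n^{o(1)}$ factors. *)

(* Defs.v *)
From HB Require Import structures.
From mathcomp Require Import all_boot all_order all_algebra.
From mathcomp Require Import all_classical all_reals all_analysis.
Set Implicit Arguments.
Unset Strict Implicit.
Unset Printing Implicit Defensive.
Import Order.TTheory GRing.Theory Num.Theory.
Import numFieldNormedType.Exports.
Local Open Scope classical_set_scope.
Local Open Scope ring_scope.

(* Planar vectors *)

Definition dot (R : realType) (u v : R * R) : R := u.1 * v.1 + u.2 * v.2.

Definition cross (R : realType) (u v : R * R) : R := u.1 * v.2 - u.2 * v.1.

Definition len (R : realType) (u : R * R) : R := Num.sqrt (dot u u).

(* Angle between the x-axis and u <> 0, in [0, 2 pi). *)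
Definition heading (R : realType) (u : R * R) : R :=
  if 0 <= u.2 then acos (u.1 / len u) else 2 * pi - acos (u.1 / len u).

(* Signed angle in (-pi, pi) from u to v, for non-collinear u and v. *)
Definition signed_angle (R : realType) (u v : R * R) : R :=
  Num.sg (cross u v) * acos (dot u v / (len u * len v)).

(* Polygons with a reference point.  The vertices v_0, v_1, ... are listed
   counterclockwise, starting so that the reference point O lies on the first
   edge: O = v_0 + base * (v_1 - v_0) with 0 <= base < 1. *)

Record pgon (R : realType) := Pgon { verts : seq (R * R); base : R }.

Definition pgon0 (R : realType) : pgon R := Pgon [::] 0.

Definition nverts (R : realType) (P : pgon R) : nat := size (verts P).

(* Vertices and edges are indexed cyclically. *)
Definition vert (R : realType) (P : pgon R) (i : nat) : R * R :=
  nth (0, 0) (verts P) (i %% nverts P)%N.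

Definition edge (R : realType) (P : pgon R) (i : nat) : R * R :=
  vert P i.+1 - vert P i.

Definition edge_point (R : realType) (P : pgon R) (i : nat) (s : R) : R * R :=
  ((vert P i).1 + s * (edge P i).1, (vert P i).2 + s * (edge P i).2).

(* Simplicity is injectivity of the closed boundary curve; each boundary point
   lies on exactly one half-open edge [v_i, v_{i+1}). *)
Definition simple_pgon (R : realType) (P : pgon R) : Prop :=
  forall (i j : nat) (s t : R), (i < nverts P)%N -> (j < nverts P)%N ->
    0 <= s < 1 -> 0 <= t < 1 ->
    edge_point P i s = edge_point P j t -> i = j /\ s = t.

(* The fourth clause is the positivity of (twice) the signed area, i.e. the
   counterclockwise order of the vertices of a simple polygon. *)
Definition polygon (R : realType) (P : pgon R) : Prop :=
  [/\ (3 <= nverts P)%N,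
      simple_pgon P,
      forall i : nat, (i < nverts P)%N -> cross (edge P i) (edge P i.+1) != 0,
      0 < \sum_(i < nverts P) cross (vert P i) (vert P i.+1)
    & 0 <= base P < 1].

Definition polygon_upto (R : realType) (m : nat) (P : pgon R) : Prop :=
  polygon P /\ (nverts P <= m)%N.

Definition perimeter (R : realType) (P : pgon R) : R :=
  \sum_(i < nverts P) len (edge P i).

(* Counterclockwise arc length from O to v_i (1 <= i <= nverts P), after
   scaling the perimeter to 1. *)
Definition vertex_pos (R : realType) (P : pgon R) (i : nat) : R :=
  (\sum_(j < i) len (edge P j) - base P * len (edge P 0)) / perimeter P.

(* Turning function; right-continuous at the vertices. *)
Definition turning (R : realType) (P : pgon R) (x : R) : R :=
  heading (edge P 0) +
  \sum_(1 <= i < (nverts P).+1 | vertex_pos P i <= x)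
     signed_angle (edge P i.-1) (edge P i).

(* The 2 pi-extension to [0, 2] of a function on [0, 1]. *)
Definition ext2pi (R : realType) (f : R -> R) (x : R) : R :=
  if x <= 1 then f x else f (x - 1) + 2 * pi.

Definition D2fun (R : realType) (f g : R -> R) : R :=
  inf [set d : R | exists a u : R, 0 <= u <= 1 /\
    d = Num.sqrt (Rintegral (@lebesgue_measure R) `[0, 1]%classic
                    (fun x => (ext2pi f (x + u) + a - g x) ^+ 2))].

Definition D2 (R : realType) (P Q : pgon R) : R :=
  D2fun (turning P) (turning Q).

(* Model of computation: a randomized real RAM.  A machine has a memory of
   natural numbers and a memory of reals, both indirectly addressable, and
   read-only access to a list of input polygons.  Every expression node, test,
   assignment, coin flip and loop iteration costs one unit of time.  There is
   no rounding of reals to integers, so reals influence the control flow only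
   through comparisons.  Programs are finite texts, and bounded loops are the
   only form of iteration, so that every run halts. *)

Inductive iexp : Type :=
| INat of nat
| IMem of iexp
| IAdd of iexp & iexp
| ISub of iexp & iexp
| IMul of iexp & iexp
| IObjects                        (* number of input polygons *)
| IVerts of iexp.                 (* number of vertices of a polygon *)

(* [RDist i j] is the D_2 distance of two input polygons: charging one unit for
   it is how the time for a distance evaluation is suppressed. *)
Inductive rexp (R : realType) : Type :=
| RConst of R
| RMem of iexp
| RNat of iexp
| RAdd of rexp R & rexp R
| RSub of rexp R & rexp R
| RMul of rexp R & rexp R
| RDiv of rexp R & rexp R
| RSqrt of rexp R
| RAcos of rexp R
| RVertX of iexp & iexp           (* polygon, vertex *)
| RVertY of iexp & iexp
| RBase of iexp
| RDist of iexp & iexp.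

Inductive cmd (R : realType) : Type :=
| Skip
| SetI of iexp & iexp             (* address, value *)
| SetR of iexp & rexp R
| Flip of iexp                    (* store a fair coin flip *)
| Seq of cmd R & cmd R
| IfI of iexp & iexp & cmd R & cmd R   (* test <= *)
| IfR of rexp R & rexp R & cmd R & cmd R
| For of iexp & iexp & cmd R.     (* address of the counter, number of rounds *)

(* [itop] and [rtop] are the numbers of allocated cells: one more than the
   largest address written so far. *)
Record state (R : realType) := State {
  imem : nat -> nat;
  rmem : nat -> R;
  itop : nat;
  rtop : nat;
  coins : nat;
  clock : nat }.

Definition state0 (R : realType) : state R :=
  State (fun=> 0%N) (fun=> 0) 0 0 0 0.

Definition tick (R : realType) (k : nat) (s : state R) : state R :=
  State (imem s) (rmem s) (itop s) (rtop s) (coins s) (clock s + k)%N.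

Definition writei (R : realType) (a v : nat) (s : state R) : state R :=
  State [eta imem s with a |-> v] (rmem s) (maxn (itop s) a.+1) (rtop s)
        (coins s) (clock s).

Definition writer (R : realType) (a : nat) (v : R) (s : state R) : state R :=
  State (imem s) [eta rmem s with a |-> v] (itop s) (maxn (rtop s) a.+1)
        (coins s) (clock s).

Definition next_coin (R : realType) (s : state R) : state R :=
  State (imem s) (rmem s) (itop s) (rtop s) (coins s).+1 (clock s).

Definition reset_clock (R : realType) (s : state R) : state R :=
  State (imem s) (rmem s) (itop s) (rtop s) (coins s) 0.

Definition cells (R : realType) (s : state R) : nat := (itop s + rtop s)%N.

Fixpoint isize (e : iexp) : nat :=
  match e with
  | INat _ | IObjects => 1
  | IMem e1 | IVerts e1 => (isize e1).+1
  | IAdd e1 e2 | ISub e1 e2 | IMul e1 e2 => (isize e1 + isize e2).+1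
  end.

Fixpoint rsize (R : realType) (e : rexp R) : nat :=
  match e with
  | RConst _ => 1
  | RMem i | RNat i | RBase i => (isize i).+1
  | RSqrt e1 | RAcos e1 => (rsize e1).+1
  | RAdd e1 e2 | RSub e1 e2 | RMul e1 e2 | RDiv e1 e2 =>
      (rsize e1 + rsize e2).+1
  | RVertX i j | RVertY i j | RDist i j => (isize i + isize j).+1
  end.

Fixpoint ieval (R : realType) (env : seq (pgon R)) (s : state R) (e : iexp)
    : nat :=
  match e with
  | INat k => k
  | IMem e1 => imem s (ieval env s e1)
  | IAdd e1 e2 => (ieval env s e1 + ieval env s e2)%N
  | ISub e1 e2 => (ieval env s e1 - ieval env s e2)%N
  | IMul e1 e2 => (ieval env s e1 * ieval env s e2)%N
  | IObjects => size env
  | IVerts e1 => nverts (nth (pgon0 R) env (ieval env s e1))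
  end.

Fixpoint reval (R : realType) (env : seq (pgon R)) (s : state R) (e : rexp R)
    : R :=
  match e with
  | RConst x => x
  | RMem i => rmem s (ieval env s i)
  | RNat i => (ieval env s i)%:R
  | RAdd e1 e2 => reval env s e1 + reval env s e2
  | RSub e1 e2 => reval env s e1 - reval env s e2
  | RMul e1 e2 => reval env s e1 * reval env s e2
  | RDiv e1 e2 => reval env s e1 / reval env s e2
  | RSqrt e1 => Num.sqrt (reval env s e1)
  | RAcos e1 => acos (reval env s e1)
  | RVertX i j => (vert (nth (pgon0 R) env (ieval env s i)) (ieval env s j)).1
  | RVertY i j => (vert (nth (pgon0 R) env (ieval env s i)) (ieval env s j)).2
  | RBase i => base (nth (pgon0 R) env (ieval env s i))
  | RDist i j => D2 (nth (pgon0 R) env (ieval env s i))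
                    (nth (pgon0 R) env (ieval env s j))
  end.

(* The k-th coin flip of a run is [tape k]. *)
Fixpoint exec (R : realType) (env : seq (pgon R)) (tape : nat -> bool)
    (p : cmd R) (s : state R) {struct p} : state R :=
  match p with
  | Skip => s
  | SetI a e =>
      tick (isize a + isize e).+1 (writei (ieval env s a) (ieval env s e) s)
  | SetR a e =>
      tick (isize a + rsize e).+1 (writer (ieval env s a) (reval env s e) s)
  | Flip a =>
      tick (isize a).+1
        (next_coin (writei (ieval env s a) (tape (coins s)) s))
  | Seq p1 p2 => exec env tape p2 (exec env tape p1 s)
  | IfI e1 e2 p1 p2 =>
      let s' := tick (isize e1 + isize e2).+1 s in
      if (ieval env s e1 <= ieval env s e2)%N
      then exec env tape p1 s' else exec env tape p2 s'
  | IfR e1 e2 p1 p2 =>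
      let s' := tick (rsize e1 + rsize e2).+1 s in
      if reval env s e1 <= reval env s e2
      then exec env tape p1 s' else exec env tape p2 s'
  | For a e p1 =>
      let x := ieval env s a in
      foldl (fun t i => exec env tape p1 (tick 1 (writei x i t)))
            (tick (isize a + isize e).+1 s)
            (iota 0 (ieval env s e))
  end.

(* Data structures for polygon search.  The polygons stored are the input of
   the preprocessing program, with objects numbered from 0.  The query program
   starts from the memory left by the preprocessing, and sees the query polygon
   as one further input object, after the stored ones; its answer is the number
   of a stored polygon, left in integer cell 0. *)

Record structure (R : realType) := Structure {
  preproc : cmd R;
  query : cmd R }.

Definition built (R : realType) (S : structure R) (data : seq (pgon R))
    (tape : nat -> bool) : state R :=
  exec data tape (preproc S) (state0 R).

Definition answered (R : realType) (S : structure R) (data : seq (pgon R))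
    (q : pgon R) (tape : nat -> bool) : state R :=
  exec (rcons data q) tape (query S) (reset_clock (built S data tape)).

Definition preproc_time (R : realType) (S : structure R) (data : seq (pgon R))
    (tape : nat -> bool) : nat :=
  clock (built S data tape).

Definition query_time (R : realType) (S : structure R) (data : seq (pgon R))
    (q : pgon R) (tape : nat -> bool) : nat :=
  clock (answered S data q tape).

(* Memory cells used during preprocessing and query, in addition to the
   read-only polygons. *)
Definition extra_space (R : realType) (S : structure R) (data : seq (pgon R))
    (q : pgon R) (tape : nat -> bool) : nat :=
  cells (answered S data q tape).

Definition answer_within (R : realType) (S : structure R) (data : seq (pgon R))
    (q : pgon R) (d : R) (tape : nat -> bool) : bool :=
  let i := imem (answered S data q tape) 0 in
  (i < size data)%N && (D2 (nth (pgon0 R) data i) q <= d).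

(* Probability of an event that depends on the first T coin flips only. *)
Definition coin_prob (R : realType) (T : nat) (E : (nat -> bool) -> bool) : R :=
  #|[set w : T.-tuple bool | E (nth false w)]%SET|%:R / (2 ^ T)%:R.

(* The (r, cr)-guarantee with success probability at least delta; T bounds the
   number of coins flipped in preprocessing and query together. *)
Definition lsh_guarantee (R : realType) (delta r c : R) (S : structure R)
    (data : seq (pgon R)) (q : pgon R) : Prop :=
  (exists2 i, (i < size data)%N & D2 (nth (pgon0 R) data i) q <= r) ->
  exists2 T : nat,
    forall tape : nat -> bool, (coins (answered S data q tape) <= T)%N &
    delta <= coin_prob R T (answer_within S data q (c * r)).

(* Parameters of the complexity bounds *)

Definition lambda_ (R : realType) (m : nat) : R := (2 * (m %/ 2) + 2)%N%:R * pi.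

Definition omega (R : realType) (m : nat) : R := lambda_ R m / 2 + 2 * pi.

Definition rho (R : realType) (c : R) : R := (2 * Num.sqrt c - 1)^-1.

Definition n_rc (R : realType) (m : nat) (r c : R) : R :=
  8 * (m + 2)%:R * omega R m ^+ 2 / ((Num.sqrt c - 1) * r ^+ 2).

(* Main.v *)
Require Import Defs.
From HB Require Import structures.
From mathcomp Require Import all_boot all_order all_algebra.
From mathcomp Require Import all_classical all_reals all_analysis.
From mathcomp Require Import measurable_realfun ring lra zify.
Set Implicit Arguments.
Unset Strict Implicit.
Unset Printing Implicit Defensive.
Import Order.TTheory GRing.Theory Num.Theory.
Import numFieldNormedType.Exports.
Local Open Scope classical_set_scope.
Local Open Scope ring_scope.

(* The vectors of samples of two turning functions on a grid of d points, one of
   them shifted by s grid steps and both centred, have a Euclidean distance that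
   approximates sqrt d times the L_2 distance for the rotation s / d; the
   translation alpha is optimised away by centring, and a grid with d of order
   m^2 / r^2, hence of order n_rc, makes the discretisation error negligible.
   So D_2 near neighbour search reduces to Euclidean near neighbour search for
   d + 1 shifted queries.

   A hash bit of a vector x is the parity of floor(<x, e> + o), with random signs
   e and a random offset o.  Two bits differ with probability E[w(<x - y, e>)] for
   a square wave w; the Fourier expansion of w, in which the expectation turns
   cosines into products of cosines, shows that this is close to a function
   F(|x - y|^2) = sum_i C_i (1 - exp (- k_i^2 |x - y|^2)).  F is bounded and
   behaves at most like |x - y|, so that by a pigeonhole argument over a geometric
   sequence of scales there is one at which F grows by a factor close to c over
   distance ratio c; as c > 2 sqrt c - 1, the exponent 1 / (2 sqrt c - 1) of the
   usual analysis of LSH is attained.  The inner product <x, e> is evaluated in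
   time O(m), whatever d is, from precomputed partial sums of e: a turning
   function is a step function with at most m steps. *)

(** * Discretised turning functions *)

(** The program is fixed before n is known, so it computes the table sizes itself: T = (2^b)^U, L =
    lam^U and K = a U share the least exponent U with T >= n, and a, b, lam depend on c alone. A key
    is a random subset sum modulo T, so that a table occupies about n cells whatever K is. Reals
    cannot be rounded, hence a parity is found by subtracting powers of two in about ln d rounds.
    The factor n^o(1) absorbs this only if d < n; for n <= d all objects are scanned, which n_rc
    pays for. The order m^2 / r^2 of d is usable only while c r is below the trivial bound (2 m + 6)
    pi on D_2; beyond it object 0 is always an answer. The good shift depends on the two polygons
    and not on the coins. So the success probability is that of one shift, without a union bound
    over d + 1 shifts: the other probes cannot spoil a correct answer, as cell 0 is overwritten only
    after a distance test. The budget of 9 L steps per shift covers L lookups and fewer than 8 L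
    visits to far objects. *)

Section CellIntegral.
Variable R : realType.
Local Notation mu := (@lebesgue_measure R).

Lemma integrable_subitv (H : R -> R) (i : interval R) :
  mu.-integrable `[0, 1]%classic (EFin \o H) ->
  [set` i] `<=` `[0, 1]%classic -> mu.-integrable [set` i] (EFin \o H).
Proof.
by move=> iH sub; apply: (@integrableS _ _ _ mu `[0, 1]%classic) sub iH => //; exact: measurable_itv.
Qed.

Lemma Rintegral_co_cst (a b r : R) : a < b ->
  Rintegral mu `[a, b[%classic (fun=> r) = r * (b - a).
Proof.
move=> ab; rewrite Rintegral_cst; last exact: measurable_itv.
have h := lebesgue_measure_itv `[a, b[; rewrite /= lte_fin ab -EFinB in h.
by congr (_ * _); transitivity (fine (b - a)%:E) => //; rewrite -h.
Qed.

Lemma integrable_co_cst (a b r : R) : a < b ->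
  mu.-integrable `[a, b[%classic (EFin \o (fun=> r)).
Proof.
move=> ab; apply: measurable_bounded_integrable => //.
  have h := lebesgue_measure_itv `[a, b[; rewrite /= lte_fin ab -EFinB in h.
  by apply: (@le_lt_trans _ _ (b - a)%:E); [rewrite -h|rewrite ltry].
exact: bounded_cst.
Qed.

(** Induction over the prefixes [[0, k/d[]: half-open cells tile the interval, so the integral
    splits without overlaps. *)
Lemma Rintegral_cells_le (H : R -> R) (d : nat) (b : nat -> R) : (0 < d)%N ->
  mu.-integrable `[0, 1]%classic (EFin \o H) ->
  (forall j x, (j < d)%N -> j%:R / d%:R <= x < j.+1%:R / d%:R -> H x <= b j) ->
  Rintegral mu `[0, 1]%classic H <= (\sum_(j < d) b j) / d%:R.
Proof.
move=> d0 iH Hb; have d0R : 0 < d%:R :> R by rewrite ltr0n.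
have sub k : (k <= d)%N -> k%:R / d%:R <= 1 :> R.
  by move=> kd; rewrite ler_pdivrMr// mul1r ler_nat.
have step k : (k <= d)%N ->
    Rintegral mu `[0, k%:R / d%:R[%classic H <= (\sum_(j < k) b j) / d%:R.
  elim: k => [|k IH] kd.
    by rewrite mul0r set_itv_ge ?bnd_simp ?ltxx// Rintegral_set0 big_ord0 mul0r.
  have k0 : 0 <= k%:R / d%:R :> R by rewrite divr_ge0.
  have kk : k%:R / d%:R <= k.+1%:R / d%:R :> R.
    by rewrite ler_wpM2r ?invr_ge0 ?ler0n// ler_nat.
  have k1 := sub _ kd.
  have kkS : k%:R / d%:R < k.+1%:R / d%:R :> R by rewrite ltr_pM2r ?invr_gt0// ltr_nat.
  have sS (x y : R) : 0 <= x -> y <= 1 -> `[x, y[%classic `<=` `[0, 1]%classic.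
    move=> x0 y1 z /=; rewrite !in_itv/= => /andP[xz zy].
    by rewrite (le_trans x0 xz) (le_trans (ltW zy) y1).
  rewrite (@itv_bndbnd_setU _ _ _ (BLeft (k%:R / d%:R))) ?bnd_simp//.
  rewrite Rintegral_setU//=; last 2 first.
  - rewrite -itv_bndbnd_setU ?bnd_simp//.
    exact: (integrable_subitv iH (sS _ _ _ k1)).
  - apply/disj_setPS => y [/=]; rewrite !in_itv/= => /andP[_ yx] /andP[].
    by rewrite leNgt yx.
  rewrite big_ord_recr/= mulrDl lerD ?IH ?(ltnW kd)//.
  have -> : b k / d%:R =
      Rintegral mu `[k%:R / d%:R, k.+1%:R / d%:R[%classic (fun=> b k).
    by rewrite Rintegral_co_cst// -mulrBl -natrB// subSnn div1r.
  apply: le_Rintegral => //.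
  - exact: (integrable_subitv iH (sS _ _ k0 k1)).
  - exact: integrable_co_cst.
  - by move=> x /=; rewrite in_itv/=; exact: Hb.
(* At k = d the prefix is [[0, 1[]; the missing endpoint is a null set. *)
have := step d (leqnn d); rewrite divff ?gt_eqF//.
rewrite Rintegral_itv_bndo_bndc//; apply: (integrable_subitv iH) => x /=.
by rewrite !in_itv/= => /andP[-> /ltW ->].
Qed.

Lemma Rintegral_cells_ge (H : R -> R) (d : nat) (b : nat -> R) : (0 < d)%N ->
  mu.-integrable `[0, 1]%classic (EFin \o H) ->
  (forall j x, (j < d)%N -> j%:R / d%:R <= x < j.+1%:R / d%:R -> b j <= H x) ->
  (\sum_(j < d) b j) / d%:R <= Rintegral mu `[0, 1]%classic H.
Proof.
move=> d0 iH Hb.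
have iN : mu.-integrable `[0, 1]%classic (EFin \o (fun x => -1 * H x)).
  have := integrableN iH; congr (mu.-integrable _ _).
  by apply/funext => x /=; rewrite mulN1r EFinN.
have := Rintegral_cells_le (b := fun j => - b j) d0 iN.
rewrite RintegralZl// mulN1r sumrN mulNr lerN2; apply=> j x jd jx.
by rewrite mulN1r lerN2 Hb.
Qed.

End CellIntegral.

(** * Variation of turning functions and of their 2 pi-extensions *)

Section Turning.
Variable R : realType.
Implicit Types (P Q : pgon R) (u v : R * R).

Lemma dot_le_len u v : `|dot u v| <= len u * len v.
Proof.
rewrite /len -sqrtrM; last by rewrite /dot -!expr2 addr_ge0 ?sqr_ge0.
rewrite -sqrtr_sqr ler_wsqrtr// /dot.
by have := sqr_ge0 (u.1 * v.2 - u.2 * v.1); nra.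
Qed.

Lemma acos_arg_bound u v : -1 <= dot u v / (len u * len v) <= 1.
Proof.
rewrite -ler_norml normrM normfV (@ger0_norm _ (len u * len v)); last first.
  by rewrite mulr_ge0 ?sqrtr_ge0.
have [->|h] := eqVneq (len u * len v) 0; first by rewrite invr0 mulr0.
rewrite ler_pdivrMr ?mul1r ?dot_le_len//.
by rewrite lt_def h mulr_ge0 ?sqrtr_ge0.
Qed.

Lemma signed_angle_bound u v : `|signed_angle u v| <= pi.
Proof.
rewrite /signed_angle normrM normr_sg.
have := acos_arg_bound u v => b.
have := acos_ge0 b; have := acos_lepi b.
case: (_ == 0) => /= a1 a2; first by rewrite mul0r pi_ge0.
by rewrite mul1r ger0_norm.
Qed.

Lemma heading_bound u : 0 <= heading u <= 2 * pi.
Proof.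
rewrite /heading.
have b : -1 <= u.1 / len u <= 1.
  have [h|h] := eqVneq (len u) 0; first by rewrite h invr0 mulr0; lra.
  have l0 : 0 < len u by rewrite lt_def h sqrtr_ge0.
  rewrite -ler_norml normrM normfV (gtr0_norm l0) ler_pdivrMr// mul1r.
  rewrite /len -sqrtr_sqr ler_wsqrtr// /dot.
  by have := sqr_ge0 u.2; nra.
by have := acos_ge0 b; have := acos_lepi b; case: ifP => _ *; apply/andP; lra.
Qed.

(** A monotone majorant of the variation: each vertex passed counts pi, the largest absolute value
    of a turning angle. Being monotone, it makes the errors of all grid cells telescope. *)
Definition turn_var P (x : R) : R :=
  \sum_(1 <= i < (nverts P).+1 | vertex_pos P i <= x) pi.

Lemma turn_var_ge0 P x : 0 <= turn_var P x.
Proof. by apply: sumr_ge0 => *; exact: pi_ge0. Qed.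

Lemma turn_var_le P x : turn_var P x <= (nverts P)%:R * pi.
Proof.
have -> : (nverts P)%:R * pi = \sum_(1 <= i < (nverts P).+1) (pi : R).
  by rewrite sumr_const_nat subn1 mulr_natl.
rewrite /turn_var big_mkcond ler_sum// => i _.
by case: ifP => // _; exact: pi_ge0.
Qed.

Lemma turning_var P x y : x <= y ->
  `|turning P y - turning P x| <= turn_var P y - turn_var P x.
Proof.
move=> xy; rewrite /turning opprD addrACA subrr add0r /turn_var.
rewrite !(big_mkcond (fun i => vertex_pos P i <= _)) -!sumrB.
apply: le_trans (ler_norm_sum _ _ _) _; apply: ler_sum => i _.
case: ifP => h1; case: ifP => h2; rewrite ?subrr ?subr0 ?normr0//.
- exact: signed_angle_bound.
- by move: h1; rewrite (le_trans h2 xy).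
Qed.

Lemma turn_var_nd P : {homo turn_var P : x y / x <= y}.
Proof.
by move=> x y xy; rewrite -subr_ge0 (le_trans _ (turning_var P xy)).
Qed.

Lemma turning_range P x :
  - ((nverts P)%:R * pi) <= turning P x <= 2 * pi + (nverts P)%:R * pi.
Proof.
have := heading_bound (edge P 0); rewrite /turning => /andP[h1 h2].
have : `|\sum_(1 <= i < (nverts P).+1 | vertex_pos P i <= x)
          signed_angle (edge P i.-1) (edge P i)| <= (nverts P)%:R * pi.
  apply: le_trans (ler_norm_sum _ _ _) _; apply: le_trans (turn_var_le P x).
  by apply: ler_sum => *; exact: signed_angle_bound.
by rewrite ler_norml => /andP[? ?]; apply/andP; lra.
Qed.

(** Jordan decomposition: [turning P] is the difference of the two nondecreasing functions
    [turning P + turn_var P] and [turn_var P]. *)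
Lemma measurable_turning P (D : set R) : measurable D -> measurable_fun D (turning P).
Proof.
move=> mD; have -> : turning P = (fun x => (turning P x + turn_var P x) - turn_var P x).
  by apply/funext => x; rewrite addrK.
apply: measurable_funB; apply: nondecreasing_measurable => // x y xy.
  have := turning_var P xy; rewrite ler_norml => /andP[? _]; lra.
exact: turn_var_nd.
Qed.

(** Plays the part of [turn_var] for the 2 pi-extension. The constant [(nverts P + 2) * pi] pays for
    a possible jump at 1, from [turning P 1] to [turning P 0 + 2 * pi]. *)
Definition ext_var P (y : R) : R :=
  if y < 1 then turn_var P y
  else turn_var P 1 + turn_var P (y - 1) + ((nverts P)%:R + 2) * pi.

Lemma wrap_jump_ge0 P : 0 <= ((nverts P)%:R + 2) * pi :> R.
Proof. by apply: mulr_ge0; [exact: addr_ge0|exact: pi_ge0]. Qed.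

Lemma ext_var_nd P : {homo ext_var P : x y / x <= y}.
Proof.
move=> x y xy; rewrite /ext_var; have p0 := pi_ge0 R.
have n0 : 0 <= (nverts P)%:R :> R by [].
case: (ltP x 1) => x1; case: (ltP y 1) => y1.
- exact: turn_var_nd.
- have := turn_var_nd P (ltW x1); have := turn_var_ge0 P (y - 1).
  by have := wrap_jump_ge0 P; lra.
- by move: (le_lt_trans xy y1); rewrite ltNge x1.
- by rewrite lerD2r lerD2l turn_var_nd// lerD2r.
Qed.

Lemma ext_var_bound P y : 0 <= ext_var P y <= (3 * (nverts P)%:R + 2) * pi.
Proof.
have p0 := pi_ge0 R; have n0 : 0 <= (nverts P)%:R :> R by [].
have np : 0 <= (nverts P)%:R * pi :> R by rewrite mulr_ge0.
rewrite /ext_var; have b x := turn_var_le P x; have g x := turn_var_ge0 P x.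
case: ifP => _.
  by have := b y; have := g y; move=> *; apply/andP; split; nra.
have := b 1; have := g 1; have := b (y - 1); have := g (y - 1).
by move=> *; apply/andP; split; nra.
Qed.

(** The value of the extension at n / d, except that it has already wrapped at n = d, whereas
    [ext2pi] wraps only after 1. *)
Definition sample P (d n : nat) : R :=
  if (n < d)%N then turning P (n%:R / d%:R)
  else turning P ((n - d)%N%:R / d%:R) + 2 * pi.

Lemma turning_wrap P y x : 0 <= y -> x <= 1 ->
  `|turning P y + 2 * pi - turning P x| <=
  turn_var P y + turn_var P 1 - turn_var P x + ((nverts P)%:R + 2) * pi.
Proof.
move=> y0 x1.
have := turning_var P y0; have := turning_var P x1.
have := turn_var_ge0 P 0.
have h : `|turning P 0 + 2 * pi - turning P 1| <= ((nverts P)%:R + 2) * pi.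
  have := turning_var P (@ler01 R); have := turn_var_le P 1.
  have := turn_var_ge0 P 0; have := pi_ge0 R.
  by rewrite !ler_norml => ? ? ? /andP[? ?]; apply/andP; split; lra.
move: h; rewrite !ler_norml => /andP[? ?] ? /andP[? ?] /andP[? ?].
by apply/andP; split; lra.
Qed.

(** Since x + u lies between n / d and (n + 2) / d for n = j + s, two grid steps of variation are
    natural. The extra step down to n - 1 covers x + u = 1, where [sample] has wrapped and [ext2pi]
    has not. *)
Lemma ext2pi_sample P (d j s : nat) (x u : R) : (0 < d)%N ->
  j%:R / d%:R <= x < j.+1%:R / d%:R -> s%:R / d%:R <= u < s.+1%:R / d%:R ->
  `|ext2pi (turning P) (x + u) - sample P d (j + s)| <=
  ext_var P ((j + s).+2%:R / d%:R) - ext_var P ((j + s).-1%:R / d%:R).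
Proof.
move=> d0 /andP[x1 x2] /andP[u1 u2]; set n := (j + s)%N; set y := x + u.
have d0R : 0 < d%:R :> R by rewrite ltr0n.
have y1 : n%:R / d%:R <= y by rewrite natrD mulrDl lerD.
have y2 : y <= n.+2%:R / d%:R.
  rewrite /n -addSn -addnS natrD mulrDl; exact: lerD (ltW x2) (ltW u2).
have ndp (a b : nat) : (a <= b)%N -> a%:R / d%:R <= b%:R / d%:R :> R.
  by move=> ab; rewrite ler_wpM2r ?invr_ge0 ?ler0n// ler_nat.
have y0 : 0 <= n%:R / d%:R :> R by rewrite divr_ge0.
have e1 := ext_var_nd P y2.
have e2 : ext_var P (n.-1%:R / d%:R) <= ext_var P (n%:R / d%:R).
  by apply: ext_var_nd; exact/ndp/leq_pred.
rewrite /ext2pi /sample.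
have J0 := wrap_jump_ge0 P.
case: (ltnP n d) => nd.
  have n1 : n%:R / d%:R < 1 :> R by rewrite ltr_pdivrMr// mul1r ltr_nat.
  have E : ext_var P (n%:R / d%:R) = turn_var P (n%:R / d%:R) by rewrite /ext_var n1.
  case: (leP y 1) => yl.
    apply: le_trans (turning_var P y1) _.
    suff : turn_var P y <= ext_var P y by lra.
    rewrite /ext_var; case: (ltP y 1) => // y3.
    have -> : y = 1 by apply/le_anti/andP.
    by have := turn_var_ge0 P (1 - 1); lra.
  apply: le_trans (turning_wrap P _ (ltW n1)) _; first lra.
  have : ext_var P y = turn_var P 1 + turn_var P (y - 1) + ((nverts P)%:R + 2) * pi.
    by rewrite /ext_var ltNge (ltW yl).
  lra.
have n1 : 1 <= n%:R / d%:R :> R by rewrite ler_pdivlMr// mul1r ler_nat.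
have E : (n - d)%N%:R / d%:R = n%:R / d%:R - 1 :> R.
  by rewrite natrB// mulrBl divff// gt_eqF.
rewrite E; have yn : n%:R / d%:R - 1 <= y - 1 by lra.
have E1 : ext_var P (n%:R / d%:R) = turn_var P 1 + turn_var P (n%:R / d%:R - 1) + ((nverts P)%:R + 2) * pi.
    by rewrite /ext_var ltNge n1.
have E2 : ext_var P y = turn_var P 1 + turn_var P (y - 1) + ((nverts P)%:R + 2) * pi.
    by rewrite /ext_var ltNge (le_trans n1 y1).
(* Here y = 1 and n = d: the whole jump is charged to the step from (d - 1) / d, which lies below
   1. *)
case: (leP y 1) => yl.
  have yE : y = 1 by apply/le_anti; rewrite yl (le_trans n1 y1).
  have nE : n = d.
    apply/eqP; rewrite eqn_leq nd andbT.
    by move: (le_trans y1 yl); rewrite ler_pdivrMr// mul1r ler_nat.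
  have n2 : n.-1%:R / d%:R < 1 :> R.
    by rewrite ltr_pdivrMr// mul1r ltr_nat nE prednK.
  have E3 : ext_var P (n.-1%:R / d%:R) = turn_var P (n.-1%:R / d%:R).
    by rewrite /ext_var n2.
  have n11 : n%:R / d%:R = 1 :> R by rewrite nE divff// gt_eqF.
  rewrite n11 subrr yE distrC.
  have := turning_wrap P (lexx 0) (lexx 1).
  have := turn_var_nd P (ltW n2); rewrite -E3.
  move: e1; rewrite E2 yE subrr; have := turn_var_ge0 P 0; lra.
have -> : turning P (y - 1) + 2 * pi - (turning P (n%:R / d%:R - 1) + 2 * pi) =
  turning P (y - 1) - turning P (n%:R / d%:R - 1) by ring.
have := turning_var P yn; lra.
Qed.

End Turning.

(** * Integral and sampled squared distances *)

Section Discretisation.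
Variables (R : realType) (P Q : pgon R) (m d : nat).
Hypotheses (Pm : (nverts P <= m)%N) (Qm : (nverts Q <= m)%N) (d0 : (0 < d)%N).
Local Notation mu := (@lebesgue_measure R).

Definition gap (s : nat) (a : R) (j : nat) : R :=
  sample P d (j + s) + a - sample Q d j.

Definition gap_fun (u a x : R) : R := ext2pi (turning P) (x + u) + a - turning Q x.

Let osc (s j : nat) : R :=
  ext_var P ((j + s).+2%:R / d%:R) - ext_var P ((j + s).-1%:R / d%:R) +
  (turn_var Q (j.+1%:R / d%:R) - turn_var Q (j%:R / d%:R)).

(** Equal to 3 (3 m + 2) pi + m pi: the extension of the first curve is counted in windows of three
    grid steps, the second curve in single steps. *)
Definition osc_bound : R := (10 * m%:R + 6) * pi.

Let grid_le (a b : nat) : (a <= b)%N -> a%:R / d%:R <= b%:R / d%:R :> R.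
Proof. by move=> ab; rewrite ler_wpM2r ?invr_ge0 ?ler0n// ler_nat. Qed.

Let osc_ge0 s j : 0 <= osc s j.
Proof.
rewrite addr_ge0// subr_ge0; [apply: ext_var_nd|apply: turn_var_nd]; apply: grid_le => //.
by rewrite (leq_trans (leq_pred _))// (leq_trans (leqnSn _)).
Qed.

Let nP_le : (nverts P)%:R <= m%:R :> R. Proof. by rewrite ler_nat. Qed.
Let nQ_le : (nverts Q)%:R <= m%:R :> R. Proof. by rewrite ler_nat. Qed.

(** Windows of width three telescope into three separate chains, each of total at most M. *)
Lemma three_step_sum (e : nat -> R) (M : R) (s k : nat) :
  (forall n, 0 <= e n <= M) ->
  \sum_(j < k) (e (j + s).+2 - e (j + s).-1) <= 3 * M.
Proof.
move=> eM.
have -> : \sum_(j < k) (e (j + s).+2 - e (j + s).-1) =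
    (e (k + s).+1 - e s.+1) + (e (k + s)%N - e s) + (e (k + s).-1 - e s.-1).
  elim: k => [|k IH]; first by rewrite big_ord0; ring.
  by rewrite big_ord_recr/= IH; ring.
have h := eM; move: (h (k + s).+1) (h s.+1) (h (k + s)%N) (h s) (h (k + s).-1) (h s.-1).
lra.
Qed.

Let osc_sum s : \sum_(j < d) osc s j <= osc_bound.
Proof.
rewrite /osc big_split/=.
have p0 := pi_ge0 R.
have h1 : \sum_(j < d) (ext_var P ((j + s).+2%:R / d%:R) - ext_var P ((j + s).-1%:R / d%:R))
    <= 3 * ((3 * m%:R + 2) * pi).
  apply: (@three_step_sum (fun n => ext_var P (n%:R / d%:R))) => n.
  have /andP[-> h] := ext_var_bound P (n%:R / d%:R); apply: le_trans h _.
  by rewrite ler_wpM2r// lerD2r ler_wpM2l.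
have h2 : \sum_(j < d) (turn_var Q (j.+1%:R / d%:R) - turn_var Q (j%:R / d%:R)) <= m%:R * pi.
  rewrite -(big_mkord xpredT (fun j => turn_var Q (j.+1%:R / d%:R) - turn_var Q (j%:R / d%:R))).
  rewrite telescope_sumr//; have := turn_var_le Q (d%:R / d%:R).
  have : (nverts Q)%:R * pi <= m%:R * pi :> R by rewrite ler_wpM2r.
  by have := turn_var_ge0 Q (0%:R / d%:R); lra.
by apply: le_trans (lerD h1 h2) _; rewrite /osc_bound; lra.
Qed.

(** A sum of squares of nonnegative numbers is at most the square of their sum. The bound does not
    grow with d, so the mean square error is of order m^2 / d. *)
Let osc_sqr_sum s : \sum_(j < d) osc s j ^+ 2 <= osc_bound ^+ 2.
Proof.
have W0 : 0 <= osc_bound by apply: le_trans (osc_sum s); exact: sumr_ge0.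
apply: (@le_trans _ _ (\sum_(j < d) osc_bound * osc s j)).
  apply: ler_sum => j _; rewrite expr2 ler_wpM2r//.
  apply: le_trans (osc_sum s); rewrite (bigD1 j)//= lerDl.
  exact: sumr_ge0.
by rewrite -mulr_sumr expr2 ler_wpM2l.
Qed.

Let gap_close s (u a x : R) j : s%:R / d%:R <= u < s.+1%:R / d%:R ->
  (j < d)%N -> j%:R / d%:R <= x < j.+1%:R / d%:R ->
  `|gap_fun u a x - gap s a j| <= osc s j.
Proof.
move=> us jd jx; have h1 := ext2pi_sample P d0 jx us.
have /andP[x1 /ltW x2] := jx.
have h2 := turning_var Q x1; have h3 := turn_var_nd Q x2.
rewrite /gap_fun /gap {2}/sample jd.
have -> : ext2pi (turning P) (x + u) + a - turning Q x -
   (sample P d (j + s) + a - turning Q (j%:R / d%:R)) =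
   (ext2pi (turning P) (x + u) - sample P d (j + s)) -
   (turning Q x - turning Q (j%:R / d%:R)) by ring.
by apply: le_trans (ler_normB _ _) _; rewrite /osc; lra.
Qed.

(** Weighted Young inequality, from the square of G - D / t. The parameter t trades relative error
    against additive error. *)
Lemma sqr_perturb (t A G B : R) : 0 < t -> `|A - G| <= B ->
  A ^+ 2 <= (1 + t) * G ^+ 2 + (1 + t^-1) * B ^+ 2.
Proof.
move=> t0 AG; set D := A - G; have -> : A = G + D by rewrite /D; ring.
have DB : D ^+ 2 <= B ^+ 2 by rewrite -real_normK ?num_real// ler_sqr ?nnegrE// (le_trans _ AG).
have h : (1 + t^-1) * D ^+ 2 <= (1 + t^-1) * B ^+ 2.
  by rewrite ler_wpM2l// addr_ge0// invr_ge0 ltW.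
apply: le_trans (lerD (lexx _) h).
have : 0 <= t * (G - D / t) ^+ 2 by rewrite mulr_ge0 ?sqr_ge0 ?ltW.
have -> : t * (G - D / t) ^+ 2 = t * G ^+ 2 - 2 * G * D + t^-1 * D ^+ 2.
  by field; rewrite gt_eqF.
nra.
Qed.

Lemma measurable_gap_fun (u a : R) (D : set R) : measurable D ->
  measurable_fun D (gap_fun u a).
Proof.
move=> mD; apply: measurable_funB; last exact: measurable_turning.
apply: measurable_funD => //; apply: measurable_funTS.
have mt : measurable_fun setT (turning P) by exact: measurable_turning.
rewrite /ext2pi; apply: measurable_fun_ifT => //=.
- by apply: measurable_fun_ler => //; exact: measurable_funD.
- by apply: (measurableT_comp mt); exact: measurable_funD.
- apply: measurable_funD => //; apply: (measurableT_comp mt).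
  by apply: measurable_funB => //; exact: measurable_funD.
Qed.

Lemma gap_fun_bound (u a x : R) : `|gap_fun u a x| <= `|a| + (2 * m%:R + 6) * pi.
Proof.
have p0 := pi_ge0 R; rewrite /gap_fun /ext2pi.
have hP y : - (m%:R * pi) <= turning P y <= 2 * pi + m%:R * pi.
  have /andP[h1 h2] := turning_range P y.
  have : (nverts P)%:R * pi <= m%:R * pi :> R by rewrite ler_wpM2r.
  by move=> ?; apply/andP; split; lra.
have hQ y : - (m%:R * pi) <= turning Q y <= 2 * pi + m%:R * pi.
  have /andP[h1 h2] := turning_range Q y.
  have : (nverts Q)%:R * pi <= m%:R * pi :> R by rewrite ler_wpM2r.
  by move=> ?; apply/andP; split; lra.
have ma := ler_norm a; have mb := lerNnormlW (lexx `|a|).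
move: (hP (x + u)) (hP (x + u - 1)) (hQ x) => /andP[? ?] /andP[? ?] /andP[? ?].
by rewrite ler_norml; case: ifP => _; apply/andP; split; lra.
Qed.

Lemma integrable_gap_fun_sqr (u a : R) :
  mu.-integrable `[0, 1]%classic (EFin \o (fun x => gap_fun u a x ^+ 2)).
Proof.
apply: measurable_bounded_integrable => //.
- have h := lebesgue_measure_itv `[(0:R), 1]; rewrite /= lte_fin ltr01 -EFinB in h.
  by apply: (@le_lt_trans _ _ (1 - 0)%:E); [rewrite -h|rewrite ltry].
- by apply: measurable_funX; apply: measurable_gap_fun; exact: measurable_itv.
- exists ((`|a| + (2 * m%:R + 6) * pi) ^+ 2); split; first exact: num_real.
  move=> M /ltW MM x _ /=; rewrite (le_trans _ MM)// normrX ler_sqr ?nnegrE//.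
    exact: gap_fun_bound.
  exact: le_trans (normr_ge0 _) (gap_fun_bound 0 a 0).
Qed.

Lemma integral_le_sample (s : nat) (t u a : R) : 0 < t ->
  s%:R / d%:R <= u < s.+1%:R / d%:R ->
  Rintegral mu `[0, 1]%classic (fun x => gap_fun u a x ^+ 2) <=
  (1 + t) * ((\sum_(j < d) gap s a j ^+ 2) / d%:R) +
  (1 + t^-1) * (osc_bound ^+ 2 / d%:R).
Proof.
move=> t0 us.
apply: le_trans (Rintegral_cells_le (b := fun j => (1 + t) * gap s a j ^+ 2 +
   (1 + t^-1) * osc s j ^+ 2) d0 (integrable_gap_fun_sqr u a) _) _.
  by move=> j x jd jx; exact: sqr_perturb t0 (gap_close a us jd jx).
rewrite big_split/= -!mulr_sumr mulrDl -[X in X + _]mulrA lerD2l -[X in X <= _]mulrA ler_wpM2l//.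
  by rewrite addr_ge0// invr_ge0 ltW.
by rewrite ler_wpM2r ?invr_ge0 ?ler0n// osc_sqr_sum.
Qed.

Lemma sample_le_integral (s : nat) (t u a : R) : 0 < t ->
  s%:R / d%:R <= u < s.+1%:R / d%:R ->
  (\sum_(j < d) gap s a j ^+ 2) / d%:R <=
  (1 + t) * Rintegral mu `[0, 1]%classic (fun x => gap_fun u a x ^+ 2) +
  (1 + t^-1) * (osc_bound ^+ 2 / d%:R).
Proof.
move=> t0 us; have t1 : 0 < 1 + t by rewrite addr_gt0.
have := Rintegral_cells_ge (b := fun j => (1 + t)^-1 * (gap s a j ^+ 2 -
   (1 + t^-1) * osc s j ^+ 2)) d0 (integrable_gap_fun_sqr u a).
have hc : forall j x, (j < d)%N -> j%:R / d%:R <= x < j.+1%:R / d%:R ->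
    (1 + t)^-1 * (gap s a j ^+ 2 - (1 + t^-1) * osc s j ^+ 2) <= gap_fun u a x ^+ 2.
  move=> j x jd jx; rewrite mulrC ler_pdivrMr// lerBlDr mulrC.
  by apply: sqr_perturb => //; rewrite distrC; exact: gap_close us jd jx.
move=> /(_ hc).
rewrite -mulr_sumr sumrB -mulr_sumr -mulrA mulrC ler_pdivrMr// mulrBl.
rewrite lerBlDr mulrC => h; apply: le_trans h _; rewrite (mulrC _ (1 + t)) lerD2l -mulrA.
rewrite ler_wpM2l//; first by rewrite addr_ge0// invr_ge0 ltW.
by rewrite ler_wpM2r ?invr_ge0 ?ler0n// osc_sqr_sum.
Qed.

End Discretisation.

(** * Reduction of D_2 to Euclidean distances of centred vectors *)

Section CentredSamples.
Variable R : realType.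
Implicit Types P Q : pgon R.

Definition mean (d : nat) (x : nat -> R) : R := (\sum_(j < d) x j) / d%:R.

Definition centre (d : nat) (x : nat -> R) (j : nat) : R := x j - mean d x.

Definition shifted P (d s j : nat) : R := sample P d (j + s).

(* Squared distance of two sample vectors, minimised over vertical translations. *)
Definition centred_dist2 P Q (d s : nat) : R :=
  \sum_(j < d) (centre d (shifted P d 0) j - centre d (shifted Q d s) j) ^+ 2.

(** Constants are orthogonal to centred vectors, so the translation a only enters through its own
    square, which vanishes at the optimal a. *)
Lemma sum_sqr_centre (d : nat) (x y : nat -> R) (a : R) : (0 < d)%N ->
  \sum_(j < d) (x j + a - y j) ^+ 2 =
  \sum_(j < d) (centre d x j - centre d y j) ^+ 2 +
  d%:R * (a + mean d x - mean d y) ^+ 2.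
Proof.
move=> d0; have dR : d%:R != 0 :> R by rewrite pnatr_eq0 -lt0n.
set b := a + mean d x - mean d y.
have E j : (x j + a - y j) ^+ 2 = (centre d x j - centre d y j) ^+ 2 +
    b ^+ 2 + 2 * b * (centre d x j - centre d y j) by rewrite /centre /b; ring.
under eq_bigr do rewrite E.
have Z z : \sum_(j < d) centre d z j = 0.
  rewrite sumrB sumr_const card_ord -[X in _ - X]mulr_natr.
  by rewrite /mean divfK// subrr.
rewrite 2!big_split/= -[X in _ + _ + X]mulr_sumr sumr_const card_ord sumrB !Z.
by rewrite subrr mulr0 addr0 mulr_natl.
Qed.

(* Shifting the first curve by s amounts to shifting the second one by d - s. *)
Lemma gap_reindex P Q (d s : nat) (a : R) : (s <= d)%N ->
  \sum_(j < d) gap P Q d s a j ^+ 2 =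
  \sum_(j < d) (shifted P d 0 j + (a + 2 * pi) - shifted Q d (d - s) j) ^+ 2.
Proof.
move=> sd; have [e dE] : exists e, d = (e + s)%N by exists (d - s)%N; rewrite subnK.
have -> : (d - s)%N = e by rewrite dE addnK.
pose h j := (shifted P d 0 j + (a + 2 * pi) - shifted Q d e j) ^+ 2.
pose g j := gap P Q d s a j ^+ 2.
transitivity (\sum_(0 <= j < d) g j); first by rewrite big_mkord.
transitivity (\sum_(0 <= j < d) h j); last by rewrite big_mkord.
rewrite (@big_cat_nat _ _ _ e 0)//= ?dE ?leq_addr//.
rewrite [RHS](@big_cat_nat _ _ _ s 0)//= ?leq_addl// addrC; congr (_ + _).
  rewrite -{1}[e]add0n [X in index_iota _ X]addnC big_addn addnK.
  apply: eq_big_nat => i /andP[_ si]; rewrite /g /h /gap /shifted /sample addn0.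
  have -> : (i + e + s < d)%N = false by rewrite dE -addnA ltnNge leq_addl.
  have -> : (i + e + s - d)%N = i by rewrite dE -addnA addnK.
  have -> : (i + e < d)%N by rewrite dE addnC ltn_add2l.
  have -> : (i < d)%N by rewrite dE (leq_trans si)// leq_addl.
  by congr (_ ^+ 2); ring.
rewrite [RHS](_ : _ = \sum_(0 + s <= i < e + s) h i)// big_addn addnK.
apply: eq_big_nat => i /andP[_ ie]; rewrite /g /h /gap /shifted /sample addn0.
have -> : (i + s < d)%N by rewrite dE ltn_add2r.
have -> : (i < d)%N by rewrite dE (leq_trans ie)// leq_addr.
have -> : (i + s + e < d)%N = false by rewrite dE -addnA (addnC s) ltnNge leq_addl.
have -> : (i + s + e - d)%N = i by rewrite dE -addnA (addnC s) addnK.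
by congr (_ ^+ 2); ring.
Qed.

Lemma near_centred P Q (m d : nat) (t r : R) :
  (nverts P <= m)%N -> (nverts Q <= m)%N -> (0 < d)%N -> 0 < r ->
  0 < t <= 3^-1 -> (1 + t^-1) * (osc_bound R m ^+ 2 / d%:R) <= t * r ^+ 2 ->
  D2 P Q <= r ->
  exists2 s, (s <= d)%N & centred_dist2 P Q d s <= (1 + 4 * t) * (d%:R * r ^+ 2).
Proof.
move=> Pm Qm d0 r0 /andP[t0 t3] dE Dr.
have d0R : 0 < d%:R :> R by rewrite ltr0n.
(* [D2] is an infimum, so a slack factor is needed to pick a pair (a, u) that nearly attains it.
   Altogether (1 + t)^2 + t <= 1 + 4 t. *)
have t1 : 1 < Num.sqrt (1 + t) by rewrite -[ltLHS]sqrtr1 ltr_sqrt ?ltrDl ?addr_gt0.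
have Dr' : D2 P Q < r * Num.sqrt (1 + t).
  by rewrite (le_lt_trans Dr)// ltr_pMr.
have hi : has_inf [set x : R | exists a u : R, 0 <= u <= 1 /\
    x = Num.sqrt (Rintegral (@lebesgue_measure R) `[0, 1]%classic
                    (fun x => gap_fun P Q u a x ^+ 2))].
  split; first by eexists; exists 0, 0; split; [rewrite lexx ler01|reflexivity].
  by exists 0 => _ [a [u [_ ->]]]; exact: sqrtr_ge0.
have [_ [a [u [u01 ->]]] ux] := inf_lt hi.1 Dr'.
move: u01 => /andP[u0 u1].
pose s := Num.truncn (u * d%:R).
have ud0 : 0 <= u * d%:R by rewrite mulr_ge0// ltW.
have /andP[s1 s2] := truncn_itv ud0.
have us : s%:R / d%:R <= u < s.+1%:R / d%:R.
  by rewrite ler_pdivrMr// ltr_pdivlMr// s1 s2.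
have sd : (s <= d)%N.
  by rewrite -(ler_nat R) (le_trans s1)// ler_piMl// ltW.
(* [D2] shifts the stored polygon by s; the program shifts the query by the complement, so that the
   stored vectors stay fixed. *)
exists (d - s)%N; first exact: leq_subr.
have := sample_le_integral Pm Qm d0 a t0 us.
rewrite gap_reindex// sum_sqr_centre//; set G := Rintegral _ _ _ => h.
have Gr : G <= (1 + t) * r ^+ 2.
  have rr : 0 <= r * Num.sqrt (1 + t) by rewrite mulr_ge0 ?sqrtr_ge0 ?ltW.
  have G0 : 0 <= G by apply: Rintegral_ge0 => x _; exact: sqr_ge0.
  have := ux; rewrite -(ltr_sqr _ rr) ?nnegrE ?sqrtr_ge0//.
  rewrite (sqr_sqrtr G0) exprMn sqr_sqrtr; last by rewrite addr_ge0// ltW.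
  by rewrite mulrC => /ltW.
have r2 : 0 < r ^+ 2 by rewrite exprn_gt0.
have h2 : (\sum_(j < d) (centre d (shifted P d 0) j -
   centre d (shifted Q d (d - s)) j) ^+ 2) / d%:R <= (1 + 4 * t) * r ^+ 2.
  apply: (@le_trans _ _ ((1 + t) * ((1 + t) * r ^+ 2) + t * r ^+ 2)); last first.
    by rewrite mulrA -mulrDl ler_wpM2r ?ltW//; nra.
  apply: le_trans (lerD (ler_wpM2l _ Gr) dE); last by rewrite addr_ge0// ltW.
  apply: le_trans h; rewrite ler_wpM2r ?invr_ge0 ?ler0n// lerDl mulr_ge0//.
  exact: sqr_ge0.
by move: h2; rewrite ler_pdivrMr// -mulrA (mulrC (r ^+ 2)).
Qed.

Lemma far_centred P Q (m d s : nat) (t r c : R) :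
  (nverts P <= m)%N -> (nverts Q <= m)%N -> (0 < d)%N -> 0 < r -> 1 < c ->
  0 < t <= 3^-1 -> (1 + t^-1) * (osc_bound R m ^+ 2 / d%:R) <= t * r ^+ 2 ->
  c * r < D2 P Q -> (s <= d)%N ->
  c ^+ 2 * (d%:R * r ^+ 2) <= (1 + 4 * t) * centred_dist2 P Q d s.
Proof.
move=> Pm Qm d0 r0 c1 /andP[t0 t3] dE Dr sd.
have d0R : 0 < d%:R :> R by rewrite ltr0n.
pose s' := (d - s)%N; pose u : R := s'%:R / d%:R.
have us : s'%:R / d%:R <= u < s'.+1%:R / d%:R.
  by rewrite lexx ltr_pM2r ?invr_gt0// ltr_nat ltnSn.
have u01 : 0 <= u <= 1.
  by rewrite divr_ge0//= ler_pdivrMr// mul1r ler_nat leq_subr.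
(* The translation that centres both vectors: the term with the means becomes 0. *)
pose a := mean d (shifted Q d s) - mean d (shifted P d 0) - 2 * pi.
have := integral_le_sample Pm Qm d0 a t0 us.
rewrite gap_reindex ?leq_subr// subKn// sum_sqr_centre//.
have -> : a + 2 * pi + mean d (shifted P d 0) - mean d (shifted Q d s) = 0.
  by rewrite /a; ring.
rewrite expr0n mulr0 addr0 -/(centred_dist2 P Q d s).
set G := Rintegral _ _ _ => h.
have : c * r < Num.sqrt G.
  apply: lt_le_trans Dr _; apply: ge_inf.
    by exists 0 => _ [b [v [_ ->]]]; exact: sqrtr_ge0.
  by exists a, u.
have G0 : 0 <= G by apply: Rintegral_ge0 => x _; exact: sqr_ge0.
have cr0 : 0 <= c * r by rewrite mulr_ge0// ltW// (lt_trans _ c1).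
rewrite -(ltr_sqr cr0) ?nnegrE ?sqrtr_ge0// sqr_sqrtr// exprMn => /ltW G1.
have h2 := le_trans (le_trans G1 h) (lerD (lexx _) dE).
have Z0 : 0 <= centred_dist2 P Q d s by apply: sumr_ge0 => *; exact: sqr_ge0.
have Zd : centred_dist2 P Q d s = d%:R * (centred_dist2 P Q d s / d%:R).
  by rewrite mulrCA divff ?mulr1// gt_eqF.
rewrite Zd mulrCA [X in _ <= X]mulrCA ler_wpM2l ?(ltW d0R)//.
set Z := centred_dist2 _ _ _ _ / _ in h2 *.
have r2 : 0 < r ^+ 2 by rewrite exprn_gt0.
have c2 : 1 <= c ^+ 2 by rewrite exprn_ege1// ltW.
set X := c ^+ 2 * r ^+ 2 in h2 *.
have Xr : r ^+ 2 <= X by rewrite ler_peMl// ltW.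
have h3 : (1 - t) * X <= (1 + t) * Z.
  have : t * r ^+ 2 <= t * X by rewrite ler_wpM2l// ltW.
  lra.
have X0 : 0 < X by rewrite (lt_le_trans _ Xr).
have Z1 : 0 <= Z by rewrite divr_ge0.
have : (1 - t) * ((1 + 4 * t) * Z) >= (1 - t) * X.
  apply: le_trans h3 _; rewrite [leRHS]mulrA ler_wpM2r//; nra.
have t1 : 0 < 1 - t by lra.
by rewrite ler_pM2l.
Qed.

Lemma centred_diff_bound P Q (m d s j : nat) :
  (nverts P <= m)%N -> (nverts Q <= m)%N -> (0 < m)%N -> (0 < d)%N ->
  `|centre d (shifted P d 0) j - centre d (shifted Q d s) j| <= osc_bound R m.
Proof.
move=> Pm Qm m0 d0; have d0R : 0 < d%:R :> R by rewrite ltr0n.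
have p0 := pi_ge0 R.
have b P' n : (nverts P' <= m)%N ->
    - (m%:R * pi) <= sample P' d n <= 4 * pi + m%:R * pi.
  move=> Pm'; have nm : (nverts P')%:R * pi <= m%:R * pi :> R.
    by rewrite ler_wpM2r// ler_nat.
  rewrite /sample; case: ifP => _.
    by have /andP[? ?] := turning_range P' (n%:R / d%:R); apply/andP; split; lra.
  by have /andP[? ?] := turning_range P' ((n - d)%:R / d%:R); apply/andP; split; lra.
have bm P' n : (nverts P' <= m)%N ->
    - (m%:R * pi) <= mean d (shifted P' d n) <= 4 * pi + m%:R * pi.
  move=> Pm'; rewrite /mean ler_pdivlMr// ler_pdivrMr//.
  have cst (x : R) : x * d%:R = \sum_(j < d) x by rewrite sumr_const card_ord mulr_natr.
  by rewrite !cst; apply/andP; split; apply: ler_sum => i _;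
     case/andP: (b P' (i + n)%N Pm').
have /andP[a1 a2] := b P (j + 0)%N Pm; have /andP[a3 a4] := b Q (j + s)%N Qm.
have /andP[a5 a6] := bm P 0%N Pm; have /andP[a7 a8] := bm Q s Qm.
rewrite /centre /osc_bound ler_norml /shifted; apply/andP.
have mp : pi <= m%:R * pi :> R by rewrite ler_peMl// ler1n.
by split; rewrite /shifted in a5 a6 a7 a8; lra.
Qed.

(** The range of the two turning functions bounds every distance; once c r reaches this bound, any
    stored polygon is an acceptable answer. *)
Lemma D2_le P Q (m : nat) : (nverts P <= m)%N -> (nverts Q <= m)%N ->
  D2 P Q <= (2 * m%:R + 6) * pi.
Proof.
move=> Pm Qm; have p0 := pi_ge0 R.
have b0 : 0 <= (2 * m%:R + 6) * pi :> R by rewrite mulr_ge0// addr_ge0// mulr_ge0.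
set x := Num.sqrt (Rintegral (@lebesgue_measure R) `[0, 1]%classic
                    (fun x => gap_fun P Q 0 0 x ^+ 2)).
apply: (@le_trans _ _ x).
  apply: ge_inf; first by exists 0 => _ [b [v [_ ->]]]; exact: sqrtr_ge0.
  by exists 0, 0; split => //; rewrite lexx ler01.
rewrite /x -[leRHS]ger0_norm// -sqrtr_sqr ler_wsqrtr//.
have := @Rintegral_cells_le R _ 1 (fun=> ((2 * m%:R + 6) * pi) ^+ 2) isT
  (integrable_gap_fun_sqr Pm Qm 0 0).
rewrite big_ord1 divr1; apply=> j y _ _.
have := gap_fun_bound Pm Qm 0 0 y; rewrite normr0 add0r => h.
by rewrite -[leLHS]real_normK ?num_real// ler_sqr ?nnegrE.
Qed.

End CentredSamples.

(** * Square waves and Gaussian averages *)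

Section TrigonometricBounds.
Variable R : realType.
Implicit Types x y : R.

Lemma cos_half x : cos x = 1 - 2 * sin (x / 2) ^+ 2.
Proof. by rewrite [in LHS](splitr x) -mulr2n cos_mulr2n sin2cos2; ring. Qed.

Lemma sin_mvt x : 0 < x -> exists2 z, 0 < z < x & sin x = cos z * x.
Proof.
move=> x0.
have d y : y \in `]0, x[ -> is_derive y 1 sin (cos y) by move=> _; exact: is_derive_sin.
have c : {within `[0, x], continuous sin}.
  exact/continuous_subspaceT/continuous_sin.
have [z] := MVT x0 d c; rewrite in_itv/= sin0 !subr0 => zx ->.
by exists z.
Qed.

Lemma sin_le x : 0 <= x -> sin x <= x.
Proof.
rewrite le_eqVlt => /predU1P[<-|x0]; first by rewrite sin0.
by have [z _ ->] := sin_mvt x0; rewrite ler_piMl ?cos_le1// ltW.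
Qed.

Lemma sqr_sin_le x : sin x ^+ 2 <= x ^+ 2.
Proof.
rewrite -(real_normK (num_real (sin x))) -(real_normK (num_real x)).
rewrite ler_sqr ?nnegrE//; wlog x0 : x / 0 <= x => [h|].
  case: (leP 0 x) => [/h//|/ltW x0].
  by rewrite -normrN -sinN -[leRHS]normrN; apply: h; rewrite oppr_ge0.
rewrite (ger0_norm x0) ler_norml sin_le// andbT.
have [x1|x1] := leP x 1.
  have : 0 <= sin x; last lra.
  by apply: sin_ge0_pi; rewrite x0 (le_trans x1)// (le_trans _ (pi_ge2 R))// ler1n.
by rewrite (le_trans _ (sin_geN1 x))// lerN2 ltW.
Qed.

Lemma cos_ge x : 1 - x ^+ 2 / 2 <= cos x.
Proof. by rewrite cos_half; have := sqr_sin_le (x / 2); rewrite expr_div_n; lra. Qed.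

Lemma sqr_sin_ge x : x ^+ 2 <= 1 -> (1 - x ^+ 2) * x ^+ 2 <= sin x ^+ 2.
Proof.
wlog x0 : x / 0 <= x => [h|x1].
  case: (leP 0 x) => [/h//|/ltW x0].
  by rewrite -[sin x ^+ 2]sqrrN -sinN -sqrrN; apply: h; rewrite oppr_ge0.
move: x0; rewrite le_eqVlt => /predU1P[<-|x0]; first by rewrite sin0; lra.
have [z /andP[z0 zx] ->] := sin_mvt x0.
have z2 : z ^+ 2 <= x ^+ 2 by rewrite ler_sqr ?nnegrE ltW.
have h := cos_ge z; rewrite exprMn ler_wpM2r ?sqr_ge0//.
have : 1 - x ^+ 2 / 2 <= cos z by lra.
by move=> h2; nra.
Qed.

(** Doubling the angle and the mean value theorem give sin x = x cos z cos (x / 2) with both angles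
    below 1, where the cosines are at least 1 / 2. *)
Lemma sin_ge_quarter x : 0 <= x <= pi / 2 -> x / 4 <= sin x.
Proof.
move=> /andP[]; rewrite le_eqVlt => /predU1P[<-|x0 xp].
  by rewrite sin0 mul0r.
have -> : sin x = 2 * (sin (x / 2) * cos (x / 2)).
  by rewrite [in LHS](splitr x) -mulr2n sin_mulr2n; ring.
have h0 : 0 < x / 2 by rewrite divr_gt0.
have [z /andP[z0 zx] ->] := sin_mvt h0.
have pi4 := pihalf_lt2 R.
have hz : z ^+ 2 <= 1 by rewrite expr_le1 ?ltW//; lra.
have hx : (x / 2) ^+ 2 <= 1 by rewrite expr_le1 ?ltW//; lra.
have c1 := cos_ge z; have c2 := cos_ge (x / 2).
have d1 : 1 / 2 <= cos z by lra.
have d2 : 1 / 2 <= cos (x / 2) by lra.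
have : 1 / 2 <= 2 * (cos z * cos (x / 2)) by nra.
by move=> h; have := ler_wpM2l (ltW h0) h; lra.
Qed.

(** With [exp_le_cos] this compares a cosine with a Gaussian up to a factor 1 +- eta in the
    exponent. A product of cosines is thereby controlled by the sum of the squared angles alone. *)
Lemma cos_le_exp (eta x : R) : 0 <= eta <= 1 -> x ^+ 2 <= eta ->
  cos x <= expR (- ((1 - eta) * (x ^+ 2 / 2))).
Proof.
move=> /andP[e0 e1] xe.
have x2 := sqr_ge0 x; have h := @sqr_sin_ge (x / 2).
rewrite expr_div_n in h.
have h2 : (1 - eta) * (x ^+ 2 / 2) <= 2 * sin (x / 2) ^+ 2.
  have h3 := h ltac:(lra).
  have : 0 <= (eta - x ^+ 2 / 2 ^+ 2) * x ^+ 2 by apply: mulr_ge0 => //; lra.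
  lra.
rewrite cos_half; apply: le_trans (expR_ge1Dx _) _.
by rewrite ler_expR; lra.
Qed.

Lemma exp_le_cos (eta x : R) : 0 <= eta <= 1 -> x ^+ 2 <= eta ->
  expR (- ((1 + eta) * (x ^+ 2 / 2))) <= cos x.
Proof.
move=> /andP[e0 e1] xe; have x2 := sqr_ge0 x.
apply: le_trans (cos_ge x); set y := x ^+ 2 / 2.
have y0 : 0 <= y by rewrite divr_ge0.
have y1 : 2 * y <= eta by rewrite /y; lra.
rewrite expRN -[leRHS]invrK lef_pV2 ?posrE ?expR_gt0 ?invr_gt0 ?subr_gt0//; last lra.
apply: le_trans (expR_ge1Dx _); rewrite -[leLHS]mul1r ler_pdivrMr; nra.
Qed.

End TrigonometricBounds.

(** * Finite Fourier expansion of the triangle wave on the integers *)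

Section TriangleWave.
Variables (R : realType) (Q : nat).
Hypothesis Q0 : (0 < Q)%N.

Let QR : 0 < Q%:R :> R. Proof. by rewrite ltr0n. Qed.
Let QN : Q%:R != 0 :> R. Proof. by rewrite gt_eqF. Qed.

Lemma dirichlet_odd (x : R) (n : nat) :
  2 * sin x * \sum_(i < n) cos ((2 * i + 1)%:R * x) = sin ((2 * n)%:R * x).
Proof.
elim: n => [|n IH]; first by rewrite big_ord0 mulr0 muln0 mul0r sin0.
rewrite big_ord_recr/= mulrDr IH.
have -> : (2 * n.+1)%:R * x = (2 * n + 1)%:R * x + x by rewrite mulnS !natrD; ring.
have -> : (2 * n)%:R * x = (2 * n + 1)%:R * x - x by rewrite natrD; ring.
by rewrite sinB sinD; ring.
Qed.

Lemma sin_pi_nat (n : nat) : sin (n%:R * pi) = 0 :> R.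
Proof.
by rewrite mulr_natl -[_ *+ _]add0r (alternatingn (@sinDpi R)) sin0 mulr0.
Qed.

Lemma cos_oddpi (i : nat) (x : R) :
  cos ((2 * i + 1)%:R * (x + pi)) = - cos ((2 * i + 1)%:R * x).
Proof.
rewrite mulrDr [X in _ + X]mulr_natl (alternatingn (@cosDpi R)) -signr_odd oddD.
by rewrite mul2n odd_double expr1 mulN1r.
Qed.

(** Fourier coefficient of the triangle wave of period 2 Q at the odd frequency 2 i + 1. Restricting
    to integer arguments keeps the series finite, so that no convergence question arises. *)
Definition wave_coef (i : nat) : R :=
  (2 * Q%:R ^+ 2 * sin ((2 * i + 1)%:R * pi / (2 * Q%:R)) ^+ 2)^-1.

Definition wave (e : nat) : R :=
  \sum_(i < Q) wave_coef i * (1 - cos ((2 * i + 1)%:R * (pi * e%:R / Q%:R))).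

Let half_angle i : (i < Q)%N -> 0 < (2 * i + 1)%:R * pi / (2 * Q%:R) :> R /\
  (2 * i + 1)%:R * pi / (2 * Q%:R) < pi :> R.
Proof.
move=> iQ; have p0 := pi_gt0 R; split; first by rewrite divr_gt0 ?mulr_gt0 ?ltr0n ?addn1.
rewrite ltr_pdivrMr ?mulr_gt0// mulrC ltr_pM2l// -natrM ltr_nat.
by lia.
Qed.

Let half_sin_neq0 i : (i < Q)%N -> sin ((2 * i + 1)%:R * pi / (2 * Q%:R)) != 0 :> R.
Proof. by move=> /half_angle[h1 h2]; rewrite gt_eqF// sin_gt0_pi// h1. Qed.

Lemma wave0 : wave 0 = 0.
Proof.
by rewrite /wave big1// => i _; rewrite mulr0 mul0r mulr0 cos0 subrr mulr0.
Qed.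

Let theta (i : nat) : R := (2 * i + 1)%:R * (pi / Q%:R).

Let wave_coef_theta i : (i < Q)%N ->
  wave_coef i * (1 - cos (theta i)) = (Q%:R ^+ 2)^-1.
Proof.
move=> iQ; rewrite cos_half /wave_coef.
have -> : theta i / 2 = (2 * i + 1)%:R * pi / (2 * Q%:R) by rewrite /theta; field.
have := half_sin_neq0 iQ; set s := sin _ => s0.
by field; rewrite QN s0.
Qed.

Let wave_theta e : wave e = \sum_(i < Q) wave_coef i * (1 - cos (theta i * e%:R)).
Proof.
by apply: eq_bigr => i _; congr (_ * (1 - cos _)); rewrite /theta; ring.
Qed.

Lemma wave1 : wave 1 = Q%:R^-1.
Proof.
rewrite wave_theta (eq_bigr (fun=> (Q%:R ^+ 2)^-1)); last first.
  by move=> i _; rewrite mulr1 wave_coef_theta.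
by rewrite sumr_const card_ord -mulr_natr; field.
Qed.

(** The coefficients are normalised so that every term has second difference 2 Q^-2 times its
    cosine; the sum of these cosines is a Dirichlet kernel, which vanishes strictly between 0 and
    Q. *)
Lemma wave_second_diff e : (0 < e < Q)%N ->
  wave e.+1 + wave e.-1 = 2 * wave e.
Proof.
move=> /andP[e0 eQ].
suff : wave e.+1 + wave e.-1 - 2 * wave e = 0 by move/eqP; rewrite subr_eq0 => /eqP.
rewrite !wave_theta mulr_sumr -big_split/= -sumrB.
have E (i : 'I_Q) : wave_coef i * (1 - cos (theta i * e.+1%:R)) +
   wave_coef i * (1 - cos (theta i * e.-1%:R)) -
   2 * (wave_coef i * (1 - cos (theta i * e%:R))) =
   2 * (Q%:R ^+ 2)^-1 * cos ((2 * i + 1)%:R * (pi * e%:R / Q%:R)).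
  rewrite -(wave_coef_theta (ltn_ord i)).
  have -> : (2 * i + 1)%:R * (pi * e%:R / Q%:R) = theta i * e%:R.
    by rewrite /theta; ring.
  have -> : theta i * e.+1%:R = theta i * e%:R + theta i by rewrite -natr1; ring.
  have -> : theta i * e.-1%:R = theta i * e%:R - theta i.
    by rewrite -[in RHS](prednK e0) -natr1; ring.
  by rewrite cosD cosB; ring.
under eq_bigr do rewrite E.
rewrite -mulr_sumr.
have := dirichlet_odd (pi * e%:R / Q%:R) Q.
have -> : (2 * Q)%:R * (pi * e%:R / Q%:R) = (2 * e)%:R * pi :> R.
  by rewrite !natrM; field.
rewrite sin_pi_nat => /eqP; rewrite !mulf_eq0 pnatr_eq0/= => /orP[/eqP s0|/eqP ->]; last first.
  by rewrite mulr0.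
have : 0 < sin (pi * e%:R / Q%:R) :> R.
  have p0 := pi_gt0 R.
  apply: sin_gt0_pi; rewrite divr_gt0 ?mulr_gt0 ?ltr0n//=.
  by rewrite ltr_pdivrMr// ltr_pM2l// ltr_nat.
by rewrite s0 ltxx.
Qed.

(** Vanishing second differences and the values at 0 and 1 determine the wave up to Q. *)
Lemma wave_linear e : (e <= Q)%N -> wave e = e%:R / Q%:R.
Proof.
case: e => [|e]; first by rewrite wave0 mul0r.
suff : (e.+1 <= Q)%N -> wave e = e%:R / Q%:R /\ wave e.+1 = e.+1%:R / Q%:R.
  by move=> h /h[].
elim: e => [_|e IH eQ]; first by rewrite wave0 wave1 mul0r mul1r.
have [h1 h2] := IH (ltnW eQ); split=> //.
have := @wave_second_diff e.+1 eQ; rewrite /= h1 h2 => /(canRL (addrK _)) ->.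
by rewrite -!natr1; field.
Qed.

(** Every odd frequency changes sign after half a period, and twice the sum of the coefficients is
    [wave Q = 1]. *)
Lemma wave_half_period e : wave (e + Q) = 1 - wave e.
Proof.
have E i : (2 * i + 1)%:R * (pi * (e + Q)%:R / Q%:R) =
    (2 * i + 1)%:R * (pi * e%:R / Q%:R + pi) :> R by rewrite natrD; field.
have h : wave Q = 1 by rewrite wave_linear// divff.
have h2 : \sum_(i < Q) wave_coef i *+ 2 = 1.
  rewrite -h /wave; apply: eq_bigr => i _.
  rewrite mulfK// -[X in cos (_ * X)]add0r cos_oddpi mulr0 cos0 opprK mulr2n; ring.
rewrite -h2 /wave -sumrB; apply: eq_bigr => i _.
by rewrite E cos_oddpi opprK mulr2n; ring.
Qed.

(* [odd (n %/ Q)] is a square wave of period 2 Q in n. *)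
Definition flips (n n' : nat) : nat :=
  \sum_(j < 2 * Q) (odd ((n + j) %/ Q) (+) odd ((n' + j) %/ Q)).

Let odd_shift n : odd ((n + Q) %/ Q) = ~~ odd (n %/ Q).
Proof. by rewrite divnDr ?dvdnn// divnn Q0 addn1. Qed.

Lemma flips_half_period n n' : (flips (n + Q) n' + flips n n' = 2 * Q)%N.
Proof.
rewrite -big_split/= -[RHS]card_ord -sum1_card; apply: eq_bigr => j _.
by rewrite addnAC odd_shift; case: odd; case: odd.
Qed.

Lemma sum_period (h : nat -> nat) (n k : nat) : (forall j, h (j + k)%N = h j) ->
  (\sum_(j < k) h (n + j) = \sum_(j < k) h j)%N.
Proof.
move=> hk; elim: n => [|n IH]; first by apply: eq_bigr => j _; rewrite add0n.
rewrite -IH; case: k hk {IH} => [|k] hk; first by rewrite !big_ord0.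
rewrite big_ord_recr/= [RHS]big_ord_recl/= addn0 addSnnS hk addnC.
by congr addn; apply: eq_bigr => i _; rewrite /bump/= addSnnS.
Qed.

Lemma flips_sub n n' : (n' <= n)%N -> flips n n' = flips (n - n') 0.
Proof.
move=> nn; pose h j := (odd ((n - n' + j) %/ Q) (+) odd (j %/ Q) : nat).
transitivity (\sum_(j < 2 * Q) h (n' + j))%N.
  by apply: eq_bigr => j _; rewrite /h addnA subnK.
rewrite sum_period => [|j]; first by apply: eq_bigr => j _; rewrite /h add0n.
by rewrite /h mul2n -addnn !addnA !odd_shift; case: odd; case: odd.
Qed.

Lemma flipsC n n' : flips n n' = flips n' n.
Proof. by apply: eq_bigr => j _; rewrite addbC. Qed.

(** In one period the two square waves differ exactly on the two windows of length e that precede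
    the jumps at Q and 2 Q. *)
Lemma flips_small e : (e < Q)%N -> flips e 0 = (2 * e)%N.
Proof.
move=> eQ; rewrite /flips.
have E j : (j < 2 * Q)%N ->
    odd ((e + j) %/ Q) (+) odd ((0 + j) %/ Q) = (Q - e <= j < Q)%N || (2 * Q - e <= j)%N.
  move=> jQ; rewrite add0n.
  have q1 x : (x < Q)%N -> (x %/ Q = 0)%N by exact: divn_small.
  have q2 x : (Q <= x < 2 * Q)%N -> (x %/ Q = 1)%N.
    move=> /andP[a b]; rewrite -(subnK a) divnDr ?dvdnn// divnn Q0 q1//; lia.
  have q3 x : (2 * Q <= x < 3 * Q)%N -> (x %/ Q = 2)%N.
    move=> /andP[a b]; rewrite -(subnK a) mulnC divnDr ?dvdn_mulr// mulKn// q1//; lia.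
  case: (ltnP j Q) => jQ1.
    rewrite (q1 j)//; case: (ltnP (e + j) Q) => h; [rewrite q1//|rewrite q2]; lia.
  rewrite (q2 j) ?jQ1//; case: (ltnP (e + j) (2 * Q)) => h; [rewrite q2|rewrite q3]; lia.
rewrite (eq_bigr (fun j : 'I_(2 * Q) =>
    ((Q - e <= j < Q)%N || (2 * Q - e <= j)%N : nat))); last first.
  by move=> j _; rewrite E.
rewrite -(big_mkord xpredT (fun j => ((Q - e <= j < Q)%N || (2 * Q - e <= j)%N : nat))).
have c a b (f : nat -> nat) v : (a <= b)%N -> (forall j, (a <= j < b)%N -> f j = v) ->
    (\sum_(a <= j < b) f j = v * (b - a))%N.
  by move=> ab fv; rewrite (eq_big_nat _ _ fv) sum_nat_const_nat mulnC.
rewrite (@big_cat_nat _ _ _ (Q - e))/=; [|lia|lia].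
rewrite (c _ _ _ 0%N); [|lia|lia].
rewrite (@big_cat_nat _ _ _ Q)/=; [|lia|lia].
rewrite (c _ _ _ 1%N); [|lia|lia].
rewrite (@big_cat_nat _ _ _ (2 * Q - e))/=; [|lia|lia].
rewrite (c _ _ _ 0%N); [|lia|lia].
rewrite (c _ _ _ 1%N); [|lia|lia].
lia.
Qed.

(** Two shifted square waves disagree on a fraction of the offsets that is the triangle wave of
    their shift: linear below Q, and both sides turn into 1 minus themselves under a shift by Q. *)
Lemma flips_wave e : (flips e 0)%:R / (2 * Q%:R) = wave e.
Proof.
have [k [e0 [e0Q ->]]] : exists k e0, (e0 < Q)%N /\ e = (e0 + k * Q)%N.
  by exists (e %/ Q)%N, (e %% Q)%N; rewrite ltn_pmod// addnC -divn_eq.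
elim: k => [|k IH].
  by rewrite mul0n addn0 flips_small// wave_linear 1?ltnW// natrM; field.
rewrite mulSn (addnC Q) addnA wave_half_period -IH.
have := flips_half_period (e0 + k * Q) 0.
move/(congr1 (fun x : nat => x%:R : R)); rewrite natrD natrM => /(canRL (addrK _)) ->.
by field.
Qed.

End TriangleWave.

(** * Truncation of the expansion, and its Gaussian average *)

Section TruncatedWave.
Variables (R : realType) (P Q : nat).
Hypotheses (P0 : (0 < P)%N) (QE : Q = (2 * P)%N).

Let Q0 : (0 < Q)%N. Proof. by rewrite QE muln_gt0. Qed.
Let QR : 0 < Q%:R :> R. Proof. by rewrite ltr0n. Qed.
Let QN : Q%:R != 0 :> R. Proof. by rewrite gt_eqF. Qed.

Definition fold_coef (i : nat) : R := 2 * wave_coef R Q i.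

Lemma fold_coef_ge0 i : 0 <= fold_coef i.
Proof. by rewrite mulr_ge0// invr_ge0 mulr_ge0 ?sqr_ge0// mulr_ge0 ?sqr_ge0. Qed.

(** The frequencies k and 2 Q - k have the same coefficient and the same cosine at integers. After
    folding, all angles k pi / (2 Q) are at most pi / 2, where the sine is bounded below linearly
    and the coefficients decay like k^-2. *)
Lemma wave_fold e : wave R Q e =
  \sum_(i < P) fold_coef i * (1 - cos ((2 * i + 1)%:R * (pi * e%:R / Q%:R))).
Proof.
pose f i := wave_coef R Q i * (1 - cos ((2 * i + 1)%:R * (pi * e%:R / Q%:R))).
have fr i : (i < P)%N -> f (P + (P - i.+1))%N = f i.
  move=> iP; rewrite /f /wave_coef.
  have -> : (2 * (P + (P - i.+1)) + 1)%:R = 2 * Q%:R - (2 * i + 1)%:R :> R.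
    have E : (2 * (P + (P - i.+1)) + 1 + (2 * i + 1) = 2 * Q)%N by rewrite QE; lia.
    by rewrite -natrM -E [in RHS]natrD addrK.
  congr (( _ * _ ^+ 2)^-1 * (1 - _)).
    have -> : (2 * Q%:R - (2 * i + 1)%:R) * pi / (2 * Q%:R) =
        - ((2 * i + 1)%:R * pi / (2 * Q%:R)) + pi :> R by field.
    by rewrite sinDpi sinN opprK.
  have -> : (2 * Q%:R - (2 * i + 1)%:R) * (pi * e%:R / Q%:R) =
      - ((2 * i + 1)%:R * (pi * e%:R / Q%:R)) + (pi *+ 2) *+ e :> R.
    by rewrite -[pi *+ 2]mulr_natr -[_ *+ e]mulr_natr; field.
  by rewrite periodicn ?cosN//; exact: cosD2pi.
rewrite /wave -(big_mkord xpredT f) [in LHS]QE mul2n -addnn.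
rewrite (@big_cat_nat _ _ _ P)//= ?leq_addr// big_mkord.
rewrite [X in _ + X](_ : _ = \sum_(0 + P <= i < P + P) f i)// big_addn addnK big_mkord.
rewrite [X in _ + X](_ : _ = \sum_(i < P) f i); last first.
  rewrite (reindex_inj rev_ord_inj)/=; apply: eq_bigr => i _.
  by rewrite addnC fr.
by rewrite -big_split/=; apply: eq_bigr => i _; rewrite /f /fold_coef; ring.
Qed.

Lemma fold_coef_le i : (i < P)%N -> fold_coef i <= 16 / (2 * i + 1)%:R ^+ 2.
Proof.
move=> iP; rewrite /fold_coef /wave_coef.
have k0 : 0 < (2 * i + 1)%:R :> R by rewrite ltr0n addn1.
set k := (2 * i + 1)%:R in k0 *.
have p0 := pi_gt0 R; have p2 := pi_ge2 R.
have x0 : 0 < k * pi / (2 * Q%:R) by rewrite divr_gt0 ?mulr_gt0.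
have xp : k * pi / (2 * Q%:R) <= pi / 2.
  rewrite ler_pdivrMr ?mulr_gt0// mulrC -mulrA ler_wpM2l ?(ltW p0)//.
  by rewrite mulrA mulVf// mul1r ler_nat QE; lia.
have := @sin_ge_quarter _ (k * pi / (2 * Q%:R)); rewrite (ltW x0) xp => /(_ isT).
set s := sin _ => hs.
have q0 : 0 < k * pi / (2 * Q%:R) / 4 by rewrite divr_gt0.
have s0 : 0 < s by rewrite (lt_le_trans q0).
have s2 : (k * pi / (2 * Q%:R) / 4) ^+ 2 <= s ^+ 2.
  by rewrite ler_sqr ?nnegrE ?(ltW q0) ?(ltW s0).
have h : k ^+ 2 / 16 <= Q%:R ^+ 2 * s ^+ 2.
  apply: le_trans (ler_wpM2l (sqr_ge0 Q%:R) s2).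
  have -> : Q%:R ^+ 2 * (k * pi / (2 * Q%:R) / 4) ^+ 2 = k ^+ 2 / 64 * pi ^+ 2 :> R by field.
  have : 2 ^+ 2 <= pi ^+ 2 :> R by rewrite ler_sqr ?nnegrE ?(ltW p0).
  have k2 : 0 < k ^+ 2 / 64 by rewrite divr_gt0 ?exprn_gt0.
  by move=> /(ler_wpM2l (ltW k2)); lra.
have -> : 2 * (2 * Q%:R ^+ 2 * s ^+ 2)^-1 = (Q%:R ^+ 2 * s ^+ 2)^-1.
  by field; rewrite QN gt_eqF.
rewrite -[leRHS]invf_div lef_pV2 ?posrE ?divr_gt0 ?exprn_gt0//.
by rewrite mulr_gt0 ?exprn_gt0.
Qed.

Lemma fold_coef0_ge : 4^-1 <= fold_coef 0.
Proof.
rewrite /fold_coef /wave_coef muln0 add0n mul1r.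
have p0 := pi_gt0 R; have p4 : pi < 4 :> R by have := pihalf_lt2 R; lra.
have Q1 : 1 <= Q%:R :> R by rewrite ler1n.
have h := @sqr_sin_le R (pi / (2 * Q%:R)).
have x0 : 0 < pi / (2 * Q%:R) :> R by rewrite divr_gt0 ?mulr_gt0.
have s0 : 0 < sin (pi / (2 * Q%:R)) :> R.
  apply: sin_gt0_pi; rewrite x0/= ltr_pdivrMr ?mulr_gt0// ltr_pMr//; lra.
set s := sin _ in h s0 *.
have -> : 2 * (2 * Q%:R ^+ 2 * s ^+ 2)^-1 = (Q%:R ^+ 2 * s ^+ 2)^-1.
  by field; rewrite QN gt_eqF.
rewrite lef_pV2 ?posrE ?mulr_gt0 ?exprn_gt0//.
apply: (le_trans (ler_wpM2l (sqr_ge0 Q%:R) h)).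
have -> : Q%:R ^+ 2 * (pi / (2 * Q%:R)) ^+ 2 = pi ^+ 2 / 4 :> R by field.
have : pi ^+ 2 <= 4 ^+ 2 :> R by rewrite ler_sqr ?nnegrE ?(ltW p0) ?(ltW p4).
lra.
Qed.

Lemma sum_inv_odd_sqr (a b : nat) : (0 < a)%N ->
  \sum_(a <= i < b) ((2 * i + 1)%:R ^+ 2)^-1 <= (4 * a%:R)^-1 :> R.
Proof.
move=> a0; have [ab|ba] := leqP a b; last first.
  by rewrite big_geq 1?ltnW// invr_ge0 mulr_ge0.
(* Telescoping comparison: (2 n + 1)^-2 is at most 1 / (4 n (n + 1)). *)
apply: (@le_trans _ _ (4^-1 * (a%:R^-1 - b%:R^-1))); last first.
  have : 0 <= b%:R^-1 :> R by rewrite invr_ge0.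
  rewrite invfM; lra.
rewrite -(subnKC ab); elim: (b - a)%N => [|k IH].
  by rewrite addn0 big_geq// subrr mulr0.
rewrite addnS big_nat_recr/= ?leq_addr//; apply: le_trans (lerD IH (lexx _)) _.
have n0 : (0 < a + k)%N by rewrite addn_gt0 a0.
set n := (a + k)%N in n0 *.
have nR : 0 < n%:R :> R by rewrite ltr0n.
rewrite -[n.+1%:R]natr1 natrD natrM.
have -> : 4^-1 * (a%:R^-1 - (n%:R + 1)^-1) = 4^-1 * (a%:R^-1 - n%:R^-1) +
   (4 * (n%:R * (n%:R + 1)))^-1 :> R.
  by field; rewrite !gt_eqF// ?addr_gt0// ltr0n.
rewrite lerD2l lef_pV2 ?posrE ?exprn_gt0 ?mulr_gt0 ?addr_gt0 ?mulr_gt0//.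
nra.
Qed.

(** The function F of the squared distance sigma^2, read at tau = pi^2 sigma^2 / 2 and cut off at I
    frequencies. *)
Definition gauss_wave (I : nat) (tau : R) : R :=
  \sum_(0 <= i < I) fold_coef i * (1 - expR (- ((2 * i + 1)%:R ^+ 2 * tau))).

Definition cos_wave (I : nat) (x : R) : R :=
  \sum_(0 <= i < I) fold_coef i * (1 - cos ((2 * i + 1)%:R * (pi * x))).

Lemma gauss_wave_mono I : {homo gauss_wave I : x y / x <= y}.
Proof.
move=> x y xy; apply: ler_sum => i _; rewrite ler_wpM2l ?fold_coef_ge0//.
by rewrite lerD2l lerN2 ler_expR lerN2 ler_wpM2l ?sqr_ge0.
Qed.

Lemma fold_coef_tail (a I : nat) : (0 < a)%N -> (I <= P)%N ->
  \sum_(a <= i < I) fold_coef i <= 4 / a%:R.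
Proof.
move=> a0 IP; apply: (@le_trans _ _ (16 * \sum_(a <= i < I) ((2 * i + 1)%:R ^+ 2)^-1)).
  by rewrite mulr_sumr; apply: ler_sum_nat => i /andP[_ iI];
     apply: fold_coef_le; rewrite (leq_trans iI).
have := ler_wpM2l (ler0n R 16) (@sum_inv_odd_sqr a I a0).
by rewrite invfM mulrA; congr (_ <= _ * _); lra.
Qed.

Lemma expRN_ge (x : R) : 1 - expR (- x) <= x.
Proof. by have := expR_ge1Dx (- x); lra. Qed.

(** The sum is split at about 1 / sqrt tau. Each lower term is at most 16 tau by 1 - exp (- x) <= x,
    which adds up to 32 sqrt tau; the coefficients of the tail add up to 4 sqrt tau. *)
Lemma gauss_wave_le (I : nat) (tau : R) : (I <= P)%N -> 0 < tau <= 1 ->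
  gauss_wave I tau <= 36 * Num.sqrt tau.
Proof.
move=> IP /andP[t0 t1].
have s0 : 0 < Num.sqrt tau by rewrite sqrtr_gt0.
have s1 : Num.sqrt tau <= 1 by rewrite -[leRHS]sqrtr1 ler_wsqrtr.
have ss : tau = Num.sqrt tau ^+ 2 by rewrite sqr_sqrtr// ltW.
set s := Num.sqrt tau in s0 s1 ss *.
pose a := (Num.truncn s^-1).+1.
have sv : 1 <= s^-1 by rewrite -invr1 lef_pV2 ?posrE.
have /andP[a1 a2] := truncn_itv (le_trans ler01 sv).
have a3 : a%:R <= 2 * s^-1 by rewrite /a -natr1; lra.
have term i : (i < P)%N -> fold_coef i * (1 - expR (- ((2 * i + 1)%:R ^+ 2 * tau))) <= 16 * tau.
  move=> iP; have k0 : 0 < (2 * i + 1)%:R ^+ 2 :> R by rewrite exprn_gt0// ltr0n addn1.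
  apply: le_trans (ler_wpM2l (fold_coef_ge0 i) (expRN_ge _)) _.
  have := ler_wpM2r (mulr_ge0 (ltW k0) (ltW t0)) (fold_coef_le iP).
  by move=> h; apply: le_trans h _; rewrite mulrA divfK// gt_eqF.
have term2 i : fold_coef i * (1 - expR (- ((2 * i + 1)%:R ^+ 2 * tau))) <= fold_coef i.
  by rewrite ler_piMr ?fold_coef_ge0// lerBlDr lerDl expR_ge0.
have step (b : nat) : (b <= a)%N -> (b <= P)%N -> gauss_wave b tau <= 32 * s.
  move=> ba bP; rewrite /gauss_wave.
  apply: (@le_trans _ _ (\sum_(0 <= i < b) 16 * tau)).
    by apply: ler_sum_nat => i /andP[_ ib]; apply: term; rewrite (leq_trans ib).
  rewrite sumr_const_nat subn0 -[_ *+ b]mulr_natr.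
  have h : b%:R <= 2 * s^-1 by apply: le_trans a3; rewrite ler_nat.
  have t16 : 0 <= 16 * tau by rewrite mulr_ge0// ltW.
  apply: le_trans (ler_wpM2l t16 h) _.
  have -> : 16 * tau * (2 * s^-1) = 32 * s by rewrite ss; field; rewrite gt_eqF.
  exact: lexx.
have [Ia|aI] := leqP I a; first by apply: le_trans (step _ Ia IP) _; lra.
have := step a (leqnn a) (leq_trans (ltnW aI) IP).
rewrite /gauss_wave (@big_cat_nat _ _ _ a 0 I)//= 1?ltnW// => h.
have : \sum_(a <= i < I) fold_coef i * (1 - expR (- ((2 * i + 1)%:R ^+ 2 * tau))) <= 4 * s.
  apply: (@le_trans _ _ (\sum_(a <= i < I) fold_coef i)).
    by apply: ler_sum => i _; exact: term2.
  apply: le_trans (@fold_coef_tail a I _ IP) _ => //.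
  by rewrite ler_pM2l// -[leRHS]invrK lef_pV2 ?posrE ?invr_gt0 ?ltr0n// ltW.
lra.
Qed.

(** Frequency 1 alone suffices: its coefficient is at least 1 / 4, and 1 - exp (- tau) >= tau / 2 on
    [0, 1]. *)
Lemma gauss_wave_ge (I : nat) (tau : R) : (0 < I)%N -> 0 <= tau <= 1 ->
  tau / 8 <= gauss_wave I tau.
Proof.
move=> I0 /andP[t0 t1]; rewrite /gauss_wave big_ltn//.
have h : 0 <= \sum_(1 <= i < I) fold_coef i * (1 - expR (- ((2 * i + 1)%:R ^+ 2 * tau))).
  apply: sumr_ge0 => i _; rewrite mulr_ge0 ?fold_coef_ge0// subr_ge0.
  by rewrite -expR0 ler_expR oppr_le0 mulr_ge0 ?sqr_ge0.
rewrite muln0 add0n expr1n mul1r.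
suff : tau / 2 <= 1 - expR (- tau).
  move=> h2; have := ler_wpM2r (le_trans (divr_ge0 t0 (ler0n R 2)) h2) fold_coef0_ge.
  lra.
rewrite expRN lerBrDr -lerBrDl -[leRHS]invrK lef_pV2 ?posrE ?expR_gt0 ?invr_gt0//; last lra.
apply: le_trans (expR_ge1Dx _); rewrite -[leLHS]mul1r ler_pdivrMr; nra.
Qed.

Lemma cos_lipschitz (x y : R) : `|cos x - cos y| <= `|x - y|.
Proof.
have -> : cos x - cos y = - (2 * (sin ((x + y) / 2) * sin ((x - y) / 2))).
  have := cosD ((x + y) / 2) ((x - y) / 2); have := cosB ((x + y) / 2) ((x - y) / 2).
  have -> : (x + y) / 2 - (x - y) / 2 = y by field.
  have -> : (x + y) / 2 + (x - y) / 2 = x by field.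
  by move=> -> ->; ring.
rewrite normrN !normrM (@ger0_norm _ 2)//.
have h : `|sin ((x - y) / 2)| <= `|(x - y) / 2|.
  by rewrite -ler_sqr ?nnegrE// !real_normK ?num_real// sqr_sin_le.
have h2 := sin_max ((x + y) / 2).
have : `|sin ((x + y) / 2)| * `|sin ((x - y) / 2)| <= 1 * `|(x - y) / 2|.
  exact: ler_pM.
by rewrite mul1r normrM normfV (@ger0_norm _ 2)//; lra.
Qed.

(* The error of replacing the integer e by Q x, and of dropping the high frequencies. *)
Lemma wave_cos_wave (I e : nat) (x : R) : (0 < I <= P)%N ->
  `|e%:R - `|Q%:R * x| | <= 1 ->
  cos_wave I x - 64 * I%:R / Q%:R <= wave R Q e <=
  cos_wave I x + 64 * I%:R / Q%:R + 8 / I%:R.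
Proof.
move=> /andP[I0 IP] ex.
pose f i := fold_coef i * (1 - cos ((2 * i + 1)%:R * (pi * e%:R / Q%:R))).
have fE : wave R Q e = \sum_(0 <= i < I) f i + \sum_(I <= i < P) f i.
  by rewrite wave_fold -(big_mkord xpredT f) (@big_cat_nat _ _ _ I).
have f0 i : 0 <= f i.
  by rewrite mulr_ge0 ?fold_coef_ge0// subr_ge0 cos_le1.
have tail0 : 0 <= \sum_(I <= i < P) f i by apply: sumr_ge0.
have tail1 : \sum_(I <= i < P) f i <= 8 / I%:R.
  have -> : 8 / I%:R = 4 / I%:R * 2 :> R by rewrite mulrAC; congr (_ / _); lra.
  apply: le_trans (ler_wpM2r _ (@fold_coef_tail I P I0 (leqnn P))) => //.
  rewrite mulr_suml; apply: ler_sum => i _; rewrite ler_wpM2l ?fold_coef_ge0//.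
  by have := @cos_geN1 R ((2 * i + 1)%:R * (pi * e%:R / Q%:R)); lra.
have main : `|\sum_(0 <= i < I) f i - cos_wave I x| <= 64 * I%:R / Q%:R.
  rewrite /cos_wave -sumrB; apply: le_trans (ler_norm_sum _ _ _) _.
  have -> : 64 * I%:R / Q%:R = \sum_(0 <= i < I) 64 / Q%:R :> R.
    by rewrite [RHS]sumr_const_nat subn0 -[RHS]mulr_natr mulrAC.
  apply: ler_sum_nat => i /andP[_ iI]; have iP := leq_trans iI IP.
  have k0 : 0 < (2 * i + 1)%:R :> R by rewrite ltr0n addn1.
  have p0 := pi_gt0 R; have p4 : pi < 4 :> R by have := pihalf_lt2 R; lra.
  rewrite /f -mulrBr normrM (ger0_norm (fold_coef_ge0 i)) opprB addrC addrA subrK.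
  set k := (2 * i + 1)%:R in k0 *.
  have h : `|cos (k * (pi * x)) - cos (k * (pi * e%:R / Q%:R))| <= k * 4 / Q%:R.
    rewrite -(cos_norm (k * (pi * x))); apply: le_trans (cos_lipschitz _ _) _.
    have -> : `|k * (pi * x)| - k * (pi * e%:R / Q%:R) =
        k * pi / Q%:R * (`|Q%:R * x| - e%:R).
      by rewrite !normrM (gtr0_norm k0) (gtr0_norm p0) (gtr0_norm QR); field.
    rewrite normrM distrC ger0_norm; last by rewrite !mulr_ge0 ?invr_ge0// ltW.
    have kq : 0 <= k * pi / Q%:R by rewrite !mulr_ge0 ?invr_ge0 ?(ltW k0) ?(ltW p0).
    apply: le_trans (ler_wpM2l kq ex) _; rewrite mulr1.
    by rewrite ler_wpM2r ?invr_ge0 ?ler0n// ler_wpM2l ?(ltW k0) ?(ltW p4).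
  apply: le_trans (ler_wpM2l (fold_coef_ge0 i) h) _.
  have kq : 0 <= k * 4 / Q%:R by rewrite !mulr_ge0 ?invr_ge0 ?(ltW k0).
  apply: le_trans (ler_wpM2r kq (fold_coef_le iP)) _.
  have -> : 16 / k ^+ 2 * (k * 4 / Q%:R) = 64 / Q%:R * k^-1.
    by field; rewrite QN gt_eqF.
  rewrite ler_piMr ?divr_ge0// -invr1 lef_pV2 ?posrE//.
  by rewrite /k ler1n addn1.
move: main; rewrite ler_norml fE => /andP[h1 h2]; apply/andP; split; lra.
Qed.

End TruncatedWave.

(** * Hash functions on random tapes *)

Section TapeAverage.
Variable R : realType.
Implicit Types (X Y : (nat -> bool) -> R) (u v w : nat -> bool).

Definition scons (b : bool) w (t : nat) : bool := if t is t'.+1 then w t' else b.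

Fixpoint tcat (a : nat) u v : nat -> bool :=
  if a is a'.+1 then scons (u 0) (tcat a' (fun t => u t.+1) v) else v.

Definition tdrop (a : nat) u (t : nat) : bool := u (a + t)%N.

Lemma tcat_lt a u v t : (t < a)%N -> tcat a u v t = u t.
Proof. by elim: a u t => // a IH u [|t] //= ta; rewrite IH. Qed.

Lemma tcat_drop a u v : tdrop a (tcat a u v) = v.
Proof.
apply/funext => t; rewrite /tdrop; elim: a u => [|a IH] u //=; exact: IH.
Qed.

Lemma tcat_eq a u v : tcat a u v a = v 0%N.
Proof. by have := congr1 (@^~ 0%N) (tcat_drop a u v); rewrite /tdrop addn0. Qed.

Lemma tdropD a b u : tdrop a (tdrop b u) = tdrop (b + a) u.
Proof. by apply/funext => t; rewrite /tdrop addnA. Qed.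

Lemma tdrop0 u : tdrop 0 u = u.
Proof. by []. Qed.

(* Expectation over the first T bits of a fair coin tape. *)
Fixpoint avg (T : nat) X : R :=
  if T is T'.+1 then
    (avg T' (fun w => X (scons false w)) + avg T' (fun w => X (scons true w))) / 2
  else X (fun=> false).

Lemma avg_cst T (x : R) : avg T (fun=> x) = x.
Proof. by elim: T => //= T ->; field. Qed.

Lemma eq_avg T X Y : (forall w, X w = Y w) -> avg T X = avg T Y.
Proof. by move=> /funext ->. Qed.

Lemma avgD T X Y : avg T (fun w => X w + Y w) = avg T X + avg T Y.
Proof. by elim: T X Y => //= T IH X Y; rewrite !IH; field. Qed.

Lemma avgZ T (x : R) X : avg T (fun w => x * X w) = x * avg T X.
Proof. by elim: T X => //= T IH X; rewrite !IH; field. Qed.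

Lemma avgB T X Y : avg T (fun w => X w - Y w) = avg T X - avg T Y.
Proof. by elim: T X Y => //= T IH X Y; rewrite !IH; field. Qed.

Lemma avg_sum T (I : Type) (s : seq I) (P : pred I) (X : I -> (nat -> bool) -> R) :
  avg T (fun w => \sum_(i <- s | P i) X i w) = \sum_(i <- s | P i) avg T (X i).
Proof.
elim: s => [|i s IH].
  by under eq_avg do rewrite big_nil; rewrite avg_cst big_nil.
rewrite big_cons -IH; case: ifP => Pi; last by apply: eq_avg => w; rewrite big_cons Pi.
by rewrite -avgD; apply: eq_avg => w; rewrite big_cons Pi.
Qed.

Lemma avg_le T X Y : (forall w, X w <= Y w) -> avg T X <= avg T Y.
Proof.
elim: T X Y => [|T IH] X Y XY /=; first exact: XY.
by rewrite ler_wpM2r ?invr_ge0// lerD// IH// => w.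
Qed.

Lemma avg_cat a b X : avg (a + b) X = avg a (fun u => avg b (fun v => X (tcat a u v))).
Proof.
elim: a X => [|a IH] X //=; rewrite !IH.
by congr ((_ + _) / 2); apply: eq_avg => u.
Qed.

Lemma avg_swap a b (X : (nat -> bool) -> (nat -> bool) -> R) :
  avg a (fun u => avg b (X u)) = avg b (fun v => avg a (fun u => X u v)).
Proof.
elim: a X => [|a IH] X //=; rewrite !IH -[RHS]/(avg b (fun v => (_ + _) / 2)).
transitivity (avg b (fun v => 2^-1 * (avg a (fun u => X (scons false u) v) +
   avg a (fun u => X (scons true u) v)))); last by apply: eq_avg => v; rewrite mulrC.
by rewrite avgZ avgD mulrC.
Qed.

Lemma sum_tuple_cons (T : nat) (f : T.+1.-tuple bool -> R) :
  \sum_w f w = \sum_(b : bool) \sum_(w : T.-tuple bool) f (cons_tuple b w).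
Proof.
rewrite pair_big/=; apply: reindex => /=.
exists (fun w : T.+1.-tuple bool => (thead w, behead_tuple w)).
  by move=> [b w] _ /=; congr (_, _); apply/val_inj.
by move=> w _; rewrite [w in RHS]tuple_eta.
Qed.

Lemma avg_tuple T X : avg T X = (\sum_(w : T.-tuple bool) X (nth false w)) / (2 ^ T)%:R.
Proof.
elim: T X => [|T IH] X /=.
  rewrite (big_pred1 [tuple]) ?divr1; last by move=> w; rewrite [w]tuple0 /= eqxx.
  by congr X; apply/funext => t; rewrite nth_nil.
have p0 : (2 ^ T)%:R != 0 :> R by rewrite pnatr_eq0 expn_eq0.
rewrite !IH sum_tuple_cons big_bool expnS natrM [X in _ = X / _]addrC.
set A := (X in X / _ + _); set B := (X in _ + X / _).
transitivity ((A + B) / (2 * (2 ^ T)%:R)); first by field.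
by congr ((_ + _) / _); apply: eq_bigr => w _; congr X; apply/funext => -[].
Qed.

Lemma coin_prob_avg T (E : (nat -> bool) -> bool) :
  coin_prob R T E = avg T (fun w => (E w)%:R).
Proof.
rewrite avg_tuple /coin_prob; congr (_ / _).
rewrite -sum1_card natr_sum big_mkcond/=; apply: eq_bigr => w _.
by rewrite inE; case: (E _).
Qed.

Definition local (n : nat) (T : Type) (g : (nat -> bool) -> T) : Prop :=
  forall u v, g (tcat n u v) = g u.

Lemma avg_prod (S L : nat) (g : nat -> (nat -> bool) -> R) :
  (forall l, local S (g l)) ->
  avg (L * S) (fun w => \prod_(l < L) g l (tdrop (l * S) w)) = \prod_(l < L) avg S (g l).
Proof.
elim: L g => [|L IH] g gS.
  by rewrite /= !big_ord0.
rewrite big_ord_recl mulSn avg_cat -(IH (fun l => g l.+1))//.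
transitivity (avg S (fun u => avg (L * S) (fun w =>
    \prod_(l < L) g l.+1 (tdrop (l * S) w)) * g 0%N u)).
  apply: eq_avg => u; rewrite mulrC -avgZ; apply: eq_avg => v.
  rewrite big_ord_recl/= mul0n tdrop0 gS; congr (_ * _); apply: eq_bigr => l _.
  by rewrite /bump/= add1n mulSn -tdropD tcat_drop.
by rewrite avgZ mulrC.
Qed.

(** The marginal of one block: [avg_prod] with the factor 1 on all other blocks. *)
Lemma avg_block (S L l : nat) (g : (nat -> bool) -> R) : (l < L)%N -> local S g ->
  avg (L * S) (fun w => g (tdrop (l * S) w)) = avg S g.
Proof.
move=> lL gS; pose G i : (nat -> bool) -> R := if i == l then g else fun=> 1.
have GS i : local S (G i) by rewrite /G; case: eqP.
have := avg_prod L GS; rewrite (bigD1 (Ordinal lL))//= /G eqxx big1 ?mulr1.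
  move=> <-; apply: eq_avg => w; rewrite (bigD1 (Ordinal lL))//= eqxx big1 ?mulr1// => i il.
  by rewrite ifN.
by move=> i il; rewrite ifN ?avg_cst.
Qed.

(** Most significant coin first, the order in which the loop of [c_rnd] accumulates its bits. *)
Fixpoint binv (n : nat) w : nat := if n is n'.+1 then (2 * binv n' w + w n')%N else 0%N.

Lemma binv_cat n m u v : (n <= m)%N -> binv n (tcat m u v) = binv n u.
Proof. by elim: n => //= n IH nm; rewrite IH 1?ltnW// tcat_lt. Qed.

Lemma binv_lt n w : (binv n w < 2 ^ n)%N.
Proof. by elim: n => //= n IH; rewrite expnS; case: (w n); lia. Qed.

Lemma sum_binv (n : nat) (f : nat -> R) :
  (\sum_(v < 2 ^ n.+1) f v) = \sum_(v < 2 ^ n) (f (2 * v)%N + f (2 * v + 1)%N).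
Proof.
rewrite expnS; elim: (2 ^ n)%N => [|k IH]; first by rewrite !big_ord0.
by rewrite mulnS !big_ord_recr/= IH -addrA addn1.
Qed.

Lemma avg_binv n (f : nat -> R) :
  avg n (fun w => f (binv n w)) = (\sum_(v < 2 ^ n) f v) / (2 ^ n)%:R.
Proof.
elim: n f => [|n IH] f; first by rewrite big_ord_recl big_ord0 addr0 divr1.
rewrite -addn1 avg_cat addn1.
transitivity (avg n (fun w => (f (2 * binv n w)%N + f (2 * binv n w + 1)%N) / 2)).
  by apply: eq_avg => u /=; rewrite !binv_cat// !tcat_eq/= addn0.
rewrite (IH (fun k : nat => (f (2 * k)%N + f (2 * k + 1)%N) / 2)) sum_binv.
by rewrite -mulr_suml expnS natrM invfM -mulrA.
Qed.

Definition sgn (b : bool) : R := 2 * b%:R - 1.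

Definition proj (d : nat) (x : nat -> R) w : R := \sum_(j < d) x j * sgn (w j).

Lemma proj_sub d x y w : proj d x w - proj d y w = proj d (fun j => x j - y j) w.
Proof. by rewrite -sumrB; apply: eq_bigr => j _; rewrite mulrBl. Qed.

(** The free phase x carries the induction: averaging over one sign turns cos (x + a) and cos (x -
    a) into cos x cos a. *)
Lemma avg_cos_proj d (a : nat -> R) (x : R) :
  avg d (fun w => cos (x + proj d a w)) = cos x * \prod_(j < d) cos (a j).
Proof.
elim: d a x => [|d IH] a x; first by rewrite /= /proj !big_ord0 addr0 mulr1.
have E b w : x + proj d.+1 a (scons b w) = (x + a 0%N * sgn b) + proj d (fun j => a j.+1) w.
  by rewrite /proj big_ord_recl/= addrA.
rewrite /=; under [in X in X + _]eq_avg do rewrite E.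
under [in X in _ + X]eq_avg do rewrite E.
rewrite !IH big_ord_recl/= /sgn/= mulr0 mulr1 sub0r mulrN1 cosB.
have -> : 2 - 1 = 1 :> R by ring.
by rewrite mulr1 cosD; field.
Qed.

Lemma normr_sgn b : `|sgn b| = 1.
Proof.
by case: b; rewrite /sgn ?mulr1 ?mulr0; [rewrite ger0_norm; lra|rewrite sub0r normrN1].
Qed.

Lemma normr_proj d x w : `|proj d x w| <= \sum_(j < d) `|x j|.
Proof.
apply: le_trans (ler_norm_sum _ _ _) _; apply: ler_sum => j _.
by rewrite normrM normr_sgn mulr1.
Qed.

End TapeAverage.

(** * The probability that a hash bit separates two vectors *)

Section HashBit.
Variables (R : realType) (d q : nat) (M : R).
Local Notation Q := (2 ^ q)%N.

Definition hbit (y : R) (j : nat) : bool := odd (Num.truncn (y + j%:R / Q%:R)).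

Let Q0 : (0 < Q)%N. Proof. by rewrite expn_gt0. Qed.
Let QR : 0 < Q%:R :> R. Proof. by rewrite ltr0n. Qed.

(** The offset is a multiple of 1 / Q, so only the integer part of Q y matters and the bit is a
    square wave on the integers. The 2 Q values of j fill exactly one period. *)
Lemma hbit_trunc (y : R) (j : nat) : 0 <= y ->
  hbit y j = odd ((Num.truncn (Q%:R * y) + j) %/ Q).
Proof.
move=> y0; congr odd; apply/truncn_def.
have Qy : 0 <= Q%:R * y by rewrite mulr_ge0.
have /andP[h1 h2] := truncn_itv Qy; set n := Num.truncn _ in h1 h2 *.
have -> : y + j%:R / Q%:R = (Q%:R * y + j%:R) / Q%:R by field; rewrite gt_eqF.
rewrite ler_pdivlMr// ltr_pdivrMr// -!natrM; apply/andP; split.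
  apply: (@le_trans _ _ (n + j)%:R); last by rewrite natrD lerD2r.
  by rewrite ler_nat leq_trunc_div.
apply: (@lt_le_trans _ _ (n + j).+1%:R).
  by rewrite -natr1 natrD addrAC ltrD2r natr1.
by rewrite ler_nat ltn_ceil.
Qed.

Lemma avg_hbit_neq (y y' : R) : 0 <= y -> 0 <= y' ->
  exists2 e : nat, `|e%:R - `|Q%:R * (y - y')| | <= 1 &
  avg q.+1 (fun w => (hbit y (binv q.+1 w) != hbit y' (binv q.+1 w))%:R) = wave R Q e.
Proof.
move=> y0 y0'; pose n := Num.truncn (Q%:R * y); pose n' := Num.truncn (Q%:R * y').
have Qy : 0 <= Q%:R * y by rewrite mulr_ge0.
have Qy' : 0 <= Q%:R * y' by rewrite mulr_ge0.
have /andP[h1 h2] := truncn_itv Qy; have /andP[h1' h2'] := truncn_itv Qy'.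
rewrite -/n -/n' -!natr1 in h1 h2 h1' h2'.
have E : avg q.+1 (fun w => (hbit y (binv q.+1 w) != hbit y' (binv q.+1 w))%:R) =
    (flips Q n n')%:R / (2 * Q%:R) :> R.
  rewrite (avg_binv q.+1 (fun j => (hbit y j != hbit y' j)%:R)) expnS natrM.
  congr (_ / _); rewrite natr_sum; apply: eq_bigr => j _.
  by rewrite !hbit_trunc// -/n -/n'; case: odd; case: odd.
rewrite E; have [nn|nn] := leqP n' n.
  exists (n - n')%N; last by rewrite flips_sub// flips_wave.
  have nR : n'%:R <= n%:R :> R by rewrite ler_nat.
  rewrite natrB// mulrBr; case: (ger0P (Q%:R * y - Q%:R * y')) => h;
    by rewrite ler_norml; apply/andP; split; lra.
exists (n' - n)%N; last by rewrite flipsC flips_sub ?flips_wave// ltnW.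
have nR : n%:R <= n'%:R :> R by rewrite ler_nat ltnW.
rewrite natrB 1?ltnW// mulrBr; case: (ger0P (Q%:R * y - Q%:R * y')) => h;
  by rewrite ler_norml; apply/andP; split; lra.
Qed.

(* A hash bit reads q + 1 coins for its offset and then d coins for the signs. *)
Definition vbit (x : nat -> R) (w : nat -> bool) : bool :=
  hbit (proj d x (tdrop q.+1 w) + M) (binv q.+1 w).

Definition diff_prob (x y : nat -> R) : R :=
  avg (q.+1 + d) (fun w => (vbit x w != vbit y w)%:R).

Lemma vbit_local m x : (q.+1 + d <= m)%N -> local m (vbit x).
Proof.
move=> dm u v; rewrite /vbit binv_cat; last by rewrite (leq_trans _ dm)// leq_addr.
congr (hbit (_ + _) _); apply: eq_bigr => j _.
by rewrite /tdrop tcat_lt// (leq_trans _ dm)// ltn_add2l.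
Qed.

Section DiffProb.
Variables (P I : nat) (eta : R) (x y : nat -> R).
Hypotheses (QE : Q = (2 * P)%N) (IP : (0 < I <= P)%N).
Hypotheses (e01 : 0 <= eta <= 1).
Hypothesis a_small :
  forall j, (j < d)%N -> (2 * I)%:R ^+ 2 * (pi * (x j - y j)) ^+ 2 <= eta.
Hypotheses (xM : \sum_(j < d) `|x j| <= M) (yM : \sum_(j < d) `|y j| <= M).

Let sigma2 : R := \sum_(j < d) (x j - y j) ^+ 2.
Let P0 : (0 < P)%N. Proof. by case/andP: IP => I0; exact: leq_trans. Qed.

Let a_freq i j : (i < I)%N -> (j < d)%N ->
  ((2 * i + 1)%:R * pi * (x j - y j)) ^+ 2 <= eta.
Proof.
move=> iI jd; apply: le_trans (a_small jd); rewrite -mulrA exprMn.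
by rewrite ler_wpM2r ?sqr_ge0// ler_sqr ?nnegrE// ler_nat; lia.
Qed.

Let avg_cos_wave : avg d (fun w => cos_wave Q I (proj d (fun j => x j - y j) w)) =
  \sum_(0 <= i < I) fold_coef R Q i *
    (1 - \prod_(j < d) cos ((2 * i + 1)%:R * pi * (x j - y j))).
Proof.
rewrite /cos_wave avg_sum; apply: eq_bigr => i _.
rewrite avgZ avgB avg_cst; congr (_ * (_ - _)).
have := avg_cos_proj d (fun j => (2 * i + 1)%:R * pi * (x j - y j)) 0.
rewrite cos0 mul1r => <-; apply: eq_avg => w.
rewrite add0r /proj !mulr_sumr; congr cos; apply: eq_bigr => j _; ring.
Qed.

Let expR_prod (t k : R) : expR (- (k ^+ 2 * (t * pi ^+ 2 * sigma2 / 2))) =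
  \prod_(j < d) expR (- (t * ((k * pi * (x j - y j)) ^+ 2 / 2))).
Proof.
rewrite -expR_sum sumrN; congr (expR (- _)).
rewrite /sigma2 mulr_sumr mulr_suml mulr_sumr; apply: eq_bigr => j _; ring.
Qed.

(** The signs are fixed first and the offset is averaged out, which yields the triangle wave of the
    difference of the projections; the function f keeps the dependence on the signs. *)
Let avg_flip_sandwich : exists f : (nat -> bool) -> R,
  diff_prob x y = avg d f /\
  forall w, cos_wave Q I (proj d (fun j => x j - y j) w) - 64 * I%:R / Q%:R <= f w <=
    cos_wave Q I (proj d (fun j => x j - y j) w) + 64 * I%:R / Q%:R + 8 / I%:R.
Proof.
exists (fun v => avg q.+1 (fun u =>
  (hbit (proj d x v + M) (binv q.+1 u) != hbit (proj d y v + M) (binv q.+1 u))%:R)).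
split.
  rewrite avg_swap /diff_prob avg_cat; apply: eq_avg => u; apply: eq_avg => v.
  by rewrite /vbit !tcat_drop !binv_cat.
move=> w.
(* The shift by M makes the argument nonnegative, where [Num.truncn] is the floor. *)
have y1 : 0 <= proj d x w + M.
  by have := le_trans (normr_proj d x w) xM; rewrite ler_norml; lra.
have y2 : 0 <= proj d y w + M.
  by have := le_trans (normr_proj d y w) yM; rewrite ler_norml; lra.
have [e he ->] := avg_hbit_neq y1 y2.
apply: (wave_cos_wave P0 QE IP); move: he.
by rewrite opprD addrACA subrr addr0 proj_sub.
Qed.

(** By [a_small] all angles below the cut-off have squares at most eta, so every factor of the
    cosine products is compared with a Gaussian; the product of these depends on sigma2 only. *)
Lemma diff_prob_le : diff_prob x y <=
  gauss_wave Q I ((1 + eta) * pi ^+ 2 * sigma2 / 2) + (64 * I%:R / Q%:R + 8 / I%:R).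
Proof.
have [f [-> fb]] := avg_flip_sandwich.
apply: (@le_trans _ _ (avg d (fun w => cos_wave Q I (proj d (fun j => x j - y j) w) +
   (64 * I%:R / Q%:R + 8 / I%:R)))).
  by apply: avg_le => w; rewrite addrA; case/andP: (fb w).
rewrite avgD avg_cst lerD2r avg_cos_wave; apply: ler_sum_nat => i /andP[_ iI].
rewrite ler_wpM2l ?fold_coef_ge0// lerD2l lerN2 expR_prod.
by apply: ler_prod => j _; rewrite expR_ge0/=; apply: exp_le_cos => //; exact: a_freq.
Qed.

Lemma diff_prob_ge :
  gauss_wave Q I ((1 - eta) * pi ^+ 2 * sigma2 / 2) - 64 * I%:R / Q%:R <= diff_prob x y.
Proof.
have [f [-> fb]] := avg_flip_sandwich.
apply: (@le_trans _ _ (avg d (fun w => cos_wave Q I (proj d (fun j => x j - y j) w) -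
   64 * I%:R / Q%:R))); last by apply: avg_le => w; case/andP: (fb w).
rewrite avgB avg_cst lerD2r avg_cos_wave; apply: ler_sum_nat => i /andP[_ iI].
rewrite ler_wpM2l ?fold_coef_ge0// lerD2l lerN2 expR_prod.
apply: ler_prod => j _; apply/andP; split.
  by apply: le_trans (expR_ge0 _) (exp_le_cos e01 _); exact: a_freq.
by apply: cos_le_exp => //; exact: a_freq.
Qed.

End DiffProb.
End HashBit.

(** * Keys of several bits, and the success of a query on a random tape *)

Section KeyProbability.
Variables (R : realType) (d q nb : nat) (M : R).
Local Notation T := (2 ^ nb)%N.

(* Coins of one hash function: nb for its multiplier, q + 1 for its offset, d for its signs. *)
Definition hash_coins : nat := nb + (q.+1 + d).
Local Notation BL := hash_coins.
Implicit Types (x y : nat -> R) (w : nat -> bool).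

Definition hmul w : nat := binv nb w.
Definition hvbit x w : bool := vbit d q M x (tdrop nb w).

Lemma hmul_local : local BL hmul.
Proof. by move=> u v; rewrite /hmul binv_cat// leq_addr. Qed.

Lemma hvbit_local x : local BL (hvbit x).
Proof.
move=> u v; have h := @vbit_local R d q M (q.+1 + d) x (leqnn _).
have E w w' : (forall t, (t < q.+1 + d)%N -> w t = w' t) -> vbit d q M x w = vbit d q M x w'.
  move=> ww; rewrite -(h w (fun=> false)) -(h w' (fun=> false)); congr vbit.
  elim: (q.+1 + d)%N w w' ww => [|k IH] w w' ww //=; congr scons; first exact: ww.
  by apply: IH => t tk; exact: ww.
by apply: E => t tk; rewrite /tdrop tcat_lt// ltn_add2l.
Qed.

(** Universal hashing of the bit string: its bits select a subset of random multipliers. Modulo T,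
    distinct strings collide with probability at most 1 / T. *)
Definition ksum (K : nat) x w : nat :=
  \sum_(k < K) hmul (tdrop (k * BL) w) * hvbit x (tdrop (k * BL) w).

Definition key (K : nat) x w : nat := (ksum K x w %% T)%N.

Definition same_bits (K : nat) x y w : bool :=
  [forall k : 'I_K, hvbit x (tdrop (k * BL) w) == hvbit y (tdrop (k * BL) w)].

Lemma natr_forall (K : nat) (p : 'I_K -> bool) :
  [forall k, p k]%:R = \prod_(k < K) (p k)%:R :> R.
Proof.
case: (boolP [forall k, p k]) => [/forallP h|].
  by rewrite big1// => k _; rewrite h.
by rewrite negb_forall => /existsP[k /negPf pk]; rewrite (bigD1 k)//= pk mul0r.
Qed.

Lemma avg_same_bits K x y :
  avg (K * BL) (fun w => (same_bits K x y w)%:R) = (1 - diff_prob d q M x y) ^+ K.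
Proof.
pose g (_ : nat) w : R := (hvbit x w == hvbit y w)%:R.
transitivity (avg (K * BL) (fun w => \prod_(k < K) g k (tdrop (k * BL) w))).
  by apply: eq_avg => w; rewrite /same_bits natr_forall.
rewrite avg_prod => [|k u v]; last by rewrite /g !hvbit_local.
rewrite (eq_bigr (fun=> avg BL (g 0%N)))// prodr_const card_ord; congr (_ ^+ _).
rewrite /g /diff_prob [LHS]avg_cat.
transitivity (avg nb (fun u => avg (q.+1 + d) (fun w =>
    1 - (vbit d q M x w != vbit d q M y w)%:R)) : R).
  apply: eq_avg => u; apply: eq_avg => v; rewrite /hvbit tcat_drop.
  by case: eqP => /=; rewrite ?subr0 ?subrr.
by rewrite avg_cst avgB avg_cst.
Qed.

Lemma sum_unique_le1 (N : nat) (p : nat -> bool) :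
  (forall a b, (a < N)%N -> (b < N)%N -> p a -> p b -> a = b) ->
  (\sum_(a < N) (p a)%:R) <= 1 :> R.
Proof.
move=> pu; case: (boolP [exists a : 'I_N, p a]) => [/existsP[a pa]|].
  rewrite (bigD1 a)//= pa big1 ?addr0// => b ba.
  case pb : (p b) => //; move: ba.
  by rewrite -val_eqE/= (pu a b)// ?eqxx.
rewrite negb_exists => /forallP h; rewrite big1// => a _.
by rewrite (negPf (h a)).
Qed.

(** The multiplier occurs on exactly one side of the congruence, hence at most one residue solves
    it. *)
Lemma avg_mul_collision (b b' : bool) (c c' : nat) : b != b' ->
  avg nb (fun w => (hmul w * b + c == hmul w * b' + c' %[mod T])%:R) <= T%:R^-1 :> R.
Proof.
move=> bb; rewrite /hmul (avg_binv nb (fun v => (v * b + c == v * b' + c' %[mod T])%:R)).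
rewrite ler_piMl ?invr_ge0//; apply: (@sum_unique_le1 _ (fun v => v * b + c == v * b' + c' %[mod T])%N) => u v uT vT.
have key e : forall u v, (u < T)%N -> (v < T)%N ->
    u + e = v + e %[mod T] -> u = v.
  by move=> u' v' h1 h2 /eqP; rewrite eqn_modDr !modn_small// => /eqP.
case: b b' bb => [] [] //= _; rewrite !muln1 !muln0 !add0n => /eqP h1 /eqP h2.
  by apply: (key c) => //; rewrite h1 h2.
by apply: (key c') => //; rewrite -h1 -h2.
Qed.

(** The free offsets c and c' let the induction discard positions where the bits agree; a position
    where they differ supplies a multiplier that is uniform given all the other coins. *)
Lemma avg_key_collision (K : nat) x y (c c' : nat) :
  avg (K * BL) (fun w => ((ksum K x w + c == ksum K y w + c' %[mod T]) &&
    ~~ same_bits K x y w)%:R) <= T%:R^-1 :> R.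
Proof.
elim: K c c' => [|K IH] c c'.
  rewrite /= (_ : same_bits _ _ _ _ = true) ?andbF ?invr_ge0//.
  by apply/forallP => -[].
have ks z u v : ksum K.+1 z (tcat BL u v) = (hmul u * hvbit z u + ksum K z v)%N.
  rewrite /ksum big_ord_recl/= !mul0n !tdrop0 hmul_local hvbit_local; congr addn.
  by apply: eq_bigr => k _; rewrite /bump/= add1n mulSn -!(tdropD (_ * BL) BL) !tcat_drop.
have sb u v : same_bits K.+1 x y (tcat BL u v) =
    (hvbit x u == hvbit y u) && same_bits K x y v.
  apply/forallP/andP => [h|[h1 /forallP h2] k].
    split; first by have := h ord0; rewrite /= mul0n !tdrop0 !hvbit_local.
    apply/forallP => k; have := h (lift ord0 k).
    by rewrite /= /bump/= add1n mulSn -!(tdropD (_ * BL) BL) !tcat_drop.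
  case: (unliftP ord0 k) => [j ->|->]; last by rewrite /= mul0n !tdrop0 !hvbit_local.
  by rewrite /= /bump/= add1n mulSn -!(tdropD (_ * BL) BL) !tcat_drop.
rewrite mulSn avg_cat.
pose X u v : R := ((hmul u * hvbit x u + ksum K x v + c ==
   hmul u * hvbit y u + ksum K y v + c' %[mod T]) &&
   ~~ ((hvbit x u == hvbit y u) && same_bits K x y v))%:R.
rewrite (_ : (fun u => _) = (fun u => avg (K * BL) (X u))); last first.
  by apply/funext => u; apply: eq_avg => v; rewrite !ks sb.
rewrite avg_cat avg_swap -[leRHS](avg_cst (q.+1 + d)); apply: avg_le => u2.
have b1 z u1 : hvbit z (tcat nb u1 u2) = vbit d q M z u2 by rewrite /hvbit tcat_drop.
have b2 u1 : hmul (tcat nb u1 u2) = hmul u1 by rewrite /hmul binv_cat.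
(* Equal bits add the same amount r to both offsets, and the induction hypothesis applies. Distinct
   bits leave u1 as the only random quantity. *)
case: (eqVneq (vbit d q M x u2) (vbit d q M y u2)) => bxy.
  rewrite -[leRHS](avg_cst nb); apply: avg_le => u1.
  set r := (hmul u1 * vbit d q M y u2)%N.
  apply: le_trans (IH (r + c)%N (r + c')%N); apply: avg_le => v.
  by rewrite /X !b1 b2 bxy eqxx/= -/r !addnA (addnC r) (addnC r).
rewrite avg_swap -[leRHS](avg_cst (K * BL)); apply: avg_le => v.
apply: le_trans (avg_mul_collision (ksum K x v + c) (ksum K y v + c') bxy).
apply: avg_le => u1; rewrite /X !b1 b2 (negPf bxy)/= andbT !addnA.
exact: lexx.
Qed.

Lemma avg_key_eq K x y :
  avg (K * BL) (fun w => (key K x w == key K y w)%:R) <=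
  (1 - diff_prob d q M x y) ^+ K + T%:R^-1.
Proof.
rewrite -avg_same_bits; apply: le_trans (lerD (lexx _) (avg_key_collision K x y 0 0)).
rewrite -avgD; apply: avg_le => w; rewrite !addn0 /key.
by case: (_ == _); case: same_bits; rewrite /= ?addr0 ?add0r// ler01.
Qed.

Lemma same_bits_key K x y w : same_bits K x y w -> key K x w = key K y w.
Proof.
move=> /forallP h; congr (_ %% _)%N; apply: eq_bigr => k _.
by rewrite (eqP (h k)).
Qed.

Lemma tcat_lt_block K (k : 'I_K) u v t : (t < BL)%N ->
  tdrop (k * BL) (tcat (K * BL) u v) t = tdrop (k * BL) u t.
Proof.
move=> tB; rewrite /tdrop tcat_lt//; apply: (@leq_trans (k.+1 * BL)).
  by rewrite mulSn addnC ltn_add2r.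
by rewrite leq_mul2r ltn_ord orbT.
Qed.

Lemma local_agree (n : nat) (A : Type) (g : (nat -> bool) -> A) u v :
  local n g -> (forall t, (t < n)%N -> u t = v t) -> g u = g v.
Proof.
move=> gl uv; rewrite -(gl u (fun=> false)) -(gl v (fun=> false)); congr g.
elim: n u v uv {gl} => [|n IH] u v uv //=; congr scons; first exact: uv.
by apply: IH => t tn; exact: uv.
Qed.

Lemma key_local K x : local (K * BL) (key K x).
Proof.
move=> u v; congr (_ %% _)%N; apply: eq_bigr => k _.
by rewrite (local_agree hmul_local (tcat_lt_block k u v))
  (local_agree (@hvbit_local x) (tcat_lt_block k u v)).
Qed.

Lemma same_bits_local K x y : local (K * BL) (same_bits K x y).
Proof.
move=> u v; apply: eq_forallb => k.
by rewrite (local_agree (@hvbit_local x) (tcat_lt_block k u v))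
  (local_agree (@hvbit_local y) (tcat_lt_block k u v)).
Qed.

Section Success.
Variables (K L n : nat) (X : nat -> nat -> R) (y : nat -> R) (i0 : nat).
Variables (far : pred nat) (p1 p2 : R).
Hypotheses (n0 : (0 < n)%N) (L0 : (0 < L)%N) (nT : (n <= T)%N).
Hypotheses (p1_01 : 0 <= p1 <= 1) (Lp1 : 1 <= L%:R * p1 ^+ K) (p2K : p2 ^+ K <= n%:R^-1).
Hypothesis near_p1 : diff_prob d q M (X i0) y <= 1 - p1.
Hypothesis far_p2 : forall i, (i < n)%N -> far i ->
  0 <= 1 - diff_prob d q M (X i) y <= p2.
Local Notation S := (K * BL)%N.

Definition table_tape (l : nat) w := tdrop (l * S) w.

Definition far_collisions w : nat :=
  \sum_(l < L) \sum_(i < n | far i) (key K (X i) (table_tape l w) == key K y (table_tape l w)).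

(** Success demands equal bits and not merely equal keys, so that its probability per table is an
    exact power. The threshold 8 L is four times the bound on the expected number of far
    collisions. *)
Definition good_tape w : bool :=
  [exists l : 'I_L, same_bits K (X i0) y (table_tape l w)] && (far_collisions w < 8 * L)%N.

(** (1 - p)^L (1 + p)^L <= 1, while Bernoulli gives (1 + p)^L >= 1 + L p >= 2. *)
Lemma bernoulli_half (p : R) : 0 <= p <= 1 -> 1 <= L%:R * p -> (1 - p) ^+ L <= 1 / 2.
Proof.
move=> /andP[p0 p1'] Lp.
have h : 1 + L%:R * p <= (1 + p) ^+ L.
  elim: (L) => [|k IH]; first by rewrite mul0r addr0 expr0.
  rewrite exprS; apply: le_trans (ler_wpM2l _ IH); last by rewrite addr_ge0.
  have kp : 0 <= k%:R * p * p by rewrite !mulr_ge0.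
  by rewrite -[k.+1%:R]natr1; lra.
have h2 : (1 - p) ^+ L * (1 + p) ^+ L <= 1.
  by rewrite -exprMn exprn_ile1//; nra.
have h3 : 0 <= (1 - p) ^+ L by rewrite exprn_ge0// subr_ge0.
nra.
Qed.

Lemma avg_no_near_collision :
  avg (L * S) (fun w => (~~ [exists l : 'I_L, same_bits K (X i0) y (table_tape l w)])%:R)
  <= 1 / 2 :> R.
Proof.
pose g (_ : nat) w : R := (~~ same_bits K (X i0) y w)%:R.
rewrite (_ : avg _ _ = avg (L * S) (fun w => \prod_(l < L) g l (tdrop (l * S) w))).
  rewrite avg_prod => [|l u v]; last by rewrite /g same_bits_local.
  have E : avg S (g 0%N) = 1 - (1 - diff_prob d q M (X i0) y) ^+ K.
    rewrite -avg_same_bits -[X in X - _](avg_cst S) -avgB; apply: eq_avg => w.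
    by rewrite /g; case: same_bits; rewrite /= ?subrr ?subr0.
  rewrite (eq_bigr (fun=> avg S (g 0%N)))// prodr_const card_ord E.
  have pp : p1 ^+ K <= (1 - diff_prob d q M (X i0) y) ^+ K.
    by have := near_p1; case/andP: p1_01 => ? ? ?; rewrite lerXn2r ?nnegrE//; lra.
  have p1K : 0 <= p1 ^+ K <= 1.
    by case/andP: p1_01 => ? ?; rewrite exprn_ge0// exprn_ile1.
  apply: le_trans (bernoulli_half p1K Lp1); rewrite lerXn2r ?nnegrE//.
  - rewrite -avg_same_bits subr_ge0 -[leRHS](avg_cst S); apply: avg_le => w.
    by case: same_bits.
  - by rewrite subr_ge0; case/andP: p1K.
  - by rewrite lerD2l lerN2.
by apply: eq_avg => w; rewrite negb_exists natr_forall.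
Qed.

(** A far object collides in a table with probability at most 1 / n through equal bits and 1 / T <=
    1 / n through the modulus. *)
Lemma avg_far_collisions : avg (L * S) (fun w => (far_collisions w)%:R) <= 2 * L%:R :> R.
Proof.
have one (l : 'I_L) i : (i < n)%N -> far i ->
    avg (L * S) (fun w => (key K (X i) (table_tape l w) == key K y (table_tape l w))%:R)
    <= 2 / n%:R :> R.
  move=> ni fi; rewrite (@avg_block R S L l (fun w => (key K (X i) w == key K y w)%:R))//;
    last by move=> u v; rewrite !key_local.
  apply: le_trans (avg_key_eq K (X i) y) _.
  have /andP[f1 f2] := far_p2 ni fi.
  have -> : 2 / n%:R = n%:R^-1 + n%:R^-1 :> R by ring.
  apply: lerD; last by rewrite lef_pV2 ?posrE ?ltr0n ?expn_gt0// ler_nat.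
  by apply: le_trans p2K; rewrite lerXn2r ?nnegrE// (le_trans f1).
rewrite (_ : avg _ _ = \sum_(l < L) \sum_(i < n | far i) avg (L * S)
   (fun w => (key K (X i) (table_tape l w) == key K y (table_tape l w))%:R)).
  apply: (@le_trans _ _ (\sum_(l < L) \sum_(i < n) 2 / n%:R)).
    apply: ler_sum => l _; rewrite big_mkcond; apply: ler_sum => i _.
    by case: ifP => [fi|_]; [exact: one|rewrite divr_ge0].
  rewrite sumr_const card_ord -[leLHS]mulr_natr sumr_const card_ord -[_ *+ n]mulr_natr.
  by rewrite divfK// pnatr_eq0 -lt0n.
transitivity (avg (L * S) (fun w => \sum_(l < L) \sum_(i < n | far i)
    (key K (X i) (table_tape l w) == key K y (table_tape l w))%:R : R)).
  apply: eq_avg => w; rewrite /far_collisions natr_sum; apply: eq_bigr => l _.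
  by rewrite natr_sum.
by rewrite avg_sum; apply: eq_bigr => l _; rewrite avg_sum.
Qed.

(** The loss is 1 / 2 for the near object and 1 / 4 for the far ones; the pointwise inequality h
    combines the union bound and Markov's inequality. *)
Lemma avg_good_tape : 1 / 4 <= avg (L * S) (fun w => (good_tape w)%:R) :> R.
Proof.
have LR : 0 < L%:R :> R by rewrite ltr0n.
have h w : 1 - (~~ [exists l : 'I_L, same_bits K (X i0) y (table_tape l w)])%:R -
    (8 * L%:R)^-1 * (far_collisions w)%:R <= (good_tape w)%:R :> R.
  have f0 : 0 <= (8 * L%:R)^-1 * (far_collisions w)%:R :> R.
    by rewrite mulr_ge0 ?invr_ge0 ?mulr_ge0.
  rewrite /good_tape; case: existsP => _ /=; last lra.
  case: ltnP => //= Lf; first by lra.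
  have : 1 <= (8 * L%:R)^-1 * (far_collisions w)%:R :> R; last lra.
  by rewrite mulrC ler_pdivlMr ?mulr_gt0// mul1r -natrM ler_nat.
apply: le_trans (avg_le _ h); rewrite !avgB avg_cst avgZ.
have h1 := avg_no_near_collision.
have h2 := avg_far_collisions.
have : (8 * L%:R)^-1 * avg (L * S) (fun w => (far_collisions w)%:R) <= 1 / 4 :> R.
  have v0 : 0 <= (8 * L%:R)^-1 :> R by rewrite invr_ge0 mulr_ge0.
  apply: le_trans (ler_wpM2l v0 h2) _.
  have -> : (8 * L%:R)^-1 * (2 * L%:R) = 1 / 4 :> R by field; rewrite gt_eqF.
  exact: lexx.
lra.
Qed.

End Success.
End KeyProbability.

(** * Choice of the parameters *)

Section HashParameters.
Variable R : realType.
Implicit Types x y c : R.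

Lemma exists_expr_lt x e : 0 < x < 1 -> 0 < e -> exists J, x ^+ J < e.
Proof.
move=> /andP[x0 x1] e0; pose z := x^-1 - 1.
have z0 : 0 < z by rewrite subr_gt0 invf_gt1.
have b J : 1 + J%:R * z <= x^-1 ^+ J.
  elim: J => [|J IH]; first by rewrite mul0r addr0 expr0.
  rewrite exprS; apply: le_trans (ler_wpM2l _ IH); last by rewrite invr_ge0 ltW.
  have -> : x^-1 = 1 + z by rewrite /z; ring.
  have h : 0 <= J%:R * z * z by rewrite !mulr_ge0// ltW.
  by rewrite -[J.+1%:R]natr1; lra.
pose J := (Num.truncn (e^-1 / z)).+1; exists J.
have ez : 0 <= e^-1 / z by rewrite divr_ge0 ?invr_ge0 ?ltW.
have /andP[_ h] := truncn_itv ez.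
have h2 : e^-1 < x^-1 ^+ J.
  by apply: lt_le_trans (b J); move: h; rewrite ltr_pdivrMr// /J; lra.
by move: h2; rewrite exprVn ltf_pV2 ?posrE ?exprn_gt0.
Qed.

(** Pigeonhole: if u fell by a factor less than a at every step, u J would be at least f0 / a^J. The
    first step that falls by a also keeps its lower bound. *)
Lemma geometric_drop (u : nat -> R) (f0 a : R) (J : nat) : 0 < a ->
  f0 <= u 0%N -> u J < f0 / a ^+ J ->
  exists j, [/\ (j < J)%N, a * u j.+1 <= u j & f0 / a ^+ j <= u j].
Proof.
move=> a0 u0 uJ.
have [//|h] : (exists j, [/\ (j < J)%N, a * u j.+1 <= u j & f0 / a ^+ j <= u j]) \/
    f0 / a ^+ J <= u J; last by move: uJ; rewrite ltNge h.
elim: J {uJ} => [|J IH]; first by right; rewrite expr0 divr1.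
case: IH => [[j [jJ h1 h2]]|h]; first by left; exists j; split => //; exact: ltnW.
case: (leP (a * u J.+1) (u J)) => h2; first by left; exists J.
right; rewrite exprS invfM mulrCA -ler_pdivlMl ?invr_gt0// invrK.
exact: le_trans h (ltW h2).
Qed.

(** The scale tau depends on Q and I, but the lower bound f is chosen before them: only so can Q and
    I be taken large enough for errors that are small against f. *)
Lemma gauss_wave_gap (a g : R) : 1 < a -> a < g ->
  exists2 f : R, 0 < f & forall P Q I : nat, (0 < I <= P)%N -> Q = (2 * P)%N ->
  exists tau : R, [/\ 0 < tau, a * gauss_wave Q I tau <= gauss_wave Q I (g ^+ 2 * tau),
    f <= gauss_wave Q I (g ^+ 2 * tau) & gauss_wave Q I (g ^+ 2 * tau) <= 1 / 2].
Proof.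
move=> a1 ag; have a0 : 0 < a by rewrite (lt_trans _ a1).
have g0 : 0 < g by rewrite (lt_trans a0).
(* Makes 36 sqrt ts equal to 1 / 2. At scale j the wave is at most 1 / (2 g^j) and at scale 0 at
   least ts / 8, so J is found from (a / g)^J < ts / 4. *)
pose ts : R := (72^-1) ^+ 2.
have ts0 : 0 < ts by rewrite exprn_gt0.
have ts1 : ts <= 1 by rewrite /ts expr2; lra.
have [J hJ] : exists J, (a / g) ^+ J < ts / 4.
  by apply: exists_expr_lt; rewrite ?divr_gt0//= ltr_pdivrMr// mul1r.
exists (ts / 8 / a ^+ J); first by rewrite !divr_gt0// exprn_gt0.
move=> P Q I /andP[I0 IP] QE; have P0 := leq_trans I0 IP.
pose tj j := ts / g ^+ 2 ^+ j; pose u j := gauss_wave Q I (tj j).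
have tj01 j : 0 < tj j <= 1.
  rewrite divr_gt0 ?exprn_gt0//= ler_pdivrMr ?exprn_gt0// mul1r.
  by rewrite (le_trans ts1)// exprn_ege1// exprn_ege1// ltW// (lt_trans a1).
have sq j : Num.sqrt (tj j) = 72^-1 / g ^+ j.
  have -> : tj j = (72^-1 / g ^+ j) ^+ 2 by rewrite /tj /ts expr_div_n -!exprM mulnC.
  by rewrite sqrtr_sqr ger0_norm// divr_ge0// exprn_ge0// ltW.
have ub j : u j <= 36 * (72^-1 / g ^+ j).
  by rewrite -sq; apply: (gauss_wave_le P0 QE IP).
have [||j [jJ h1 h2]] := @geometric_drop u (ts / 8) a J a0.
- have := gauss_wave_ge P0 QE I0 (tau := ts); rewrite (ltW ts0) ts1 => /(_ isT) h.
  by rewrite /u /tj expr0 divr1.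
- apply: le_lt_trans (ub J) _; move: hJ; rewrite expr_div_n.
  rewrite ltr_pdivrMr ?exprn_gt0// => hJ.
  have gJ : 0 < g ^+ J by rewrite exprn_gt0.
  have aJ : 0 < a ^+ J by rewrite exprn_gt0.
  rewrite ltr_pdivlMr//.
  have -> : 36 * (72^-1 / g ^+ J) * a ^+ J = 2^-1 * a ^+ J / g ^+ J.
    by field; rewrite gt_eqF.
  by rewrite ltr_pdivrMr//; lra.
exists (tj j.+1).
have E : g ^+ 2 * tj j.+1 = tj j.
  by rewrite /tj [_ ^+ j.+1]exprS invfM mulrCA mulVKf// expf_neq0// gt_eqF.
rewrite E; split => //.
- by case/andP: (tj01 j.+1).
- apply: le_trans h2; rewrite ler_wpM2l ?divr_ge0 ?(ltW ts0)//.
  by rewrite lef_pV2 ?posrE ?exprn_gt0// ler_weXn2l ?(ltW a1)// ltnW.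
- apply: le_trans (ub j) _.
  have : 72^-1 / g ^+ j <= 72^-1.
    by rewrite ler_pdivrMr ?exprn_gt0// ler_peMr// exprn_ege1// ltW// (lt_trans a1).
  lra.
Qed.

(** Young's inequality gives (1 - k D)^(1 / k) <= 1 - D. For D = 1 - p1 and k D = 1 - p2 this bounds
    ln p1 / ln p2 by 1 / k. *)
Lemma ln_concave_ratio (k D : R) : 1 < k -> 0 < D -> k * D < 1 ->
  ln (1 - k * D) <= k * ln (1 - D).
Proof.
move=> k1 D0 kD; have k0 : 0 < k by rewrite (lt_trans _ k1).
have D1 : D < 1 by apply: lt_trans kD; rewrite ltr_pMl.
have kv : k^-1 < 1 by rewrite invf_lt1.
pose q := (1 - k^-1)^-1.
have q0 : 0 < q by rewrite invr_gt0 subr_gt0.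
have X0 : 0 < 1 - k * D by rewrite subr_gt0.
have := @conjugate_powR R ((1 - k * D) `^ k^-1) 1 k q (powR_ge0 _ _) ler01 k0 q0.
rewrite /q invrK subrKC => /(_ erefl).
rewrite mulr1 powR1 mul1r -powRrM mulVf ?gt_eqF// powRr1 ?(ltW X0)//.
have -> : (1 - k * D) / k + (1 - k^-1) = 1 - D by field; rewrite gt_eqF.
rewrite -ler_ln ?posrE ?powR_gt0 ?subr_gt0// ln_powR.
by rewrite ler_pdivrMl.
Qed.

Lemma near_scale (t tau p : R) : 1 + t != 0 -> 1 + 4 * t != 0 -> p != 0 ->
  (1 + t) * p * ((1 + 4 * t) * (2 * tau / ((1 + t) * (1 + 4 * t) * p))) / 2 = tau.
Proof. by move=> h1 h2 h3; field; rewrite h1 h2 h3. Qed.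

Lemma far_scale (t tau p x : R) : 1 + t != 0 -> 1 + 4 * t != 0 -> p != 0 ->
  (1 - t) * p * (x * (2 * tau / ((1 + t) * (1 + 4 * t) * p)) / (1 + 4 * t)) / 2 =
  (1 - t) * x * tau / ((1 + t) * (1 + 4 * t) ^+ 2).
Proof. by move=> h1 h2 h3; field; rewrite h1 h2 h3. Qed.

(* The gap c - (2 sqrt c - 1) = (sqrt c - 1)^2 leaves room for all approximations. *)
Lemma hash_parameters c : 1 < c ->
  exists (q P I : nat) (t s0 p1 p2 k : R),
  [/\ (2 ^ q = 2 * P)%N, (0 < I <= P)%N, 0 < t <= 3^-1 & 0 < s0] /\
  [/\ 0 < p1 < 1, 0 < p2 < 1, 2 * Num.sqrt c - 1 < k, 1 < k &
      k * (1 - p1) = 1 - p2] /\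
  [/\ forall s2, s2 <= (1 + 4 * t) * s0 ->
      gauss_wave (2 ^ q) I ((1 + t) * pi ^+ 2 * s2 / 2) +
        (64 * I%:R / (2 ^ q)%:R + 8 / I%:R) <= 1 - p1 &
      forall s2, c ^+ 2 * s0 <= (1 + 4 * t) * s2 ->
      1 - p2 <= gauss_wave (2 ^ q) I ((1 - t) * pi ^+ 2 * s2 / 2) -
        64 * I%:R / (2 ^ q)%:R].
Proof.
move=> c1; have c0 : 0 < c by rewrite (lt_trans _ c1).
have sc : Num.sqrt c ^+ 2 = c by rewrite sqr_sqrtr// ltW.
have sc1 : 1 < Num.sqrt c by rewrite -[ltLHS]sqrtr1 ltr_sqrt.
pose c' := 2 * Num.sqrt c - 1.
have cc : c' < c.
  have : 0 < (Num.sqrt c - 1) ^+ 2 by rewrite exprn_gt0// subr_gt0.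
  by rewrite /c'; move: sc; lra.
have c'1 : 1 < c' by rewrite /c'; lra.
(* Of c' < k < a < g < c, the room between k and a pays for additive errors, that between a and g
   for the pigeonhole, and that between g and c for the factors 1 +- t and 1 + 4 t. *)
pose k := c' + (c - c') / 4; pose a := c' + (c - c') / 2; pose g := c' + 3 * (c - c') / 4.
have k1 : c' < k by rewrite /k; lra.
have ka : k < a by rewrite /k /a; lra.
have ag : a < g by rewrite /g /a; lra.
have gc : g < c by rewrite /g; lra.
have k0 : 0 < k by lra.
have a0 : 0 < a by lra.
have g0 : 0 < g by lra.
have [||f f0 gap] := @gauss_wave_gap a g; [lra|lra|].
(* Chosen such that k (u + e) <= U - e whenever a u <= U and f <= U. *)
pose e := (1 - k / a) * f / (1 + k).
have ka1 : k / a < 1 by rewrite ltr_pdivrMr// mul1r.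
have e0 : 0 < e by rewrite /e divr_gt0 ?mulr_gt0// ?subr_gt0//; lra.
pose I := (Num.truncn (16 / e)).+1.
(* As q < 2 ^ q, it is enough to take the required size of Q as the exponent. *)
pose q := ((Num.truncn (128 * I%:R / e)).+1 + 2 * I)%N.
have q0 : (0 < q)%N by rewrite /q addSn.
pose P := (2 ^ q.-1)%N; exists q, P, I.
have QE : (2 ^ q = 2 * P)%N by rewrite /P -expnS prednK.
have qQ : (q < 2 ^ q)%N by rewrite ltn_expl.
have IP : (0 < I <= P)%N.
  by rewrite /= -(leq_pmul2l (isT : 0 < 2)%N) -QE (leq_trans _ (ltnW qQ))// /q leq_addl.
have IR : 0 < I%:R :> R by rewrite ltr0n.
have QR : 0 < (2 ^ q)%:R :> R by rewrite ltr0n expn_gt0.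
have errI : 8 / I%:R <= e / 2.
  have ge : 0 <= 16 / e by rewrite divr_ge0// ltW.
  have /andP[_ h] := truncn_itv ge; rewrite ler_pdivrMr//.
  by move: h; rewrite -/I ltr_pdivrMr//; lra.
have errQ : 64 * I%:R / (2 ^ q)%:R <= e / 2.
  have ge : 0 <= 128 * I%:R / e by apply: divr_ge0; [exact: mulr_ge0|exact: ltW].
  have /andP[_ h] := truncn_itv ge; rewrite ler_pdivrMr//.
  have : 128 * I%:R / e <= (2 ^ q)%:R.
    apply: le_trans (ltW h) _; rewrite ler_nat (leq_trans _ (ltnW qQ))//.
    by rewrite /q leq_addr.
  by rewrite ler_pdivrMr//; lra.
have [tau [tau0 h1 h2 h3]] := gap P (2 ^ q)%N I IP QE.
(* Makes g^2 = (1 - 12 t) c^2, and (1 - 12 t) (1 + t) (1 + 4 t)^2 <= 1 - t. *)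
pose t := (1 - (g / c) ^+ 2) / 12.
have gc1 : 0 < (g / c) ^+ 2 < 1.
  rewrite exprn_gt0 ?divr_gt0//= expr_lt1 ?divr_ge0 ?(ltW g0) ?(ltW c0)//.
  by rewrite ltr_pdivrMr// mul1r.
have t0 : 0 < t <= 3^-1 by rewrite /t; apply/andP; split; lra.
have pi0 : 0 < pi ^+ 2 :> R by rewrite exprn_gt0// pi_gt0.
(* The squared distance of near vectors after rescaling; with its error factors it lands exactly at
   tau. *)
pose s0 := 2 * tau / ((1 + t) * (1 + 4 * t) * pi ^+ 2).
case/andP: (t0) => t00 t03.
have t1 : 0 < 1 + t by lra.
have t4 : 0 < 1 + 4 * t by lra.
pose D1 := gauss_wave (2 ^ q) I tau + e.
have D10 : 0 < D1.
  apply: ltr_wpDl => //; apply: le_trans (gauss_wave_mono _ _ (ltW tau0)).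
  by rewrite /gauss_wave big1// => i _; rewrite mulr0 oppr0 expR0 subrr mulr0.
set U := gauss_wave (2 ^ q) I (g ^+ 2 * tau) in h1 h2 h3.
have D2U : k * D1 <= U - e.
  have E : (1 + k) * e = (1 - k / a) * f by rewrite /e mulrC divfK// gt_eqF//; lra.
  have h4 : (1 - k / a) * f <= (1 - k / a) * U by rewrite ler_wpM2l// subr_ge0 ltW.
  have h5 : k * gauss_wave (2 ^ q) I tau <= k / a * U.
    have -> : k * gauss_wave (2 ^ q) I tau = k / a * (a * gauss_wave (2 ^ q) I tau).
      by rewrite mulrA divfK// gt_eqF.
    by rewrite ler_wpM2l// divr_ge0// ltW.
  by rewrite /D1; lra.
have D12 : D1 <= k * D1 by rewrite ler_peMl// ltW//; lra.
exists t, s0, (1 - D1), (1 - k * D1), k; split; first split => //.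
  by apply: divr_gt0; [exact: mulr_gt0|apply: mulr_gt0 => //; exact: mulr_gt0].
split.
  split => //; rewrite ?subKr//; last lra.
    by apply/andP; split; lra.
  by apply/andP; split; lra.
rewrite !subKr; split => s2 hs.
  apply: lerD; last lra.
  apply: gauss_wave_mono; apply: (@le_trans _ _ ((1 + t) * pi ^+ 2 * ((1 + 4 * t) * s0) / 2)).
    by rewrite ler_wpM2r// ler_wpM2l// mulr_ge0// ltW.
  by rewrite /s0 near_scale ?gt_eqF.
apply: le_trans D2U _; apply: lerB; last lra.
apply: gauss_wave_mono.
have s20 : c ^+ 2 * s0 / (1 + 4 * t) <= s2 by rewrite ler_pdivrMr// [leRHS]mulrC.
apply: (@le_trans _ _ ((1 - t) * pi ^+ 2 * (c ^+ 2 * s0 / (1 + 4 * t)) / 2)); last first.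
  by rewrite ler_wpM2r// ler_wpM2l// mulr_ge0 ?(ltW pi0)//; lra.
have -> : (1 - t) * pi ^+ 2 * (c ^+ 2 * s0 / (1 + 4 * t)) / 2 =
    (1 - t) * c ^+ 2 * tau / ((1 + t) * (1 + 4 * t) ^+ 2).
  by rewrite /s0 far_scale ?gt_eqF.
rewrite ler_pdivlMr ?mulr_gt0 ?exprn_gt0//.
have gE : g ^+ 2 = (1 - 12 * t) * c ^+ 2.
  by rewrite /t expr_div_n; field; rewrite gt_eqF.
have main : (1 - 12 * t) * ((1 + t) * (1 + 4 * t) ^+ 2) <= 1 - t.
  clear - t00 t03; have := sqr_ge0 t.
  have : 0 <= t ^+ 3 by rewrite exprn_ge0// ltW.
  have : 0 <= t ^+ 4 by rewrite exprn_ge0// ltW.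
  lra.
have -> : g ^+ 2 * tau * ((1 + t) * (1 + 4 * t) ^+ 2) =
    (1 - 12 * t) * ((1 + t) * (1 + 4 * t) ^+ 2) * (c ^+ 2 * tau) by rewrite gE; ring.
rewrite -[leRHS]mulrA ler_wpM2r//; apply: mulr_ge0; [exact: sqr_ge0|exact: ltW].
Qed.

(* Rounding the number of hash functions and of tables to powers with a common exponent. *)
Lemma table_parameters (p1 p2 k r : R) : 0 < p1 < 1 -> 0 < p2 < 1 -> 1 < k ->
  k * (1 - p1) = 1 - p2 -> k^-1 < r ->
  exists a b lam : nat, [/\ (0 < b)%N, (0 < lam)%N, p2 ^+ a <= ((2 ^ b)%:R)^-1,
    1 <= lam%:R * p1 ^+ a & lam%:R <= (2 ^ b)%:R `^ r].
Proof.
move=> /andP[p10 p11] /andP[p20 p21] k1 kp kr.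
have k0 : 0 < k by rewrite (lt_trans _ k1).
pose x1 := - ln p1; pose x2 := - ln p2; pose l2 : R := ln 2.
have l20 : 0 < l2 by rewrite ln_gt0// ltr1n.
have x20 : 0 < x2 by rewrite oppr_gt0 ln_lt0// p20.
have x12 : k * x1 <= x2.
  have D0 : 0 < 1 - p1 by rewrite subr_gt0.
  have kD : k * (1 - p1) < 1 by rewrite kp; lra.
  have := ln_concave_ratio k1 D0 kD; rewrite kp !subKr /x1 /x2; lra.
have x10 : 0 < x1 by rewrite oppr_gt0 ln_lt0// p10.
have E1 (j : nat) : p1 ^+ j = expR (- (j%:R * x1)).
  by rewrite /x1 mulrN opprK expRM_natl lnK.
have E2 (j : nat) : p2 ^+ j = expR (- (j%:R * x2)).
  by rewrite /x2 mulrN opprK expRM_natl lnK.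
have E3 (j : nat) : (2 ^ j)%:R = expR (j%:R * l2) :> R.
  by rewrite /l2 expRM_natl lnK ?posrE// natrX.
have d0 : 0 < (r - k^-1) * l2 by rewrite mulr_gt0// subr_gt0.
(* Rounding up costs a factor p1^-1 for a and at most 2 for lam; b is large enough for the room
   between 1 / k and r to pay for both. *)
pose b := (Num.truncn ((l2 + x1) / ((r - k^-1) * l2))).+1.
have hb : l2 + x1 <= b%:R * ((r - k^-1) * l2).
  have ge : 0 <= (l2 + x1) / ((r - k^-1) * l2) by rewrite divr_ge0 ?addr_ge0 ?(ltW l20) ?(ltW x10) ?(ltW d0).
  have /andP[_ h] := truncn_itv ge.
  by rewrite -ler_pdivrMr// ltW.
pose a := (Num.truncn (b%:R * l2 / x2)).+1.
have ge : 0 <= b%:R * l2 / x2 by rewrite divr_ge0 ?mulr_ge0 ?(ltW l20) ?(ltW x20).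
have /andP[a1 a2] := truncn_itv ge.
have ha : b%:R * l2 <= a%:R * x2 by rewrite -ler_pdivrMr// ltW.
have ha2 : a%:R * x1 <= x1 + k^-1 * (b%:R * l2).
  have : a%:R <= b%:R * l2 / x2 + 1 by rewrite /a -[_.+1%:R]natr1 lerD2r.
  move=> /(ler_wpM2r (ltW x10)) h; apply: le_trans h _.
  rewrite mulrDl mul1r addrC lerD2l.
  have -> : k^-1 * (b%:R * l2) = b%:R * l2 / x2 * (k^-1 * x2) by field; rewrite !gt_eqF.
  by rewrite ler_wpM2l// ler_pdivlMl.
pose lam := (Num.truncn (expR (a%:R * x1))).+1.
have /andP[l1 l2'] := truncn_itv (expR_ge0 (a%:R * x1)).
exists a, b, lam; split => //.
- by rewrite E2 E3 -expRN ler_expR lerN2.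
- by rewrite E1 expRN ler_pdivlMr ?expR_gt0// mul1r ltW.
- have hl : lam%:R <= expR (l2 + a%:R * x1).
    rewrite expRD /l2 lnK ?posrE//.
    have : 1 <= expR (a%:R * x1) by rewrite -expR0 ler_expR mulr_ge0// ltW.
    by rewrite /lam -[_.+1%:R]natr1; lra.
  apply: le_trans hl _; rewrite E3 /powR gt_eqF ?expR_gt0// expRK ler_expR.
  lra.
Qed.

End HashParameters.

(** * Reasoning about programs *)

Arguments tick : simpl never.
Arguments writei : simpl never.
Arguments writer : simpl never.
Arguments next_coin : simpl never.

Section MemoryView.
Variable R : realType.
Implicit Types (s : state R) (p : cmd R).

(* The memories are used as 32 interleaved arrays: cell x of array k has address 32 x + k. *)
Definition stride : nat := 32.

Definition iv s (k x : nat) : nat := imem s (x * stride + k).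
Definition rv s (k x : nat) : R := rmem s (x * stride + k).
Definition wi (k x v : nat) s : state R := writei (x * stride + k) v s.
Definition wr (k x : nat) (v : R) s : state R := writer (x * stride + k) v s.

Arguments iv : simpl never.
Arguments rv : simpl never.
Arguments wi : simpl never.
Arguments wr : simpl never.

Definition arr (k : nat) (e : iexp) : iexp := IAdd (IMul e (INat stride)) (INat k).

Lemma addr_inj k k' x x' : (k < stride)%N -> (k' < stride)%N ->
  (x * stride + k == x' * stride + k')%N = (k == k') && (x == x').
Proof.
move=> kA kA'; apply/eqP/andP => [h|[/eqP -> /eqP ->]//].
have h1 := congr1 (fun z => z %% stride)%N h; have h2 := congr1 (fun z => z %/ stride)%N h.
move: h1 h2; rewrite !modnMDl !modn_small// !divnMDl// !divn_small// !addn0.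
by move=> -> ->.
Qed.

Lemma iv_wi s k k' x x' v : (k < stride)%N -> (k' < stride)%N ->
  iv (wi k' x' v s) k x = if (k == k') && (x == x') then v else iv s k x.
Proof. by move=> kA kA'; rewrite /iv /wi /writei /= addr_inj//. Qed.

Lemma rv_wr s k k' x x' v : (k < stride)%N -> (k' < stride)%N ->
  rv (wr k' x' v s) k x = if (k == k') && (x == x') then v else rv s k x.
Proof. by move=> kA kA'; rewrite /rv /wr /writer /= addr_inj. Qed.

Lemma iv_wr s k k' x x' v : iv (wr k' x' v s) k x = iv s k x. Proof. by []. Qed.
Lemma rv_wi s k k' x x' v : rv (wi k' x' v s) k x = rv s k x. Proof. by []. Qed.
Lemma iv_tick s k x c : iv (tick c s) k x = iv s k x. Proof. by []. Qed.
Lemma rv_tick s k x c : rv (tick c s) k x = rv s k x. Proof. by []. Qed.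
Lemma iv_coin s k x : iv (next_coin s) k x = iv s k x. Proof. by []. Qed.
Lemma rv_coin s k x : rv (next_coin s) k x = rv s k x. Proof. by []. Qed.
Lemma coins_wi s k x v : coins (wi k x v s) = coins s. Proof. by []. Qed.
Lemma coins_wr s k x v : coins (wr k x v s) = coins s. Proof. by []. Qed.
Lemma coins_tick s c : coins (tick c s) = coins s. Proof. by []. Qed.
Lemma coins_coin s : coins (next_coin s) = (coins s).+1. Proof. by []. Qed.
Lemma clock_wi s k x v : clock (wi k x v s) = clock s. Proof. by []. Qed.
Lemma clock_wr s k x v : clock (wr k x v s) = clock s. Proof. by []. Qed.
Lemma clock_tick s c : clock (tick c s) = (clock s + c)%N. Proof. by []. Qed.
Lemma clock_coin s : clock (next_coin s) = clock s. Proof. by []. Qed.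

Definition fits (Y : nat) s : bool :=
  (itop s <= Y * stride)%N && (rtop s <= Y * stride)%N.

Lemma fits_tick Y s c : fits Y (tick c s) = fits Y s. Proof. by []. Qed.
Lemma fits_coin Y s : fits Y (next_coin s) = fits Y s. Proof. by []. Qed.

Let addr_lt Y k x : (x < Y)%N -> (k < stride)%N -> (x * stride + k < Y * stride)%N.
Proof.
move=> xY kA; apply: (@leq_trans (x.+1 * stride)); last by rewrite leq_mul2r xY orbT.
by rewrite mulSn addnC ltn_add2r.
Qed.

Lemma fits_wi Y s k x v : (x < Y)%N -> (k < stride)%N -> fits Y s -> fits Y (wi k x v s).
Proof.
by move=> xY kA /andP[h1 h2]; rewrite /fits /= geq_max h1 h2 addr_lt.
Qed.

Lemma fits_wr Y s k x v : (x < Y)%N -> (k < stride)%N -> fits Y s -> fits Y (wr k x v s).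
Proof.
by move=> xY kA /andP[h1 h2]; rewrite /fits /= geq_max h1 h2 addr_lt.
Qed.

Lemma cells_fits Y s : fits Y s -> (cells s <= 64 * Y)%N.
Proof.
rewrite /fits /cells => /andP[h1 h2]; apply: leq_trans (leq_add h1 h2) _.
by rewrite -[stride]/32%N; lia.
Qed.

(** Recognises the two address shapes in use, a register (cell 0 of its array) and [arr k e], so
    that frame conditions are decided by computation. *)
Definition addr_var (a : iexp) : option nat :=
  match a with
  | INat k => if (k < stride)%N then Some k else None
  | IAdd (IMul _ (INat w)) (INat k) =>
      if (w == stride) && (k < stride)%N then Some k else None
  | _ => None
  end.

(* Every address in the program denotes a cell of a syntactically known array. *)
Fixpoint framed p : bool :=
  match p with
  | Skip => true
  | SetI a _ | SetR a _ | Flip a => addr_var a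
  | Seq p1 p2 | IfI _ _ p1 p2 | IfR _ _ p1 p2 => framed p1 && framed p2
  | For a _ p1 => addr_var a && framed p1
  end.

Definition var_list (a : iexp) : seq nat := if addr_var a is Some k then [:: k] else [::].

Fixpoint imods p : seq nat :=
  match p with
  | Skip | SetR _ _ => [::]
  | SetI a _ | Flip a => var_list a
  | Seq p1 p2 | IfI _ _ p1 p2 | IfR _ _ p1 p2 => imods p1 ++ imods p2
  | For a _ p1 => var_list a ++ imods p1
  end.

Fixpoint rmods p : seq nat :=
  match p with
  | Skip | SetI _ _ | Flip _ => [::]
  | SetR a _ => var_list a
  | Seq p1 p2 | IfI _ _ p1 p2 | IfR _ _ p1 p2 => rmods p1 ++ rmods p2
  | For _ _ p1 => rmods p1
  end.

Fixpoint flipless p : bool :=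
  match p with
  | Flip _ => false
  | Seq p1 p2 | IfI _ _ p1 p2 | IfR _ _ p1 p2 => flipless p1 && flipless p2
  | For _ _ p1 => flipless p1
  | _ => true
  end.

Variables (env : seq (pgon R)) (tape : nat -> bool).
Local Notation run := (exec env tape).
Local Notation iev := (ieval env).
Local Notation rev := (reval env).

Lemma addr_varP s a : addr_var a ->
  exists k x, [/\ (k < stride)%N, addr_var a = Some k, var_list a = [:: k] &
    iev s a = (x * stride + k)%N].
Proof.
rewrite /var_list; case: a => //= [k|e1 e2].
  by case: ifP => // kA _; exists k, 0%N.
case: e1 => //= e w; case: w => // w; case: e2 => // k.
by case: ifP => // /andP[/eqP -> kA] _; exists k, (iev s e).
Qed.

Lemma imem_frame k x v s w y : (k < stride)%N -> (w < stride)%N -> k != w ->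
  iv (writei (y * stride + w) v s) k x = iv s k x.
Proof. by move=> kA wA kw; rewrite -/(wi w y v s) iv_wi// (negPf kw). Qed.

Lemma for_ind (I : nat -> state R -> Prop) a e p s :
  I 0 (tick (isize a + isize e).+1 s) ->
  (forall i t, (i < iev s e)%N -> I i t -> I i.+1 (run p (tick 1 (writei (iev s a) i t)))) ->
  I (iev s e) (run (For a e p) s).
Proof.
move=> I0 IS /=; set x := iev s a; set N := iev s e.
suff H n t m : (m + n = N)%N -> I m t ->
    I N (foldl (fun t i => run p (tick 1 (writei x i t))) t (iota m n)).
  exact: (H N _ 0%N).
elim: n m t => [|n IH] m t mn It /=; first by rewrite -mn addn0.
apply: IH; first by rewrite addSnnS.
by apply: IS => //; rewrite -/N -mn addnS ltnS leq_addr.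
Qed.

Lemma frame_iv p s k x : framed p -> (k < stride)%N -> k \notin imods p ->
  iv (run p s) k x = iv s k x.
Proof.
elim: p s => //= [a e|a|p1 IH1 p2 IH2|e1 e2 p1 IH1 p2 IH2|e1 e2 p1 IH1 p2 IH2|a e p IH] s.
- move=> /(addr_varP s)[w [y [wA _ -> ->]]] kA; rewrite inE => kw.
  by rewrite iv_tick imem_frame.
- move=> /(addr_varP s)[w [y [wA _ -> ->]]] kA; rewrite inE => kw.
  by rewrite iv_tick iv_coin imem_frame.
- by move=> /andP[f1 f2] kA; rewrite mem_cat negb_or => /andP[k1 k2]; rewrite IH2// IH1.
- move=> /andP[f1 f2] kA; rewrite mem_cat negb_or => /andP[k1 k2].
  by case: ifP => _; [rewrite IH1|rewrite IH2].
- move=> /andP[f1 f2] kA; rewrite mem_cat negb_or => /andP[k1 k2].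
  by case: ifP => _; [rewrite IH1|rewrite IH2].
- move=> /andP[fa fp] kA; have [w [y [wA _ E Ea]]] := addr_varP s fa.
  rewrite E mem_cat inE negb_or => /andP[kw kp].
  apply: (@for_ind (fun _ t => iv t k x = iv s k x)) => // i t _ It.
  by rewrite IH// iv_tick Ea imem_frame.
Qed.

Lemma frame_rv p s k x : framed p -> (k < stride)%N -> k \notin rmods p ->
  rv (run p s) k x = rv s k x.
Proof.
elim: p s => //= [a e|p1 IH1 p2 IH2|e1 e2 p1 IH1 p2 IH2|e1 e2 p1 IH1 p2 IH2|a e p IH] s.
- move=> /(addr_varP s)[w [y [wA _ -> ->]]] kA; rewrite inE => kw.
  by rewrite rv_tick -/(wr w y _ s) rv_wr// (negPf kw).
- by move=> /andP[f1 f2] kA; rewrite mem_cat negb_or => /andP[k1 k2]; rewrite IH2// IH1.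
- move=> /andP[f1 f2] kA; rewrite mem_cat negb_or => /andP[k1 k2].
  by case: ifP => _; [rewrite IH1|rewrite IH2].
- move=> /andP[f1 f2] kA; rewrite mem_cat negb_or => /andP[k1 k2].
  by case: ifP => _; [rewrite IH1|rewrite IH2].
- move=> /andP[fa fp] kA kp.
  by apply: (@for_ind (fun _ t => rv t k x = rv s k x)) => // i t _ It; rewrite IH.
Qed.

Lemma frame_coins p s : flipless p -> coins (run p s) = coins s.
Proof.
elim: p s => //= [p1 IH1 p2 IH2|e1 e2 p1 IH1 p2 IH2|e1 e2 p1 IH1 p2 IH2|a e p IH] s.
- by move=> /andP[f1 f2]; rewrite IH2// IH1.
- by move=> /andP[f1 f2]; case: ifP => _; [rewrite IH1|rewrite IH2].
- by move=> /andP[f1 f2]; case: ifP => _; [rewrite IH1|rewrite IH2].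
- move=> fp; apply: (@for_ind (fun _ t => coins t = coins s)) => // i t _ It.
  by rewrite IH.
Qed.

Lemma ev_nat s k : iev s (INat k) = k. Proof. by []. Qed.
Lemma ev_var s k : iev s (IMem (INat k)) = iv s k 0. Proof. by []. Qed.
Lemma ev_arr s k e : iev s (IMem (arr k e)) = iv s k (iev s e). Proof. by []. Qed.
Lemma ev_add s e1 e2 : iev s (IAdd e1 e2) = (iev s e1 + iev s e2)%N. Proof. by []. Qed.
Lemma ev_sub s e1 e2 : iev s (ISub e1 e2) = (iev s e1 - iev s e2)%N. Proof. by []. Qed.
Lemma ev_mul s e1 e2 : iev s (IMul e1 e2) = (iev s e1 * iev s e2)%N. Proof. by []. Qed.
Lemma ev_objects s : iev s IObjects = size env. Proof. by []. Qed.
Lemma ev_verts s e : iev s (IVerts e) = nverts (nth (pgon0 R) env (iev s e)).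
Proof. by []. Qed.
Definition ievE := (ev_nat, ev_var, ev_arr, ev_add, ev_sub, ev_mul, ev_objects, ev_verts).

Lemma rev_const s x : rev s (RConst x) = x. Proof. by []. Qed.
Lemma rev_var s k : rev s (RMem R (INat k)) = rv s k 0. Proof. by []. Qed.
Lemma rev_arr s k e : rev s (RMem R (arr k e)) = rv s k (iev s e). Proof. by []. Qed.
Lemma rev_nat s e : rev s (RNat R e) = (iev s e)%:R. Proof. by []. Qed.
Lemma rev_add s e1 e2 : rev s (RAdd e1 e2) = rev s e1 + rev s e2. Proof. by []. Qed.
Lemma rev_sub s e1 e2 : rev s (RSub e1 e2) = rev s e1 - rev s e2. Proof. by []. Qed.
Lemma rev_mul s e1 e2 : rev s (RMul e1 e2) = rev s e1 * rev s e2. Proof. by []. Qed.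
Lemma rev_div s e1 e2 : rev s (RDiv e1 e2) = rev s e1 / rev s e2. Proof. by []. Qed.
Lemma rev_sqrt s e : rev s (RSqrt e) = Num.sqrt (rev s e). Proof. by []. Qed.
Lemma rev_acos s e : rev s (RAcos e) = acos (rev s e). Proof. by []. Qed.
Lemma rev_vx s i j : rev s (RVertX R i j) = (vert (nth (pgon0 R) env (iev s i)) (iev s j)).1.
Proof. by []. Qed.
Lemma rev_vy s i j : rev s (RVertY R i j) = (vert (nth (pgon0 R) env (iev s i)) (iev s j)).2.
Proof. by []. Qed.
Lemma rev_base s i : rev s (RBase R i) = base (nth (pgon0 R) env (iev s i)).
Proof. by []. Qed.
Lemma rev_dist s i j : rev s (RDist R i j) =
  D2 (nth (pgon0 R) env (iev s i)) (nth (pgon0 R) env (iev s j)).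
Proof. by []. Qed.
Definition revE := (rev_const, rev_var, rev_arr, rev_nat, rev_add, rev_sub, rev_mul,
  rev_div, rev_sqrt, rev_acos, rev_vx, rev_vy, rev_base, rev_dist).

Lemma run_seq p1 p2 s : run (Seq p1 p2) s = run p2 (run p1 s). Proof. by []. Qed.
Lemma run_skip s : run (Skip R) s = s. Proof. by []. Qed.
Lemma run_seti s k e : run (SetI R (INat k) e) s =
  tick (isize e).+2 (wi k 0 (iev s e) s).
Proof. by []. Qed.
Lemma run_setia s k a e : run (SetI R (arr k a) e) s =
  tick (isize (arr k a) + isize e).+1 (wi k (iev s a) (iev s e) s).
Proof. by []. Qed.
Lemma run_setr s k e : run (SetR (INat k) e) s =
  tick (rsize e).+2 (wr k 0 (rev s e) s).
Proof. by []. Qed.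
Lemma run_setra s k a e : run (SetR (arr k a) e) s =
  tick (isize (arr k a) + rsize e).+1 (wr k (iev s a) (rev s e) s).
Proof. by []. Qed.
Lemma run_flip s k : run (Flip R (INat k)) s =
  tick 2 (next_coin (wi k 0 (tape (coins s)) s)).
Proof. by []. Qed.
Lemma run_ifi s e1 e2 p1 p2 : run (IfI e1 e2 p1 p2) s =
  if (iev s e1 <= iev s e2)%N then run p1 (tick (isize e1 + isize e2).+1 s) else run p2 (tick (isize e1 + isize e2).+1 s).
Proof. by []. Qed.
Lemma run_ifr s e1 e2 p1 p2 : run (IfR e1 e2 p1 p2) s =
  if rev s e1 <= rev s e2 then run p1 (tick (rsize e1 + rsize e2).+1 s) else run p2 (tick (rsize e1 + rsize e2).+1 s).
Proof. by []. Qed.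
Definition runE := (run_seq, run_skip, run_seti, run_setia, run_setr, run_setra,
  run_flip, run_ifi, run_ifr).

(* The loop rule with the frame conditions built in. *)
Lemma for_rule (I : nat -> state R -> Prop) k e p s :
  framed (For (INat k) e p) ->
  I 0 (tick (isize e).+2 s) ->
  (forall i t, (i < iev s e)%N ->
    (forall k' x, (k' < stride)%N -> k' \notin imods (For (INat k) e p) ->
      iv t k' x = iv s k' x) ->
    (forall k' x, (k' < stride)%N -> k' \notin rmods p -> rv t k' x = rv s k' x) ->
    I i t -> I i.+1 (run p (tick 1 (wi k 0 i t)))) ->
  I (iev s e) (run (For (INat k) e p) s).
Proof.
move=> fp I0 IS.
pose J i t := (forall k' x, (k' < stride)%N -> k' \notin imods (For (INat k) e p) ->
      iv t k' x = iv s k' x) /\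
    (forall k' x, (k' < stride)%N -> k' \notin rmods p -> rv t k' x = rv s k' x) /\ I i t.
suff : J (iev s e) (run (For (INat k) e p) s) by move=> [_ []].
apply: for_ind => //= i t iN [h1 [h2 It]]; move: fp => /=.
case: ifP => //= kA fp.
have hm k' : k' \notin imods (For (INat k) e p) -> (k' == k = false) /\ k' \notin imods p.
  by rewrite /= /var_list /= kA inE negb_or => /andP[/negPf -> ->].
split; [|split].
- move=> k' x k'A /hm[kk kp]; rewrite frame_iv// iv_tick.
  rewrite -[writei _ _ _]/(wi k 0 i t) iv_wi// kk h1//.
  by rewrite /= /var_list /= kA inE kk.
- by move=> k' x k'A kp; rewrite frame_rv// -[LHS]/(rv t k' x) h2.
- exact: (IS i t iN h1 h2 It).
Qed.

Lemma for_rule_eq (n : nat) (I : nat -> state R -> Prop) k e p s :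
  iev s e = n -> framed (For (INat k) e p) ->
  I 0 (tick (isize e).+2 s) ->
  (forall i t, (i < n)%N ->
    (forall k' x, (k' < stride)%N -> k' \notin imods (For (INat k) e p) ->
      iv t k' x = iv s k' x) ->
    (forall k' x, (k' < stride)%N -> k' \notin rmods p -> rv t k' x = rv s k' x) ->
    I i t -> I i.+1 (run p (tick 1 (wi k 0 i t)))) ->
  I n (run (For (INat k) e p) s).
Proof. by move=> <-; exact: for_rule. Qed.

End MemoryView.

(** * The data structure *)

Arguments iv : simpl never.
Arguments rv : simpl never.
Arguments wi : simpl never.
Arguments wr : simpl never.
Arguments fits : simpl never.
Local Opaque iv rv wi wr fits tick next_coin.

Notation "p ;; q" := (Seq p q) (at level 90, right associativity).
Notation V k := (IMem (INat k)).
Notation stE := (iv_tick, rv_tick, iv_coin, rv_coin, iv_wr, rv_wi, coins_wi, coins_wr,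
  coins_tick, coins_coin, clock_wi, clock_wr, clock_tick, clock_coin, fits_tick, fits_coin).

Ltac sx := rewrite ?(stE, ievE, revE, iv_wi, rv_wr)//=.

Ltac fx := repeat first [rewrite fits_tick | rewrite fits_coin |
  apply: fits_wi => // | apply: fits_wr => //].

(* Closes goals [k \in l1 -> k \in l2] for explicit lists of array numbers. *)
Ltac inx := rewrite /= !inE; repeat (case/orP; [by move/eqP=> ->|]); by move/eqP=> ->.

Section Code.
Variables (R : realType) (m d q a b lam B : nat) (sc cr : R).

(* Integer registers: 0 answer, 1 T, 2 L, 3 K, 4 bits of T, 5 object, 6 table, 7 shift,
   8-15 temporaries (11 the computed key).  Integer arrays: 20 list heads, 21 list links,
   22 multipliers, 23 grid positions of the vertices.  Real registers: 0-4 temporaries.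
   Real arrays: 20 offsets, 21 projections, 22 turning angles. *)

Definition c_rnd (N : iexp) : cmd R :=
  SetI R (INat 15) (INat 0) ;;
  For (INat 10) N
    (Flip R (INat 13) ;;
     SetI R (INat 15) (IAdd (IMul (INat 2) (V 15)) (V 13))).

(** The exponent is unknown when the text is written, so T, L, K and the number of bits of T grow
    together until T reaches n. As loops are bounded, n rounds are run, which is enough because
    (2^b)^n >= n. *)
Definition c_size : cmd R :=
  SetI R (INat 1) (INat 1) ;; SetI R (INat 2) (INat 1) ;;
  SetI R (INat 3) (INat 0) ;; SetI R (INat 4) (INat 0) ;;
  For (INat 8) IObjects
    (IfI IObjects (V 1) (Skip R)
      (SetI R (INat 1) (IMul (V 1) (INat (2 ^ b))) ;;
       SetI R (INat 2) (IMul (V 2) (INat lam)) ;;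
       SetI R (INat 3) (IAdd (V 3) (INat a)) ;;
       SetI R (INat 4) (IAdd (V 4) (INat b)))).

(** Each hash function owns a block of 2 d + 1 cells, since [c_bit] reads suffix sums at positions
    up to 2 d; those past d keep their initial value 0. *)
Definition om (t : iexp) : iexp := IAdd (IMul (V 9) (INat (2 * d + 1))) t.

Definition c_hashfun : cmd R :=
  c_rnd (V 4) ;; SetI R (arr 22 (V 9)) (V 15) ;;
  c_rnd (INat q.+1) ;;
  SetR (arr 20 (V 9)) (RDiv (RNat R (V 15)) (RConst (2 ^ q)%:R)) ;;
  SetR (arr 21 (om (INat 0))) (RConst 0) ;;
  For (INat 10) (INat d)
    (Flip R (INat 13) ;;
     SetR (arr 21 (om (IAdd (V 10) (INat 1))))
       (RAdd (RMem R (arr 21 (om (V 10))))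
         (RSub (RMul (RConst 2) (RNat R (V 13))) (RConst 1)))) ;;
  SetR (INat 0) (RMem R (arr 21 (om (INat d)))) ;;
  For (INat 10) (INat d.+1)
    (SetR (arr 21 (om (V 10)))
      (RSub (RMul (RDiv (RNat R (V 10)) (RConst d%:R)) (RMem R (INat 0)))
            (RMem R (arr 21 (om (V 10)))))).

Definition c_gen : cmd R := For (INat 9) (IMul (V 2) (V 3)) c_hashfun.

Definition e_x (t : iexp) : rexp R :=
  RSub (RVertX R (V 5) (IAdd t (INat 1))) (RVertX R (V 5) t).
Definition e_y (t : iexp) : rexp R :=
  RSub (RVertY R (V 5) (IAdd t (INat 1))) (RVertY R (V 5) t).
Definition e_len (t : iexp) : rexp R :=
  RSqrt (RAdd (RMul (e_x t) (e_x t)) (RMul (e_y t) (e_y t))).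
Definition e_cross (t u : iexp) : rexp R :=
  RSub (RMul (e_x t) (e_y u)) (RMul (e_y t) (e_x u)).
Definition e_ang (t u : iexp) : rexp R :=
  RAcos (RDiv (RAdd (RMul (e_x t) (e_x u)) (RMul (e_y t) (e_y u)))
              (RMul (e_len t) (e_len u))).

Definition pos_ix : iexp := IAdd (IMul (V 5) (INat m)) (V 10).

(** Without rounding, the grid position of a vertex is found by comparison with all d grid
    points. *)
Definition c_prep : cmd R :=
  SetR (INat 2) (RConst 0) ;;
  For (INat 10) (IVerts (V 5)) (SetR (INat 2) (RAdd (RMem R (INat 2)) (e_len (V 10)))) ;;
  SetR (INat 3) (RSub (RConst 0) (RMul (RBase R (V 5)) (e_len (INat 0)))) ;;
  For (INat 10) (IVerts (V 5))
    (SetR (INat 3) (RAdd (RMem R (INat 3)) (e_len (V 10))) ;;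
     IfR (RConst 0) (e_cross (V 10) (IAdd (V 10) (INat 1)))
       (SetR (arr 22 pos_ix) (e_ang (V 10) (IAdd (V 10) (INat 1))))
       (SetR (arr 22 pos_ix) (RSub (RConst 0) (e_ang (V 10) (IAdd (V 10) (INat 1))))) ;;
     SetI R (INat 15) (INat 0) ;;
     SetR (INat 4) (RDiv (RMem R (INat 3)) (RMem R (INat 2))) ;;
     For (INat 12) (INat d)
       (IfR (RMem R (INat 4)) (RDiv (RNat R (V 12)) (RConst d%:R)) (Skip R)
         (SetI R (INat 15) (IAdd (V 15) (INat 1)))) ;;
     SetI R (arr 23 pos_ix) (V 15)).

Definition e_om (t : iexp) : rexp R := RMem R (arr 21 (om t)).
Definition e_pos : iexp := IMem (arr 23 pos_ix).

(** The first loop evaluates [hval]. The second subtracts 2^B, ..., 4, 2 whenever possible and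
    leaves the value modulo 2, whose comparison with 1 is the parity of the floor. *)
Definition c_bit : cmd R :=
  SetR (INat 0) (RMul (RConst (2 * pi)) (e_om (ISub (INat d) (V 7)))) ;;
  For (INat 10) (IVerts (V 5))
    (SetR (INat 0) (RAdd (RMem R (INat 0)) (RMul (RMem R (arr 22 pos_ix))
       (RAdd (RSub (e_om (ISub e_pos (V 7))) (e_om (ISub (INat d) (V 7))))
             (e_om (ISub (IAdd e_pos (INat d)) (V 7))))))) ;;
  SetR (INat 0) (RAdd (RAdd (RMul (RConst sc) (RMem R (INat 0))) (RConst (2 ^ B)%:R))
                      (RMem R (arr 20 (V 9)))) ;;
  SetR (INat 1) (RConst (2 ^ B)%:R) ;;
  For (INat 10) (INat B)
    (IfR (RMem R (INat 1)) (RMem R (INat 0))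
       (SetR (INat 0) (RSub (RMem R (INat 0)) (RMem R (INat 1)))) (Skip R) ;;
     SetR (INat 1) (RDiv (RMem R (INat 1)) (RConst 2))).

Definition c_key : cmd R :=
  SetI R (INat 11) (INat 0) ;;
  For (INat 14) (V 3)
    (SetI R (INat 9) (IAdd (IMul (V 6) (V 3)) (V 14)) ;;
     c_bit ;;
     IfR (RConst 1) (RMem R (INat 0))
       (SetI R (INat 11) (IAdd (V 11) (IMem (arr 22 (V 9)))) ;;
        IfI (V 1) (V 11) (SetI R (INat 11) (ISub (V 11) (V 1))) (Skip R))
       (Skip R)).

Definition head_ix : iexp := IAdd (IMul (V 6) (V 1)) (V 11).

(** Objects are entered as their number plus one, so that memory filled with 0 represents empty
    lists. *)
Definition c_insert : cmd R :=
  For (INat 6) (V 2)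
    (For (INat 5) IObjects
      (SetI R (INat 7) (INat 0) ;; c_key ;;
       SetI R (arr 21 (IAdd (IMul (V 6) IObjects) (V 5))) (IMem (arr 20 head_ix)) ;;
       SetI R (arr 20 head_ix) (IAdd (V 5) (INat 1)))).

(** For n <= d nothing is stored and the query scans all objects; the same test in [c_query] selects
    that branch. *)
Definition c_preproc : cmd R :=
  IfI IObjects (INat d) (Skip R)
    (c_size ;; c_gen ;; For (INat 5) IObjects c_prep ;; c_insert).

Definition nobj : iexp := ISub IObjects (INat 1).

Definition c_brute : cmd R :=
  For (INat 5) nobj
    (IfR (RDist R (V 5) nobj) (RConst cr) (SetI R (INat 0) (V 5)) (Skip R)).

Definition c_lookup : cmd R :=
  c_key ;; SetI R (INat 12) (IMem (arr 20 head_ix)) ;;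
  SetI R (INat 6) (IAdd (V 6) (INat 1)).

Definition c_visit : cmd R :=
  SetI R (INat 15) (ISub (V 12) (INat 1)) ;;
  IfR (RDist R (V 15) nobj) (RConst cr) (SetI R (INat 0) (V 15)) (Skip R) ;;
  SetI R (INat 12) (IMem (arr 21 (IAdd (IMul (ISub (V 6) (INat 1)) nobj) (V 15)))).

(** The search of all buckets, flattened into uniform steps so that a bounded loop can cap the total
    work. Register 6 counts the tables already opened, hence the current one has number one less. *)
Definition c_step : cmd R :=
  IfI (V 12) (INat 0)
    (IfI (IAdd (V 6) (INat 1)) (V 2) c_lookup (Skip R)) c_visit.

Definition c_shift : cmd R :=
  SetI R (INat 6) (INat 0) ;; SetI R (INat 12) (INat 0) ;;
  For (INat 8) (IMul (INat 9) (V 2)) c_step.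

Definition c_query : cmd R :=
  IfI nobj (INat d) c_brute
    (SetI R (INat 5) nobj ;; c_prep ;; For (INat 7) (INat d.+1) c_shift).

End Code.

Section CodeSpec.
Variables (R : realType) (m d q a b lam B : nat) (sc cr : R).
Variables (env : seq (pgon R)) (tape : nat -> bool) (Y : nat).
Hypothesis Y0 : (0 < Y)%N.
Local Notation run := (exec env tape).
Local Notation iev := (ieval env).
Implicit Types s t : state R.

Lemma c_rnd_spec N n s : fits Y s ->
  (forall t, iv t 4 0 = iv s 4 0 -> iev t N = n) ->
  let s' := run (c_rnd R N) s in
  [/\ iv s' 15 0 = binv n (tdrop (coins s) tape), coins s' = (coins s + n)%N,
      (clock s' <= clock s + isize N + 20 + n * 20)%N & fits Y s'].
Proof.
move=> fs hN; rewrite /c_rnd !runE.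
set s1 := tick _ _.
have E : iev s1 N = n by apply: hN; rewrite /s1 !stE iv_wi.
pose I i t := [/\ iv t 15 0 = binv i (tdrop (coins s) tape), coins t = (coins s + i)%N,
      (clock t <= clock s + isize N + 20 + i * 20)%N & fits Y t].
set p := For _ _ _; suff : I n (run p s1) by [].
apply: (@for_rule_eq _ _ _ n I) => //.
  rewrite /I /s1 ?stE iv_wi//= addn0; split => //.
    by rewrite -!addnA leq_add2l; lia.
  by apply: fits_wi.
move=> i t iN _ _ [h1 h2 h3 h4].
rewrite !runE /I; sx; rewrite h1 h2; split => //.
- by rewrite addnS.
- by lia.
- by fx.
Qed.

Local Notation U := (up_log (2 ^ b) (size env)).

Lemma c_size_spec s : (0 < b)%N -> fits Y s ->
  let s' := run (c_size R a b lam) s in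
  [/\ iv s' 1 0 = ((2 ^ b) ^ U)%N, iv s' 2 0 = (lam ^ U)%N, iv s' 3 0 = (a * U)%N,
      iv s' 4 0 = (b * U)%N & [/\ coins s' = coins s,
      (clock s' <= clock s + 60 + size env * 60)%N & fits Y s']].
Proof.
move=> b0 fs; have b1 : (1 < 2 ^ b)%N by rewrite -{1}(expn0 2) ltn_exp2l.
have Un : (U <= size env)%N by apply: up_log_min => //; exact/ltnW/ltn_expl.
rewrite /c_size !runE; set s1 := tick _ _.
pose I i t := let e := minn i U in
  [/\ iv t 1 0 = ((2 ^ b) ^ e)%N, iv t 2 0 = (lam ^ e)%N, iv t 3 0 = (a * e)%N,
      iv t 4 0 = (b * e)%N & [/\ coins t = coins s,
      (clock t <= clock s + 60 + i * 60)%N & fits Y t]].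
set p := For _ _ _; suff : I (size env) (run p s1) by rewrite /I (minn_idPr Un).
apply: (@for_rule_eq _ _ _ _ I) => //.
  rewrite /I /s1; sx; rewrite min0n !expn0 !muln0; split => //; split => //; first lia.
  by fx.
move=> i t iN _ _ [h1 h2 h3 h4 [h5 h6 h7]].
rewrite !runE; sx; move: h1 h2 h3 h4.
have [iU|Ui] := ltnP i U; move=> h1 h2 h3 h4; rewrite h1.
  have -> : (size env <= (2 ^ b) ^ i)%N = false.
    apply/negP => h; have := up_log_min b1 h; by rewrite leqNgt iU.
  rewrite /I (minn_idPl iU); sx; rewrite ?(h1, h2, h3, h4).
  split; [by rewrite expnSr|by rewrite expnSr|lia|lia|split => //; first lia].
  by fx.
rewrite (up_logP (size env) b1) /I (minn_idPr (leqW Ui)); sx.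
rewrite ?(h1, h2, h3, h4); split => //; split => //; first lia.
by fx.
Qed.

End CodeSpec.

Section Generation.
Variables (R : realType) (d q : nat).
Variables (env : seq (pgon R)) (tape : nat -> bool) (Y : nat).
Hypothesis Y0 : (0 < Y)%N.
Local Notation run := (exec env tape).
Local Notation iev := (ieval env).
Implicit Types s : state R.

Definition prefix (w : nat -> bool) (t : nat) : R := \sum_(j < t) sgn R (w j).

(* The partial sums of signs recentred to total 0, as a function of the starting point. *)
Definition bridge (w : nat -> bool) (t : nat) : R :=
  if (t <= d)%N then t%:R / d%:R * prefix w d - prefix w t else 0.

Local Notation D := (2 * d + 1)%N.

Lemma rnd_frame_iv N s k x : (k < stride)%N -> k \notin [:: 15; 10; 13]%N ->
  iv (run (c_rnd R N) s) k x = iv s k x.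
Proof. by move=> kA kn; apply: frame_iv => //; apply: contra kn; inx. Qed.

Lemma rnd_frame_rv N s k x : (k < stride)%N ->
  rv (run (c_rnd R N) s) k x = rv s k x.
Proof. by move=> kA; apply: frame_rv. Qed.

Lemma c_hashfun_spec h nb s : fits Y s -> iv s 9 0 = h -> iv s 4 0 = nb ->
  (h * D + d < Y)%N -> (h < Y)%N ->
  let s' := run (c_hashfun R d q) s in
  [/\ iv s' 22 h = binv nb (tdrop (coins s) tape),
     rv s' 20 h = (binv q.+1 (tdrop (coins s + nb) tape))%:R / (2 ^ q)%:R,
     forall t : nat, (t <= d)%N ->
       rv s' 21 (h * D + t) = bridge (tdrop (coins s + nb + q.+1) tape) t,
     [/\ forall x, x != h -> iv s' 22 x = iv s 22 x,
      forall x, x != h -> rv s' 20 x = rv s 20 x &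
      forall x, ~~ (h * D <= x <= h * D + d)%N -> rv s' 21 x = rv s 21 x] &
     [/\ coins s' = (coins s + hash_coins d q nb)%N,
      (clock s' <= clock s + 200 + 20 * nb + 20 * q.+1 + 100 * d.+1)%N & fits Y s']].
Proof.
move=> fs h9 h4 hD hY.
rewrite /c_hashfun run_seq.
have [] := @c_rnd_spec R env tape Y Y0 (V 4) nb s fs; first by move=> t; rewrite ievE h4.
have f1 := @rnd_frame_iv (V 4) s; have g1 := @rnd_frame_rv (V 4) s.
move: f1 g1; set s1 := run _ s => f1 g1 a1 a2 a3 a4.
rewrite run_seq run_setia ievE f1// h9; move E2: (tick _ _) => s2.
have b4 : fits Y s2 by rewrite -E2; fx.
rewrite run_seq.
have [] := @c_rnd_spec R env tape Y Y0 (INat q.+1) q.+1 s2 b4; first by [].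
have f3 := @rnd_frame_iv (INat q.+1) s2; have g3 := @rnd_frame_rv (INat q.+1) s2.
move: f3 g3; set s3 := run _ s2 => f3 g3 c1 c2 c3 c4.
rewrite run_seq run_setra ievE; move E4: (tick _ _) => s4.
have h49 : iv s4 9 0 = h by rewrite -E4; sx; rewrite f3// -E2; sx; rewrite f1.
rewrite run_seq run_setra; move E5: (tick _ _) => s5.
have ix5 : iev s4 (om d (INat 0)) = (h * D)%N by rewrite /om; sx; rewrite h49 addn0.
have h59 : iv s5 9 0 = h by rewrite -E5; sx.
rewrite run_seq; set p6 := For _ (INat d) _.
pose w := tdrop (coins s5) tape.
pose I1 i t := [/\ coins t = (coins s5 + i)%N,
  forall u : nat, (u <= i)%N -> rv t 21 (h * D + u) = prefix w u,
  forall x, ~~ (h * D <= x <= h * D + d)%N -> rv t 21 x = rv s5 21 x,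
  (clock t <= clock s5 + 10 + 40 * i)%N & fits Y t].
have h39 : iv s3 9 0 = h by rewrite f3// -E2; sx; rewrite f1.
have hD0 : (h * D < Y)%N by apply: leq_ltn_trans hD; rewrite leq_addr.
have : I1 d (run p6 s5).
  apply: (@for_rule_eq _ _ _ _ I1) => //.
    rewrite /I1; sx; split => //; last 2 first.
    - by lia.
    - by rewrite -E5 ix5; fx; rewrite -E4 h39; fx.
    - by rewrite addn0.
    - move=> u; rewrite leqn0 => /eqP ->; rewrite addn0 /prefix big_ord0 -E5; sx.
      by rewrite ?ix5 ?h49 ?addn0 eqxx.
  move=> i t id fi fr [i1 i2 i3 i4 i5].
  have t9 : iv t 9 0 = h by rewrite fi.
  rewrite !runE /I1 /om; sx; rewrite !t9.
  have hix : (h * D + (i + 1) < Y)%N by lia.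
  split.
  - by rewrite i1 addnS.
  - move=> u ui; sx; rewrite eqn_add2l addn1; case: eqP => [->|ne].
      by rewrite i2// /prefix big_ord_recr/= /w /tdrop i1.
    by rewrite i2//; lia.
  - move=> x hx; sx; case: eqP => [e|_]; last exact: i3.
    by move: hx; rewrite e; lia.
  - by lia.
  - by fx.
have f6 k x : (k < stride)%N -> k \notin [:: 10; 13]%N -> iv (run p6 s5) k x = iv s5 k x.
  by move=> kA kn; apply: frame_iv => //; apply: contra kn; inx.
have g6 k x : (k < stride)%N -> k != 21%N -> rv (run p6 s5) k x = rv s5 k x.
  by move=> kA kn; apply: frame_rv => //; rewrite /= inE.
set s6 := run p6 s5 in f6 g6 *; move=> [j1 j2 j3 j4 j5].
have h69 : iv s6 9 0 = h by rewrite f6.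
(* The total of all signs is saved first, because the next loop recentres the partial sums in place
   and overwrites cell d too. *)
rewrite run_seq run_setr; move E7: (tick _ _) => s7.
have h70 : rv s7 0 0 = prefix w d by rewrite -E7 /om; sx; rewrite h69 j2.
have h79 : iv s7 9 0 = h by rewrite -E7; sx.
set p8 := For _ _ _.
pose I2 i t := [/\ coins t = coins s7,
  forall u : nat, (u <= d)%N ->
    rv t 21 (h * D + u) = if (u < i)%N then bridge w u else prefix w u,
  forall x, ~~ (h * D <= x <= h * D + d)%N -> rv t 21 x = rv s5 21 x,
  (clock t <= clock s7 + 10 + 40 * i)%N & fits Y t].
have : I2 d.+1 (run p8 s7).
  apply: (@for_rule_eq _ _ _ _ I2) => //.
    rewrite /I2; sx; split => //.
    - by move=> u ud; rewrite -E7; sx; exact: j2.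
    - by move=> x hx; rewrite -E7; sx; exact: j3.
    - by lia.
    - by rewrite -E7; fx.
  move=> i t id fi fr [i1 i2 i3 i4 i5].
  have t9 : iv t 9 0 = h by rewrite fi.
  have t0 : rv t 0 0 = prefix w d by rewrite fr.
  rewrite !runE /I2 /om; sx; rewrite !t9 t0.
  have hix : (h * D + i < Y)%N by lia.
  split => //.
  - move=> u ud; sx; rewrite eqn_add2l; case: eqP => [->|/eqP ne].
      by rewrite i2// ltnn ltnSn /bridge -ltnS id.
    have -> : (u < i.+1)%N = (u < i)%N by lia.
    exact: i2.
  - move=> x hx; sx; case: eqP => [e|_]; last exact: i3.
    by move: hx; rewrite e; lia.
  - by lia.
  - by fx.
have f8 k x : (k < stride)%N -> k != 10%N -> iv (run p8 s7) k x = iv s7 k x.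
  by move=> kA kn; apply: frame_iv => //; rewrite /= !inE.
have g8 k x : (k < stride)%N -> k != 21%N -> rv (run p8 s7) k x = rv s7 k x.
  by move=> kA kn; apply: frame_rv => //; rewrite /= inE.
set s8 := run p8 s7 in f8 g8 *; move=> [k1 k2 k3 k4 k5].
have cc : coins s5 = (coins s + nb + q.+1)%N.
  by rewrite -E5 -E4; sx; rewrite c2 -E2; sx; rewrite a2.
split.
- by rewrite f8// -E7; sx; rewrite f6// -E5 -E4; sx; rewrite f3// -E2; sx; rewrite eqxx.
- rewrite g8// -E7; sx; rewrite g6// -E5 -E4; sx; rewrite h39 eqxx c1 -E2; sx.
  by rewrite a2.
- by move=> t td; rewrite k2// ltnS td /w cc.
- split=> x hx.
  + rewrite f8// -E7; sx; rewrite f6// -E5 -E4; sx; rewrite f3// -E2; sx.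
    by rewrite (negPf hx) f1.
  + rewrite g8// -E7; sx; rewrite g6// -E5 -E4; sx; rewrite h39 (negPf hx) g3// -E2; sx.
    exact: g1.
  + rewrite k3// -E5; sx; rewrite ?ix5 ?h49 ?addn0; case: eqP => [e|_]; first by move: hx; rewrite e; lia.
    by rewrite -E4; sx; rewrite g3// -E2; sx; exact: g1.
- split=> //.
  + by rewrite k1 -E7; sx; rewrite j1 cc /hash_coins; lia.
  + have q2 : (clock s2 <= clock s1 + 20)%N by rewrite -E2; sx; lia.
    have q4 : (clock s4 <= clock s3 + 20)%N by rewrite -E4; sx; lia.
    have q5 : (clock s5 <= clock s4 + 30)%N by rewrite -E5; sx; lia.
    have q7 : (clock s7 <= clock s6 + 30)%N by rewrite -E7; sx; lia.
    by move: a3 c3; rewrite /=; lia.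
Qed.

End Generation.

Section LoadedParameters.
Variables (R : realType) (d q : nat).
Variables (env : seq (pgon R)) (tape : nat -> bool) (Y : nat).
Hypothesis Y0 : (0 < Y)%N.
Local Notation run := (exec env tape).
Local Notation iev := (ieval env).
Implicit Types s : state R.
Local Notation D := (2 * d + 1)%N.
Local Notation bridge := (bridge R d).

(** The range of t extends to 2 d, where [bridge] is 0 by definition and the cells have never been
    written. *)
Definition loaded (nb H : nat) s : Prop := forall h, (h < H)%N ->
  let w := tdrop (h * hash_coins d q nb) tape in
  [/\ iv s 22 h = hmul nb w,
      rv s 20 h = (binv q.+1 (tdrop nb w))%:R / (2 ^ q)%:R &
      forall t : nat, (t <= 2 * d)%N ->
        rv s 21 (h * D + t) = bridge (tdrop q.+1 (tdrop nb w)) t].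

Lemma c_gen_spec nb H s : fits Y s -> iv s 4 0 = nb -> (iv s 2 0 * iv s 3 0)%N = H ->
  coins s = 0%N -> (forall x, rv s 21 x = 0) -> (H * D <= Y)%N ->
  let s' := run (c_gen R d q) s in
  [/\ loaded nb H s', coins s' = (H * hash_coins d q nb)%N,
    (clock s' <= clock s + 20 + H * (210 + 20 * nb + 20 * q.+1 + 100 * d.+1))%N & fits Y s'].
Proof.
move=> fs h4 hH c0 z0 HY; rewrite /c_gen.
(* That all later cells are still 0 provides the upper half of the next block. *)
pose I i t := [/\ loaded nb i t /\ (forall x, (i * D <= x)%N -> rv t 21 x = 0),
  coins t = (i * hash_coins d q nb)%N,
  (clock t <= clock s + 20 + i * (210 + 20 * nb + 20 * q.+1 + 100 * d.+1))%N & fits Y t].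
set p := For _ _ _; suff : I H (run p s) by move=> [[? _] ? ? ?].
apply: (@for_rule_eq _ _ _ _ I) => //.
  by rewrite /I; sx; split => //; [split => // x _; sx|lia].
move=> i t iH fi _ [[i1 i1'] i2 i3 i4].
move E: (tick _ _) => t1.
have t9 : iv t1 9 0 = i by rewrite -E; sx.
have t4 : iv t1 4 0 = nb by rewrite -E; sx; rewrite fi.
have f1 : fits Y t1 by rewrite -E; fx.
have iY : (i * D + d < Y)%N.
  apply: leq_trans HY; apply: (@leq_trans (i.+1 * D)); first by rewrite mulSn; lia.
  by rewrite leq_mul2r iH orbT.
have iY2 : (i < Y)%N.
  by apply: leq_ltn_trans iY; rewrite (leq_trans _ (leq_addr _ _))// leq_pmulr// addn1.
have := @c_hashfun_spec R d q env tape Y Y0 i nb t1 f1 t9 t4 iY iY2.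
move: (run _ t1) => t2 [b1 b2 b3 [b4 b5 b6] [b7 b8 b9]].
have ct : coins t1 = (i * hash_coins d q nb)%N by rewrite -E; sx.
rewrite ct in b1 b2 b3 b7.
have iv22 x : iv t1 22 x = iv t 22 x by rewrite -E; sx.
have rv20 k x : rv t1 k x = rv t k x by rewrite -E; sx.
split => //.
- split=> [h|x xi]; last first.
    rewrite b6 ?rv20 ?i1'//; first by apply: leq_trans xi; rewrite mulSn; lia.
    by move: xi; rewrite mulSn; lia.
  rewrite ltnS leq_eqVlt => /predU1P[->|hi] /=.
    rewrite b1 b2 !tdropD; split => // t' t'd.
    have [t'd1|t'd1] := leqP t' d; first exact: b3.
    rewrite b6 ?rv20 ?i1' ?leq_addr//; last by lia.
    by rewrite /bridge leqNgt t'd1.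
  have [c1 c2 c3] := i1 h hi.
  have hne : h != i by rewrite neq_ltn hi.
  rewrite b4// iv22 c1 b5// rv20 c2; split => // t' t'd.
  rewrite b6 ?rv20 ?c3//.
  have : (h.+1 * D <= i * D)%N by rewrite leq_mul2r hi orbT.
  by rewrite mulSn; lia.
- by rewrite b7 mulSn addnC.
- have : clock t1 = (clock t + 1)%N by rewrite -E; sx.
  by move: b8; rewrite mulSn; lia.
Qed.

End LoadedParameters.

(** * Grid positions and turning angles of a polygon *)

Section Preparation.
Variables (R : realType) (m d : nat).
Variables (env : seq (pgon R)) (tape : nat -> bool) (Y : nat).
Hypothesis Y0 : (0 < Y)%N.
Local Notation run := (exec env tape).
Local Notation iev := (ieval env).
Local Notation rev := (reval env).
Implicit Types s : state R.

(** The least g < d whose grid point is not before vertex k + 1, or d if there is none. The index k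
    belongs to the vertex between the edges k and k + 1. *)
Definition gridpos (P : pgon R) (k : nat) : nat :=
  \sum_(g < d) (g%:R / d%:R < vertex_pos P k.+1)%R.

Definition angle (P : pgon R) (k : nat) : R := signed_angle (edge P k) (edge P k.+1).

Definition prepared (i : nat) (P : pgon R) s : Prop := forall k, (k < nverts P)%N ->
  iv s 23 (i * m + k) = gridpos P k /\ rv s 22 (i * m + k) = angle P k.

Section OneObject.
Variables (i : nat).
Let P := nth (pgon0 R) env i.
Hypothesis Pm : (nverts P <= m)%N.
Hypothesis Pcross : forall k, (k < nverts P)%N -> cross (edge P k) (edge P k.+1) != 0.

Lemma rev_x s e : iv s 5 0 = i -> rev s (e_x R e) = (edge P (iev s e)).1.
Proof. by move=> h; rewrite /e_x; sx; rewrite h addn1. Qed.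

Lemma rev_y s e : iv s 5 0 = i -> rev s (e_y R e) = (edge P (iev s e)).2.
Proof. by move=> h; rewrite /e_y; sx; rewrite h addn1. Qed.

Lemma rev_len s e : iv s 5 0 = i -> rev s (e_len R e) = len (edge P (iev s e)).
Proof.
by move=> h; rewrite /e_len rev_sqrt rev_add !rev_mul rev_x// rev_y.
Qed.

Lemma rev_cross s e f : iv s 5 0 = i ->
  rev s (e_cross R e f) = cross (edge P (iev s e)) (edge P (iev s f)).
Proof. by move=> h; rewrite /e_cross rev_sub !rev_mul !rev_x// !rev_y. Qed.

Lemma rev_ang s e f : iv s 5 0 = i ->
  rev s (e_ang R e f) = acos (dot (edge P (iev s e)) (edge P (iev s f)) /
    (len (edge P (iev s e)) * len (edge P (iev s f)))).
Proof.
move=> h; rewrite /e_ang rev_acos rev_div rev_add !rev_mul !rev_x// !rev_y//.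
by rewrite !rev_len.
Qed.

Lemma c_prep_spec s : fits Y s -> iv s 5 0 = i -> (i * m + m <= Y)%N ->
  let s' := run (c_prep R m d) s in
  [/\ prepared i P s',
    forall x, ~~ (i * m <= x < i * m + m)%N -> iv s' 23 x = iv s 23 x,
    forall x, ~~ (i * m <= x < i * m + m)%N -> rv s' 22 x = rv s 22 x,
    (clock s' <= clock s + 400 + m * (1000 + d * 50))%N & fits Y s'].
Proof.
move=> fs h5 iY; rewrite /c_prep run_seq run_setr; move E1: (tick _ _) => s1.
have a1 : rv s1 2 0 = 0 by rewrite -E1; sx.
have a2 : iv s1 5 0 = i by rewrite -E1; sx.
have a3 : fits Y s1 by rewrite -E1; fx.
have a4 : (clock s1 <= clock s + 10)%N by rewrite -E1; sx; lia.
rewrite run_seq; set p2 := For _ (IVerts _) (SetR (INat 2) _).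
pose I1 j t := [/\ rv t 2 0 = \sum_(k < j) len (edge P k),
  (clock t <= clock s + 20 + j * 100)%N & fits Y t].
have : I1 (nverts P) (run p2 s1).
  apply: (@for_rule_eq _ _ _ _ I1) => //.
  - by sx; rewrite a2.
  - by rewrite /I1; sx; rewrite big_ord0; split => //; lia.
  move=> j t jn fi fr [i1 i2 i3].
  have t5 : iv t 5 0 = i by rewrite fi.
  rewrite run_setr rev_add rev_len; last by sx.
  rewrite /I1; sx; rewrite i1 big_ord_recr/=; split => //; first lia.
  by fx.
have f2 k x : (k < stride)%N -> k != 10%N -> iv (run p2 s1) k x = iv s1 k x.
  by move=> kA kn; apply: frame_iv => //; rewrite /= !inE.
have g2 k x : (k < stride)%N -> k != 2%N -> rv (run p2 s1) k x = rv s1 k x.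
  by move=> kA kn; apply: frame_rv => //; rewrite /= inE.
move: f2 g2; move: (run p2 s1) => s2 f2 g2 [b1 b2 b3].
rewrite run_seq run_setr; move E3: (tick _ _) => s3.
have h52 : iv s2 5 0 = i by rewrite f2.
have h53 : iv s3 5 0 = i by rewrite -E3; sx.
have per : rv s3 2 0 = perimeter P by rewrite -E3; sx.
have run0 : rv s3 3 0 = 0 - base P * len (edge P 0).
  by rewrite -E3 rev_sub rev_mul rev_len//; sx; rewrite h52.
have a5 : fits Y s3 by rewrite -E3; fx.
have a6 : (clock s3 <= clock s + 200 + nverts P * 100)%N by rewrite -E3; sx; lia.
set p4 := For _ _ _.
pose I2 j t := [/\ forall k, (k < j)%N ->
    iv t 23 (i * m + k) = gridpos P k /\ rv t 22 (i * m + k) = angle P k,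
  rv t 3 0 = \sum_(k < j) len (edge P k) - base P * len (edge P 0),
  forall x, ~~ (i * m <= x < i * m + m)%N -> iv t 23 x = iv s 23 x /\ rv t 22 x = rv s 22 x,
  (clock t <= clock s3 + 20 + j * (800 + d * 50))%N & fits Y t].
have : I2 (nverts P) (run p4 s3).
  apply: (@for_rule_eq _ _ _ _ I2) => //.
  - by sx; rewrite h53.
  - rewrite /I2; sx; split => //.
    + by rewrite run0 big_ord0.
    + move=> x hx; split; sx; rewrite -E3; sx.
        by rewrite f2// -E1; sx.
      by rewrite g2// -E1; sx.
    + lia.
  move=> j t jn fi fr [i1 i2 i3 i4 i5].
  have t5 : iv t 5 0 = i by rewrite fi.
  have t2 : rv t 2 0 = perimeter P by rewrite fr.
  have jY : (i * m + j < Y)%N by apply: leq_trans iY; rewrite ltn_add2l; exact: leq_trans Pm.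
  rewrite run_seq run_setr rev_add rev_len; last by sx.
  move E5: (tick _ _) => s5.
  have u5 : iv s5 5 0 = i by rewrite -E5; sx.
  have u10 : iv s5 10 0 = j by rewrite -E5; sx.
  have u3 : rv s5 3 0 = \sum_(k < j.+1) len (edge P k) - base P * len (edge P 0).
    by rewrite -E5; sx; rewrite i2 big_ord_recr/=; ring.
  have u2 : rv s5 2 0 = perimeter P by rewrite -E5; sx.
  have uf : fits Y s5 by rewrite -E5; fx.
  have uc : (clock s5 <= clock t + 100)%N by rewrite -E5; sx; lia.
  have ui x : iv s5 23 x = iv t 23 x by rewrite -E5; sx.
  have ur x : rv s5 22 x = rv t 22 x by rewrite -E5; sx.
  rewrite run_seq; move E6: (run (IfR _ _ _ _) s5) => s6.
  have [v1 v2 v3 v4 [v5 v6 v7]] : [/\ forall k x, iv s6 k x = iv s5 k x,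
      rv s6 22 (i * m + j) = angle P j,
      forall x, x != (i * m + j)%N -> rv s6 22 x = rv s5 22 x,
      rv s6 3 0 = rv s5 3 0 & [/\ rv s6 2 0 = rv s5 2 0, fits Y s6 &
      (clock s6 <= clock s5 + 500)%N]].
    rewrite -E6 run_ifr rev_const rev_cross//.
    (* The cross product is nonzero, so the test [0 <= cross] decides its sign. *)
    have cr := Pcross jn.
    have ix c : iev (tick c s5) (pos_ix m) = (i * m + j)%N.
      by rewrite /pos_ix; sx; rewrite u5 u10.
    have jx : iev s5 (V 10) = j by rewrite ievE.
    have jx1 : iev s5 (IAdd (V 10) (INat 1)) = j.+1 by rewrite !ievE u10 addn1.
    rewrite jx jx1; case: ifP => c0; rewrite run_setra ix.
    - rewrite rev_ang; last by sx.
      rewrite (_ : iev _ (V 10) = j); last by sx.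
      rewrite (_ : iev _ (IAdd (V 10) (INat 1)) = j.+1); last by sx; rewrite u10 addn1.
      split; [by move=> k x; sx| | | |].
      + sx; rewrite eqxx /angle /signed_angle gtr0_sg ?mul1r//.
        by rewrite lt_neqAle eq_sym cr.
      + by move=> x xj; sx; rewrite (negPf xj).
      + by sx.
      + by split; [sx|fx|sx; clear; lia].
    - rewrite rev_sub rev_const rev_ang; last by sx.
      rewrite (_ : iev _ (V 10) = j); last by sx.
      rewrite (_ : iev _ (IAdd (V 10) (INat 1)) = j.+1); last by sx; rewrite u10 addn1.
      split; [by move=> k x; sx| | | |].
      + sx; rewrite eqxx /angle /signed_angle ltr0_sg ?mulN1r ?sub0r//.
        by rewrite ltNge c0.
      + by move=> x xj; sx; rewrite (negPf xj).
      + by sx.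
      + by split; [sx|fx|sx; clear; lia].
  rewrite run_seq run_seti run_seq run_setr; move E7: (tick _ (wr _ _ _ _)) => s7.
  have w15 : iv s7 15 0 = 0%N by rewrite -E7; sx.
  have w4 : rv s7 4 0 = vertex_pos P j.+1.
    by rewrite -E7; sx; rewrite v4 u3 v5 u2.
  have w5 : iv s7 5 0 = i by rewrite -E7; sx; rewrite v1.
  have w10 : iv s7 10 0 = j by rewrite -E7; sx; rewrite v1.
  have wi7 x : iv s7 23 x = iv t 23 x by rewrite -E7; sx; rewrite v1.
  have wr7 x : rv s7 22 x = rv s6 22 x by rewrite -E7; sx.
  have w3 : rv s7 3 0 = rv s6 3 0 by rewrite -E7; sx.
  have wf : fits Y s7 by rewrite -E7; fx.
  have wc : (clock s7 <= clock s6 + 20)%N by rewrite -E7; sx; clear; lia.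
  rewrite run_seq; set p8 := For _ _ _.
  pose I3 (g : nat) (t : state R) := [/\ iv t 15 0 = (\sum_(g' < g) (g'%:R / d%:R < vertex_pos P j.+1)%R)%N,
    (clock t <= clock s7 + 10 + g * 30)%N & fits Y t].
  have : I3 d (run p8 s7).
    apply: (@for_rule_eq _ _ _ _ I3) => //.
      by rewrite /I3; sx; rewrite big_ord0; split => //; clear; lia.
    move=> g t' gd fi' fr' [k1 k2 k3].
    have x4 : rv t' 4 0 = vertex_pos P j.+1 by rewrite fr'.
    rewrite !runE; sx; rewrite x4 /I3 big_ord_recr/=.
    case: leP => hl; sx.
      by rewrite addn0; split => //; [move: k2; clear; lia|fx].
    by rewrite k1; split => //; [move: k2; clear; lia|fx].
  have f8 k x : (k < stride)%N -> k \notin [:: 12; 15]%N -> iv (run p8 s7) k x = iv s7 k x.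
    by move=> kA kn; apply: frame_iv => //; apply: contra kn; inx.
  have g8 k x : (k < stride)%N -> rv (run p8 s7) k x = rv s7 k x.
    by move=> kA; apply: frame_rv.
  move: f8 g8; move: (run p8 s7) => s8 f8 g8 [x1 x2 x3].
  rewrite run_setia.
  have ix8 : iev s8 (pos_ix m) = (i * m + j)%N.
    by rewrite /pos_ix; sx; rewrite !f8// w5 w10.
  rewrite ix8 /I2; split.
  - move=> k; rewrite ltnS leq_eqVlt => /predU1P[->|kj]; sx.
      by rewrite eqxx x1 g8// wr7 v2.
    have kne : (i * m + k == i * m + j)%N = false by rewrite eqn_add2l ltn_eqF.
    have [y1 y2] := i1 k kj.
    by rewrite kne f8// wi7 y1 g8// wr7 v3 ?kne// ur y2.
  - by sx; rewrite g8// w3 v4 u3.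
  - move=> x hx; have [y1 y2] := i3 x hx; sx.
    have xne : (x == i * m + j)%N = false.
      apply/negP => /eqP xe; move: hx; rewrite xe leq_addr ltn_add2l.
      by rewrite (leq_trans jn Pm).
    by rewrite xne f8// wi7 y1 g8// wr7 v3 ?xne// ur y2.
  - by sx; move: x2 wc v7 uc i4; clear; lia.
  - by fx.
have f4 k x : (k < stride)%N -> k \notin [:: 10; 15; 12; 23]%N -> iv (run p4 s3) k x = iv s3 k x.
  by move=> kA kn; apply: frame_iv => //; apply: contra kn; inx.
move: (run p4 s3) => s4 [z1 z2 z3 z4 z5]; split => //.
- by move=> x /z3[].
- by move=> x /z3[].
- have : (nverts P * (800 + d * 50) <= m * (800 + d * 50))%N by rewrite leq_mul2r Pm orbT.
  have : (nverts P * 100 <= m * 100)%N by rewrite leq_mul2r Pm orbT.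
  by lia.
Qed.

End OneObject.
End Preparation.

(** * Inner products with random signs from their partial sums *)

Section Projection.
Variables (R : realType) (d : nat).
Hypothesis d0 : (0 < d)%N.
Local Notation bridge := (bridge R d).

(** A step function is a combination of indicators of final segments, and such an indicator pairs
    with the centred signs to a suffix sum. Hence one term for the wrap by 2 pi and three per
    vertex. *)
Definition hval (P : pgon R) (s : nat) (w : nat -> bool) : R :=
  2 * pi * bridge w (d - s) + \sum_(k < nverts P) angle P k *
    (bridge w (gridpos d P k - s) - bridge w (d - s) + bridge w (gridpos d P k + d - s)).

Lemma gridpos_le (P : pgon R) k : (gridpos d P k <= d)%N.
Proof.
by rewrite -[leqRHS]card_ord -sum1_card leq_sum// => g _; case: (_ < _).
Qed.

Lemma gridpos_ltP (P : pgon R) k (g : nat) : (g < d)%N ->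
  (gridpos d P k <= g)%N = (vertex_pos P k.+1 <= g%:R / d%:R).
Proof.
move=> gd; rewrite leNgt; set x := vertex_pos P k.+1.
have mono (a b : nat) : (a <= b)%N -> b%:R / d%:R < x -> a%:R / d%:R < x.
  by move=> ab; apply: le_lt_trans; rewrite ler_wpM2r ?invr_ge0 ?ler0n// ler_nat.
rewrite /gridpos -/x -(big_mkord xpredT (fun g : nat => (g%:R / d%:R < x)%R : nat)).
case: (boolP (g%:R / d%:R < x)) => h /=.
  apply/negbTE; rewrite -ltnNge (@big_cat_nat _ _ _ g.+1 0 d)//=.
  apply: (@leq_trans (\sum_(0 <= i < g.+1) 1)%N); first by rewrite sum_nat_const_nat subn0 muln1.
  apply: leq_trans (leq_addr _ _); rewrite !big_nat; apply: leq_sum => i /andP[_ ig].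
  by rewrite (mono i g).
rewrite (@big_cat_nat _ _ _ g 0 d)//=; last exact: ltnW.
have -> : (\sum_(g <= i < d) (i%:R / d%:R < x)%R = 0)%N.
  rewrite big_nat big1// => i /andP[gi _].
  by apply/eqP; rewrite eqb0; apply: contra h; exact: mono.
rewrite addn0.
apply: (@leq_trans (\sum_(0 <= i < g) 1)%N); last by rewrite sum_nat_const_nat subn0 muln1.
by apply: leq_sum => i _; case: (_ < _).
Qed.

(** Past the wrap the indicator of d <= n cancels the first passage of each vertex, and the last
    indicator counts the second passage. *)
Lemma sample_angles (P : pgon R) (n : nat) : (n < 2 * d)%N ->
  sample P d n = heading (edge P 0) + \sum_(k < nverts P) angle P k *
    ((gridpos d P k <= n)%:R - (d <= n)%:R + (gridpos d P k + d <= n)%:R) +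
    2 * pi * (d <= n)%:R.
Proof.
move=> nd.
have E (g : nat) : (g < d)%N -> turning P (g%:R / d%:R) =
    heading (edge P 0) + \sum_(k < nverts P) angle P k * (gridpos d P k <= g)%:R.
  move=> gd; rewrite /turning; congr (_ + _).
  rewrite big_add1 big_mkcond big_mkord/=; apply: eq_bigr => k _.
  by rewrite -gridpos_ltP// /angle; case: (_ <= _)%N; rewrite ?mulr1 ?mulr0.
rewrite /sample; case: ltnP => h.
  rewrite E// mulr0 addr0; congr (_ + _); apply: eq_bigr => k _.
  have -> : (gridpos d P k + d <= n)%N = false by lia.
  by rewrite subr0 addr0.
rewrite E; last by lia.
rewrite mulr1; congr (_ + _ + _); apply: eq_bigr => k _; congr (_ * _).
have -> : (gridpos d P k <= n)%N by apply: leq_trans (gridpos_le P k) h.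
by rewrite subrr add0r leq_subRL// addnC.
Qed.

(** The centred signs have total 0, so the suffix sum is minus the prefix sum, which is what
    [bridge] stores. *)
Lemma bridge_suffix (w : nat -> bool) (t : nat) :
  \sum_(j < d) ((t <= j)%:R * (sgn R (w j) - prefix R w d / d%:R)) = bridge w t.
Proof.
have dR : d%:R != 0 :> R by rewrite pnatr_eq0 -lt0n.
rewrite /bridge; set mu := prefix R w d / d%:R.
have [td|td] := leqP t d; last first.
  by rewrite big1// => j _; rewrite leqNgt (ltn_trans (ltn_ord j) td) mul0r.
have -> : \sum_(j < d) ((t <= j)%:R * (sgn R (w j) - mu)) =
    \sum_(0 <= j < d) ((t <= j)%:R * (sgn R (w j) - mu)) by rewrite big_mkord.
rewrite (@big_cat_nat _ _ _ t)//= [X in X + _]big_nat big1 ?add0r; last first.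
  by move=> j /andP[_ jt]; rewrite leqNgt jt mul0r.
rewrite (eq_big_nat _ _ (F2 := fun j => sgn R (w j) - mu)); last first.
  by move=> j /andP[-> _]; rewrite mul1r.
have H (k : nat) : prefix R w k = \sum_(0 <= j < k) sgn R (w j) by rewrite big_mkord.
rewrite sumrB sumr_const_nat -[_ *+ (d - t)]mulr_natr natrB// /mu.
have := H d; rewrite (@big_cat_nat _ _ _ t)//= -H => /esym/(canRL (addKr _)) ->.
by field.
Qed.

(** Centring is a symmetric projection and moves from the samples to the signs; the heading then
    contributes 0. The truncated subtraction t - s is right for t <= s, as the indicator is then
    constant and [bridge w 0 = 0]. *)
Lemma hval_proj (P : pgon R) (s : nat) (w : nat -> bool) : (s <= d)%N ->
  hval P s w = proj d (centre d (shifted P d s)) w.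
Proof.
move=> sd; have dR : d%:R != 0 :> R by rewrite pnatr_eq0 -lt0n.
pose G j := sgn R (w j) - prefix R w d / d%:R.
have G0 : \sum_(j < d) G j = 0.
  rewrite sumrB sumr_const card_ord -[X in _ - X]mulr_natr divfK//.
  exact: subrr.
have -> : proj d (centre d (shifted P d s)) w = \sum_(j < d) shifted P d s j * G j.
  pose x j := shifted P d s j.
  transitivity (\sum_(j < d) x j * sgn R (w j) - mean d x * prefix R w d).
    by rewrite /prefix mulr_sumr -sumrB; apply: eq_bigr => j _; rewrite /centre mulrBl.
  transitivity (\sum_(j < d) x j * sgn R (w j) -
      (\sum_(j < d) x j) * (prefix R w d / d%:R)); last first.
    rewrite [X in _ - X]mulr_suml -sumrB; apply: eq_bigr => j _.
    by rewrite /G /x; ring.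
  by congr (_ - _); rewrite /mean; field.
have suf t : bridge w (t - s) = \sum_(j < d) (t <= j + s)%:R * G j.
  by rewrite -bridge_suffix; apply: eq_bigr => j _; rewrite leq_subLR addnC.
rewrite /hval !suf.
have -> : \sum_(j < d) shifted P d s j * G j = \sum_(j < d) ((heading (edge P 0) * G j +
    \sum_(k < nverts P) angle P k * (((gridpos d P k <= j + s)%:R - (d <= j + s)%:R +
      (gridpos d P k + d <= j + s)%:R) * G j)) + 2 * pi * ((d <= j + s)%:R * G j)).
  apply: eq_bigr => j _; rewrite /shifted sample_angles; last by have := ltn_ord j; lia.
  rewrite !mulrDl mulr_suml mulrA; congr (_ + _ + _); apply: eq_bigr => k _.
  by rewrite mulrA.
rewrite !big_split/= -!mulr_sumr G0 mulr0 add0r addrC; congr (_ + _).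
rewrite exchange_big/=; apply: eq_bigr => k _; rewrite -mulr_sumr; congr (_ * _).
rewrite !suf -sumrB -big_split/=; apply: eq_bigr => j _.
by rewrite mulrDl mulrBl.
Qed.

End Projection.

(** * Computation of a key *)

Section HashKey.
Variables (R : realType) (m d q B nb : nat) (sc : R).
Variables (env : seq (pgon R)) (tape : nat -> bool) (Y : nat).
Hypotheses (Y0 : (0 < Y)%N) (d0 : (0 < d)%N).
Local Notation run := (exec env tape).
Local Notation iev := (ieval env).
Local Notation rev := (reval env).
Local Notation D := (2 * d + 1)%N.
Local Notation BL := (hash_coins d q nb).
Local Notation M := ((2 ^ B)%:R : R).
Implicit Types s : state R.

Definition vec (P : pgon R) (sh j : nat) : R := sc * centre d (shifted P d sh) j.

Lemma proj_vec P sh w : proj d (vec P sh) w = sc * proj d (centre d (shifted P d sh)) w.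
Proof. by rewrite /proj mulr_sumr; apply: eq_bigr => j _; rewrite mulrA. Qed.

Lemma parity_reduce (y x : R) (z : nat) : 0 <= x < 2 -> y = x + (2 * z)%:R ->
  (1 <= x) = odd (Num.truncn y).
Proof.
move=> /andP[x0 x2] ->.
have -> : Num.truncn (x + (2 * z)%:R) = ((1 <= x)%R + 2 * z)%N.
  apply: truncn_def; rewrite -natr1 !natrD; case: (leP 1 x) => h /=; apply/andP; split; lra.
by rewrite oddD mul2n odd_double addbF; case: (1 <= x).
Qed.

Section Bit.
Variables (h i sh : nat).
Let P := nth (pgon0 R) env i.
Hypotheses (Pm : (nverts P <= m)%N) (shd : (sh <= d)%N).
Hypothesis range : \sum_(j < d) `|vec P sh j| + 2 <= M.

Lemma c_bit_spec H s : fits Y s -> loaded d q tape nb H s -> (h < H)%N ->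
  prepared m d i P s -> iv s 9 0 = h -> iv s 5 0 = i -> iv s 7 0 = sh ->
  let s' := run (c_bit m d B sc) s in
  [/\ (1 <= rv s' 0 0) = hvbit d q nb M (vec P sh) (tdrop (h * BL) tape),
      (clock s' <= clock s + 300 + m * 300 + B * 60)%N & fits Y s'].
Proof.
move=> fs ld hH pr h9 h5 h7; rewrite /c_bit run_seq run_setr; move E1: (tick _ _) => s1.
pose w := tdrop (h * BL) tape; pose w2 := tdrop q.+1 (tdrop nb w).
have [l1 l2 l3] := ld h hH.
have a0 : rv s1 0 0 = 2 * pi * bridge R d w2 (d - sh).
  rewrite -E1 /e_om /om; sx; rewrite h9 h7 l3//.
  by rewrite (leq_trans (leq_subr _ _))// leq_pmull.
have a1 k x : iv s1 k x = iv s k x by rewrite -E1; sx.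
have a2 k x : (k < stride)%N -> k != 0%N -> rv s1 k x = rv s k x.
  by move=> kA kn; rewrite -E1; sx; rewrite (negPf kn).
have a3 : (clock s1 <= clock s + 50)%N by rewrite -E1; sx; clear; lia.
have a4 : fits Y s1 by rewrite -E1; fx.
rewrite run_seq; set p2 := For _ (IVerts _) _.
pose I1 (k : nat) (t : state R) := [/\ rv t 0 0 = 2 * pi * bridge R d w2 (d - sh) +
    \sum_(k' < k) angle P k' * (bridge R d w2 (gridpos d P k' - sh) -
      bridge R d w2 (d - sh) + bridge R d w2 (gridpos d P k' + d - sh)),
  (clock t <= clock s1 + 10 + k * 300)%N & fits Y t].
have : I1 (nverts P) (run p2 s1).
  apply: (@for_rule_eq _ _ _ _ I1) => //.
  - by sx; rewrite a1 h5.
  - rewrite /I1; sx; rewrite big_ord0 addr0; split => //; by clear; lia.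
  move=> k t kn fi fr [i1 i2 i3].
  have t9 : iv t 9 0 = h by rewrite fi// a1.
  have t5 : iv t 5 0 = i by rewrite fi// a1.
  have t7 : iv t 7 0 = sh by rewrite fi// a1.
  have [p1 p3] := pr k kn.
  have gk := gridpos_le d P k.
  have b1 (u : nat) : (u <= 2 * d)%N -> rv t 21 (h * D + u) = bridge R d w2 u.
    by move=> ud; rewrite fr// a2// l3.
  rewrite run_setr /e_om /om /e_pos /pos_ix /I1; sx.
  rewrite t9 t5 t7 (fi 23%N)// a1 p1 (fr 22%N)// a2// p3 i1 !b1; last 3 first.
  - by move: gk; clear; lia.
  - by move: gk; clear; lia.
  - by move: gk; clear; lia.
  rewrite big_ord_recr/= addrA; split => //; first by move: i2; clear; lia.
  by fx.
have f2 k x : (k < stride)%N -> k != 10%N -> iv (run p2 s1) k x = iv s1 k x.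
  by move=> kA kn; apply: frame_iv => //; rewrite /= !inE.
have g2 k x : (k < stride)%N -> k != 0%N -> rv (run p2 s1) k x = rv s1 k x.
  by move=> kA kn; apply: frame_rv => //; rewrite /= inE.
move: f2 g2; move: (run p2 s1) => s2 f2 g2 [b1 b2 b3].
pose y : R := proj d (vec P sh) w2 + M + (binv q.+1 (tdrop nb w))%:R / (2 ^ q)%:R.
(* The summand 2 in [range] is room for the offset, which is less than 2. *)
have yB : 0 <= y < (2 ^ B.+1)%:R.
  have := le_trans (normr_proj d (vec P sh) w2) (lexx _).
  have off : 0 <= (binv q.+1 (tdrop nb w))%:R / (2 ^ q)%:R :> R /\
      (binv q.+1 (tdrop nb w))%:R / (2 ^ q)%:R < 2 :> R.
    split; first exact: divr_ge0.
    by rewrite ltr_pdivrMr ?ltr0n ?expn_gt0// -natrM ltr_nat -expnS binv_lt.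
  rewrite expnS natrM /y ler_norml; move: range off; clear.
  by move=> h1 [h2 h3] /andP[h4 h5]; apply/andP; split; lra.
rewrite run_seq run_setr run_seq run_setr; move E3: (tick _ (wr 1 _ _ _)) => s3.
have c0 : rv s3 0 0 = y.
  rewrite -E3; sx; rewrite b1 -[_ + \sum_(_ < _) _]/(hval d P sh w2) hval_proj// -proj_vec.
  by rewrite f2// a1 h9 g2// a2// l2.
have c1 : rv s3 1 0 = M by rewrite -E3; sx.
have c3 : (clock s3 <= clock s2 + 40)%N by rewrite -E3; sx; clear; lia.
have c4 : fits Y s3 by rewrite -E3; fx.
set p4 := For _ _ _.
(* Only even numbers have been subtracted, and the remainder is below twice the next power to be
   tried. *)
pose I2 (k : nat) (t : state R) := [/\ exists2 z : nat, y = rv t 0 0 + (2 * z)%:R &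
    0 <= rv t 0 0 < (2 ^ (B.+1 - k))%:R, rv t 1 0 = 2 ^+ (B - k),
  (clock t <= clock s3 + 10 + k * 60)%N & fits Y t].
have : I2 B (run p4 s3).
  apply: (@for_rule_eq _ _ _ _ I2) => //.
    rewrite /I2; sx; rewrite !subn0 c0 c1; split => //.
    - by exists 0%N; rewrite ?muln0 ?addr0.
    - by rewrite natrX.
    - by clear; lia.
  move=> k t kB fi fr [[z z1 z2] i1 i2 i3].
  have kE : (B - k = (B - k.+1).+1)%N by rewrite subnSK.
  have kE2 : (B.+1 - k = (B - k.+1).+2)%N by rewrite -kE subSn// ltnW.
  have kE3 : (B.+1 - k.+1 = (B - k.+1).+1)%N by rewrite subSS kE.
  rewrite !runE; sx; rewrite i1 kE; rewrite kE2 in z2.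
  case: leP => hp; sx; rewrite /I2; sx; rewrite ?i1 kE3.
  - split; last 1 first.
    + by fx.
    + exists (z + 2 ^ (B - k.+1))%N.
        by rewrite z1 mulnDr natrD -expnS natrX ?kE; ring.
      rewrite subr_ge0 hp/= ?kE; move: z2 => /andP[_]; rewrite expnS natrM natrX; lra.
    + by rewrite ?kE exprS; field.
    + by move: i2; clear; lia.
  - split; last 1 first.
    + by fx.
    + exists z => //; rewrite natrX hp andbT; by case/andP: z2.
    + by rewrite ?kE exprS; field.
    + by move: i2; clear; lia.
move: (run p4 s3) => s4 [[z z1 z2] _ e2 e3].
have z2' : 0 <= rv s4 0 0 < 2 by move: z2; rewrite subSnn expn1.
split => //; first by rewrite (parity_reduce z2' z1).
have : (nverts P * 300 <= m * 300)%N by rewrite leq_mul2r Pm orbT.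
by move: e2 c3 b2 a3; clear; lia.
Qed.

End Bit.

Lemma c_bit_frame s k x : (k < stride)%N -> k != 10%N ->
  iv (run (c_bit m d B sc) s) k x = iv s k x.
Proof. by move=> kA kn; apply: frame_iv => //; apply: contra kn; inx. Qed.

Section Key.
Variables (K L l i sh : nat).
Let P := nth (pgon0 R) env i.
Hypotheses (Pm : (nverts P <= m)%N) (shd : (sh <= d)%N).
Hypothesis range : \sum_(j < d) `|vec P sh j| + 2 <= M.
Hypothesis lL : (l < L)%N.

Lemma c_key_spec s : fits Y s -> loaded d q tape nb (L * K) s ->
  prepared m d i P s -> iv s 6 0 = l -> iv s 5 0 = i -> iv s 7 0 = sh ->
  iv s 3 0 = K -> iv s 1 0 = (2 ^ nb)%N ->
  let s' := run (c_key m d B sc) s in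
  [/\ iv s' 11 0 = key d q nb M K (vec P sh) (table_tape d q nb K l tape),
      (clock s' <= clock s + 20 + K * (400 + m * 300 + B * 60))%N & fits Y s'].
Proof.
move=> fs ld pr h6 h5 h7 h3 h1; rewrite /c_key run_seq run_seti; move E1: (tick _ _) => s1.
have a1 k x : (k < stride)%N -> k != 11%N -> iv s1 k x = iv s k x.
  by move=> kA kn; rewrite -E1; sx; rewrite (negPf kn).
have a2 k x : rv s1 k x = rv s k x by rewrite -E1; sx.
have a3 : iv s1 11 0 = 0%N by rewrite -E1; sx.
have a4 : fits Y s1 by rewrite -E1; fx.
have a5 : (clock s1 <= clock s + 10)%N by rewrite -E1; sx; clear; lia.
set p2 := For _ _ _.
pose W := table_tape d q nb K l tape.
pose I1 (k : nat) (t : state R) := [/\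
  iv t 11 0 = ((\sum_(k' < k) hmul nb (tdrop (k' * BL) W) *
     hvbit d q nb M (vec P sh) (tdrop (k' * BL) W)) %% 2 ^ nb)%N,
  (clock t <= clock s1 + 10 + k * (400 + m * 300 + B * 60))%N & fits Y t].
have : I1 K (run p2 s1).
  apply: (@for_rule_eq _ _ _ _ I1) => //.
  - by sx; rewrite a1.
  - by rewrite /I1; sx; rewrite a3 big_ord0 mod0n; split => //; clear; lia.
  move=> k t kK fi fr [i1 i2 i3].
  rewrite run_seq run_seti; move E2: (tick _ _) => s2.
  have hlK : (l * K + k < L * K)%N.
    apply: (@leq_trans (l.+1 * K)); first by rewrite mulSn addnC ltn_add2r.
    by rewrite leq_mul2r lL orbT.
  have b9 : iv s2 9 0 = (l * K + k)%N.
    by rewrite -E2; sx; rewrite !fi// !a1// h6 h3.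
  have b k' x : (k' < stride)%N -> k' \notin [:: 9; 10; 11; 14]%N -> iv s2 k' x = iv s k' x.
    move=> kA kn; rewrite -E2; sx.
    have -> : (k' == 9%N) = false by apply/negbTE; apply: contra kn => /eqP ->.
    have -> : (k' == 14%N) = false by apply/negbTE; apply: contra kn => /eqP ->.
    rewrite /= fi//; last by apply: contra kn; inx.
    by rewrite a1//; apply: contra kn => /eqP ->.
  have b11 : iv s2 11 0 = iv t 11 0 by rewrite -E2; sx.
  have br k' x : (k' < stride)%N -> k' \notin [:: 0; 1]%N -> rv s2 k' x = rv s k' x.
    move=> kA kn; rewrite -E2; sx; rewrite (fr k' x kA) ?a2//.
    by apply: contra kn; inx.
  have bf : fits Y s2 by rewrite -E2; fx.
  have bc : (clock s2 <= clock t + 30)%N by rewrite -E2; sx; clear; lia.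
  have ld2 : loaded d q tape nb (L * K) s2.
    move=> h hH; have [l1 l2 l3] := ld h hH; split; first by rewrite b.
      by rewrite br.
    by move=> u ud; rewrite br// l3.
  have pr2 : prepared m d i P s2.
    by move=> u un; have [p1 p3] := pr u un; rewrite b// br.
  have u5 : iv s2 5 0 = i by rewrite b.
  have u7 : iv s2 7 0 = sh by rewrite b.
  rewrite run_seq.
  have := c_bit_spec Pm shd range bf ld2 hlK pr2 b9 u5 u7.
  have f3 := @c_bit_frame s2.
  move: f3; move: (run (c_bit _ _ _ _) s2) => s3 f3 [e1 e2 e3].
  have tW : tdrop ((l * K + k) * BL) tape = tdrop (k * BL) W.
    by rewrite /W /table_tape tdropD mulnDl mulnA.
  rewrite tW in e1.
  have c11 : iv s3 11 0 = iv t 11 0 by rewrite f3.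
  have c9 : iv s3 9 0 = (l * K + k)%N by rewrite f3.
  have c1 : iv s3 1 0 = (2 ^ nb)%N by rewrite f3// b.
  have c22 : iv s3 22 (l * K + k) = hmul nb (tdrop (k * BL) W).
    have [l1 _ _] := ld _ hlK.
    by rewrite f3// b// l1 tW.
  have Rlt := binv_lt nb (tdrop (k * BL) W).
  have Slt : (iv t 11 0 < 2 ^ nb)%N by rewrite i1 ltn_mod expn_gt0.
  pose F (k' : nat) := (hmul nb (tdrop (k' * BL) W) *
     hvbit d q nb M (vec P sh) (tdrop (k' * BL) W))%N.
  have ES : (\sum_(k' < k.+1) F k' = \sum_(k' < k) F k' + F k)%N by rewrite big_ord_recr.
  rewrite run_ifr rev_const rev_var e1 /I1 [X in (X %% _)%N]ES /F.
  set bit := hvbit _ _ _ _ _ _.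
  have cl : (clock s3 <= clock s1 + 10 + k * (400 + m * 300 + B * 60) + 340 + m * 300 + B * 60)%N.
    by move: e2 bc i2; clear; lia.
  case: bit; last first.
    rewrite !runE; sx; rewrite muln0 addn0 c11 i1; split => //.
    by move: cl; clear; rewrite mulSn; lia.
  rewrite !runE; sx; rewrite !c9 !c11 c22 c1 muln1 -modnDml -i1.
  set r := hmul _ _ in Rlt *.
  (* The partial sum and the multiplier are both below T, so one subtraction reduces modulo T. *)
  case: leqP => hT; sx; rewrite ?c11 ?c9 ?c22 ?c1; split.
  - rewrite -[in RHS](subnK hT) modnDr modn_small//.
    by move: Rlt Slt; rewrite /r /hmul; clear; lia.
  - by move: cl; clear; rewrite mulSn; lia.
  - by fx.
  - by rewrite modn_small.
  - by move: cl; clear; rewrite mulSn; lia.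
  - by fx.
move: (run p2 s1) => s2 [e1 e2 e3]; split => //.
by move: e2 a5; clear; lia.
Qed.

End Key.

Lemma c_key_frame s k x : (k < stride)%N -> k \notin [:: 9; 10; 11; 14]%N ->
  iv (run (c_key m d B sc) s) k x = iv s k x.
Proof. by move=> kA kn; apply: frame_iv => //; apply: contra kn; inx. Qed.

End HashKey.

Section Transfer.
Variables (R : realType) (m d q nb : nat) (tape : nat -> bool).
Implicit Types s t : state R.

Lemma loaded_ext H s t : (forall x, iv t 22 x = iv s 22 x) ->
  (forall x, rv t 20 x = rv s 20 x) -> (forall x, rv t 21 x = rv s 21 x) ->
  loaded d q tape nb H s -> loaded d q tape nb H t.
Proof.
move=> h1 h2 h3 ld h hH; have [l1 l2 l3] := ld h hH; split; rewrite ?h1 ?h2//.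
by move=> u ud; rewrite h3 l3.
Qed.

Lemma prepared_ext i P s t : (forall x, iv t 23 x = iv s 23 x) ->
  (forall x, rv t 22 x = rv s 22 x) -> prepared m d i P s -> prepared m d i P t.
Proof. by move=> h1 h2 pr k kP; rewrite h1 h2; exact: pr. Qed.

(* [ptr] starts a linked list of table l through the objects xs; 0 ends a list. *)
Fixpoint is_list (n : nat) s (l : nat) (xs : seq nat) (ptr : nat) : Prop :=
  if xs is i :: xs' then ptr = i.+1 /\ is_list n s l xs' (iv s 21 (l * n + i)) else ptr = 0%N.

Lemma is_list_ext n s t l xs ptr :
  (forall i, i \in xs -> iv t 21 (l * n + i) = iv s 21 (l * n + i)) ->
  is_list n s l xs ptr -> is_list n t l xs ptr.
Proof.
elim: xs ptr => //= i xs IH ptr h [-> hl]; split => //.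
rewrite h ?inE ?eqxx//; apply: IH => // j jx; apply: h.
by rewrite inE jx orbT.
Qed.

Lemma pair_index_inj (w i j k l : nat) : (i < w)%N -> (j < w)%N ->
  (k * w + i == l * w + j)%N = (k == l) && (i == j).
Proof.
move=> iw jw; apply/eqP/andP => [h|[/eqP -> /eqP ->]//].
have w0 : (0 < w)%N by apply: leq_ltn_trans iw.
have h1 := congr1 (fun z => z %/ w)%N h; have h2 := congr1 (fun z => z %% w)%N h.
move: h1 h2; rewrite !modnMDl !modn_small// !divnMDl// !divn_small// !addn0.
by move=> -> ->.
Qed.

End Transfer.

(** * Construction of the buckets *)

Section Insertion.
Variables (R : realType) (m d q B nb K L : nat) (sc : R).
Variables (env : seq (pgon R)) (tape : nat -> bool) (Y : nat).
Hypotheses (Y0 : (0 < Y)%N) (d0 : (0 < d)%N).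
Local Notation run := (exec env tape).
Local Notation iev := (ieval env).
Local Notation n := (size env).
Local Notation T := (2 ^ nb)%N.
Local Notation M := ((2 ^ B)%:R : R).
Local Notation obj i := (nth (pgon0 R) env i).
Implicit Types s t : state R.
Hypothesis env_small : forall i, (i < n)%N -> (nverts (obj i) <= m)%N.
Hypothesis range : forall i, (i < n)%N -> \sum_(j < d) `|vec d sc (obj i) 0 j| + 2 <= M.
Hypotheses (LT : (L * T <= Y)%N) (Ln : (L * n <= Y)%N).

Definition tkey (l i : nat) : nat :=
  key d q nb M K (vec d sc (obj i) 0) (table_tape d q nb K l tape).

(** In reverse order, because insertion is at the head of the list. *)
Definition bucket (l a k : nat) : seq nat := [seq i <- rev (iota 0 k) | tkey l i == a].

(** The number of objects inserted may differ from table to table, so that one invariant serves both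
    nested loops. *)
Definition bucketed (cnt : nat -> nat) s : Prop := forall l a, (l < L)%N -> (a < T)%N ->
  is_list n s l (bucket l a (cnt l)) (iv s 20 (l * T + a)).

Lemma bucketS l a k : bucket l a k.+1 = if tkey l k == a then k :: bucket l a k else bucket l a k.
Proof. by rewrite /bucket -addn1 iotaD rev_cat. Qed.

Lemma mem_bucket l a k i : i \in bucket l a k -> (i < k)%N.
Proof. by rewrite mem_filter mem_rev mem_iota => /andP[_ /andP[_]]. Qed.

Lemma tkey_lt l i : (tkey l i < T)%N.
Proof. by rewrite ltn_mod expn_gt0. Qed.

Lemma bucketed_insert (cnt cnt' : nat -> nat) l i s t : (l < L)%N -> (i < n)%N ->
  (forall l', (cnt l' <= n)%N) ->
  cnt l = i -> cnt' l = i.+1 -> (forall l', l' != l -> cnt' l' = cnt l') ->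
  (forall x, iv t 20 x = if x == (l * T + tkey l i)%N then i.+1 else iv s 20 x) ->
  (forall x, iv t 21 x = if x == (l * n + i)%N then iv s 20 (l * T + tkey l i) else iv s 21 x) ->
  bucketed cnt s -> bucketed cnt' t.
Proof.
move=> lL iN cn ci ci' cne h20 h21 bk l' a l'L aT; have kT := tkey_lt l i.
have old : forall xs ptr, (forall j, j \in xs -> (j < n)%N /\ (l' != l \/ j != i)) ->
    is_list n s l' xs ptr -> is_list n t l' xs ptr.
  move=> xs ptr hx; apply: is_list_ext => j /hx[jn jne].
  by rewrite h21 pair_index_inj//; case: jne => /negPf ->; rewrite ?andbF.
have bk' := bk l' a l'L aT; rewrite h20 pair_index_inj//.
have [ll|ll] := eqVneq l' l => /=; last first.
  rewrite cne//; apply: old bk' => j /mem_bucket jc; split; last by left.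
  exact: leq_trans jc (cn _).
rewrite ll ci' bucketS eq_sym; rewrite ll ci in bk'.
have small : forall j, j \in bucket l a i -> (j < n)%N /\ (l' != l \/ j != i).
  move=> j /mem_bucket ji; split; first exact: ltn_trans ji iN.
  by right; rewrite neq_ltn ji.
have [ka|ka] := eqVneq a (tkey l i); rewrite ll in old; last by apply: old bk' => // j /small; rewrite ll.
split => //; rewrite h21 eqxx -ka; apply: old bk' => j /small.
by rewrite ll.
Qed.

Lemma c_insert_spec s : fits Y s -> loaded d q tape nb (L * K) s ->
  (forall i, (i < n)%N -> prepared m d i (obj i) s) ->
  iv s 1 0 = T -> iv s 2 0 = L -> iv s 3 0 = K -> (forall x, iv s 20 x = 0%N) ->
  let s' := run (c_insert m d B sc) s in
  [/\ bucketed (fun=> n) s',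
    (clock s' <= clock s + 10 + L * (10 + n * (100 + K * (400 + m * 300 + B * 60))))%N &
    fits Y s'].
Proof.
move=> fs ld pr h1 h2 h3 z20; rewrite /c_insert.
pose C := (K * (400 + m * 300 + B * 60))%N.
pose I1 (l : nat) (t : state R) := [/\ bucketed (fun l' => if (l' < l)%N then n else 0%N) t,
  (clock t <= clock s + 10 + l * (10 + n * (100 + C)))%N & fits Y t].
set p1 := For _ _ _; suff : I1 L (run p1 s).
  move: (run p1 s) => w [b1 b2 b3]; split => // l a lL aT; have := b1 l a lL aT; by rewrite lL.
apply: (@for_rule_eq _ _ _ _ I1) => //.
  rewrite /I1; sx; split => //; last by clear; lia.
  by move=> l a lL aT /=; sx; rewrite z20.
move=> l t lL fi fr [i1 i2 i3]; move E1: (tick _ _) => t1.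
have a6 : iv t1 6 0 = l by rewrite -E1; sx.
have ai k x : (k < stride)%N -> k != 6%N -> iv t1 k x = iv t k x.
  by move=> kA kn; rewrite -E1; sx; rewrite (negPf kn).
have ar k x : rv t1 k x = rv t k x by rewrite -E1; sx.
have ac : clock t1 = (clock t + 1)%N by rewrite -E1; sx.
have af : fits Y t1 by rewrite -E1; fx.
pose cnt i l' := if (l' < l)%N then n else if l' == l then i else 0%N.
pose I2 (i : nat) (u : state R) := [/\ bucketed (cnt i) u,
  (clock u <= clock t1 + 5 + i * (100 + C))%N & fits Y u].
set p2 := For _ _ _; suff : I2 n (run p2 t1).
  move: (run p2 t1) => w [b1 b2 b3]; split => //.
    move=> l' a l'L aT; have := b1 l' a l'L aT.
    rewrite /cnt (_ : (l' < l.+1)%N = (l' == l) || (l' < l)%N); last by rewrite ltnS leq_eqVlt.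
    by case: (l' =P l) => [->|_] /=; rewrite ?ltnn.
  by rewrite mulSn; move: b2 i2 ac; clear; lia.
apply: (@for_rule_eq _ _ _ _ I2) => //.
  rewrite /I2; sx; split => //; last by clear; lia.
  move=> l' a l'L aT; sx; have := i1 l' a l'L aT.
  rewrite /cnt (_ : (if (l' < l)%N then n else if l' == l then 0%N else 0%N) =
     if (l' < l)%N then n else 0%N); last by case: (l' == l).
  rewrite ai//; apply: is_list_ext => j _; sx; exact: ai.
move=> i u iN fi2 fr2 [j1 j2 j3].
rewrite run_seq run_seti; move E2: (tick _ _) => u1.
have b5 : iv u1 5 0 = i by rewrite -E2; sx.
have b7 : iv u1 7 0 = 0%N by rewrite -E2; sx.
have bi k x : (k < stride)%N -> k \notin [:: 5; 7]%N -> iv u1 k x = iv u k x.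
  move=> kA; rewrite !inE negb_or => /andP[k5 k7].
  by rewrite -E2; sx; rewrite (negPf k5) (negPf k7).
have br k x : rv u1 k x = rv u k x by rewrite -E2; sx.
have bc : (clock u1 <= clock u + 10)%N by rewrite -E2; sx; clear; lia.
have bf : fits Y u1 by rewrite -E2; fx.
have b6 : iv u1 6 0 = l by rewrite bi// fi2.
have b3 : iv u1 3 0 = K by rewrite bi// fi2// ai// fi.
have b1 : iv u1 1 0 = T by rewrite bi// fi2// ai// fi.
have ri k x : (k < stride)%N -> k \notin [:: 0; 1]%N -> rv u1 k x = rv s k x.
  by move=> kA kn; rewrite br fr2 ?ar ?fr//; apply: contra kn; inx.
have ii k x : (k < stride)%N -> k \in [:: 22; 23]%N -> iv u1 k x = iv s k x.
  by move=> kA; rewrite !inE => /orP[] /eqP ->; rewrite bi// fi2// ai// fi.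
have ld1 : loaded d q tape nb (L * K) u1.
  by apply: loaded_ext ld => x; [apply: ii|apply: ri|apply: ri].
have pr1 : prepared m d i (obj i) u1.
  by apply: prepared_ext (pr i iN) => x; [apply: ii|apply: ri].
rewrite run_seq.
have := c_key_spec Y0 d0 (env_small iN) (leq0n d) (range iN) lL bf ld1 pr1 b6 b5 b7 b3 b1.
have f1 := @c_key_frame R m d B sc env tape u1.
move: f1; move: (run (c_key _ _ _ _) u1) => u2 f1 [e1 e2 e3].
rewrite -/(tkey l i) in e1.
have g1 : iv u2 1 0 = T by rewrite f1.
have g5 : iv u2 5 0 = i by rewrite f1.
have g6 : iv u2 6 0 = l by rewrite f1.
have lnY : (l * n + i < Y)%N.
  apply: leq_trans Ln; apply: (@leq_trans (l.+1 * n)); last by rewrite leq_mul2r lL orbT.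
  by rewrite mulSn addnC ltn_add2r.
have lTY : (l * T + tkey l i < Y)%N.
  apply: leq_trans LT; apply: (@leq_trans (l.+1 * T)); last by rewrite leq_mul2r lL orbT.
  by rewrite mulSn addnC ltn_add2r tkey_lt.
rewrite run_seq; move E3: (run _ u2) => u3; rewrite run_setia in E3.
have ix3 : iev u2 (IAdd (IMul (V 6) IObjects) (V 5)) = (l * n + i)%N by sx; rewrite g5 g6.
have ix2 : iev u2 head_ix = (l * T + tkey l i)%N by rewrite /head_ix; sx; rewrite g6 g1 e1.
have E3' : forall k x, (k < stride)%N -> iv u3 k x =
    if (k == 21%N) && (x == (l * n + i)%N) then iv u2 20 (l * T + tkey l i) else iv u2 k x.
  by move=> k x kA; rewrite -E3 ix3 ev_arr ix2; sx.
have c3 : (clock u3 <= clock u2 + 30)%N by rewrite -E3; sx; clear; lia.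
have f3 : fits Y u3 by rewrite -E3 ix3; fx.
rewrite run_setia.
have ix4 : iev u3 head_ix = (l * T + tkey l i)%N.
  by rewrite /head_ix; sx; rewrite !E3'//= g6 g1 e1.
rewrite ix4; split; last 2 first.
- sx; rewrite mulSn; move: c3 e2 bc j2; rewrite /C; clear; lia.
- by fx.
apply: (bucketed_insert (cnt := cnt i) (l := l) (i := i) (s := u)) => //.
- by move=> l'; rewrite /cnt; case: ifP => // _; case: ifP => // _; exact: ltnW.
- by rewrite /cnt ltnn eqxx.
- by rewrite /cnt ltnn eqxx.
- by move=> l' ne; rewrite /cnt (negPf ne).
- move=> x; sx; rewrite E3'//= g5 addn1; case: eqP => // _.
  by rewrite E3'//= f1// bi.
- move=> x; sx; rewrite E3'//=; case: eqP => // _; by rewrite f1// bi.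
Qed.

End Insertion.

Section StartState.
Variable R : realType.

Lemma iv_state0 k x : iv (state0 R) k x = 0%N. Proof. exact: erefl. Qed.
Lemma rv_state0 k x : rv (state0 R) k x = 0. Proof. exact: erefl. Qed.
Lemma fits_state0 Y : fits Y (state0 R).
Proof. exact: isT. Qed.

End StartState.

Section Build.
Variables (R : realType) (m d q a b lam B : nat) (sc : R).
Variables (data : seq (pgon R)) (tape : nat -> bool) (Y : nat).
Local Notation run := (exec data tape).
Local Notation n := (size data).
Local Notation U := (up_log (2 ^ b) n).
Local Notation nb := (b * U)%N.
Local Notation K := (a * U)%N.
Local Notation L := (lam ^ U)%N.
Local Notation T := (2 ^ nb)%N.
Local Notation M := ((2 ^ B)%:R : R).
Local Notation obj i := (nth (pgon0 R) data i).
Local Notation BL := (hash_coins d q nb).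
Implicit Types s t : state R.
Hypotheses (Y0 : (0 < Y)%N) (d0 : (0 < d)%N) (b0 : (0 < b)%N) (dn : (d < n)%N).
Hypothesis data_small : forall i, (i < n)%N -> (nverts (obj i) <= m)%N.
Hypothesis data_cross : forall i k, (i < n)%N -> (k < nverts (obj i))%N ->
  cross (edge (obj i) k) (edge (obj i) k.+1) != 0.
Hypothesis range : forall i, (i < n)%N -> \sum_(j < d) `|vec d sc (obj i) 0 j| + 2 <= M.
Hypotheses (LT : (L * T <= Y)%N) (Ln : (L * n <= Y)%N) (nm : (n * m <= Y)%N)
  (LKD : (L * K * (2 * d + 1) <= Y)%N).

Definition prep_cost : nat := 400 + m * (1000 + d * 50).
Definition key_cost : nat := 400 + m * 300 + B * 60.
Definition gen_cost (k : nat) : nat := 210 + 20 * k + 20 * q.+1 + 100 * d.+1.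

Lemma prep_all_spec s : fits Y s ->
  let s' := run (For (INat 5) IObjects (c_prep R m d)) s in
  [/\ forall i, (i < n)%N -> prepared m d i (obj i) s',
    (clock s' <= clock s + 10 + n * (prep_cost + 10))%N & fits Y s'].
Proof.
move=> fs.
pose I (i : nat) (t : state R) := [/\ forall j, (j < i)%N -> prepared m d j (obj j) t,
  (clock t <= clock s + 10 + i * (prep_cost + 10))%N & fits Y t].
set p := For _ _ _; suff : I n (run p s) by [].
apply: (@for_rule_eq _ _ _ n I) => //.
  by rewrite /I; sx; split => //; lia.
move=> i t iN _ _ [h1 h2 h3]; move E: (tick 1 _) => t1.
have f1 : fits Y t1 by rewrite -E; fx.
have v5 : iv t1 5 0 = i by rewrite -E; sx.
have v23 x : iv t1 23 x = iv t 23 x by rewrite -E; sx.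
have v22 x : rv t1 22 x = rv t 22 x by rewrite -E; sx.
have c1 : clock t1 = (clock t + 1)%N by rewrite -E; sx.
have iY : (i * m + m <= Y)%N.
  by apply: leq_trans nm; rewrite addnC -mulSn leq_mul2r iN orbT.
have := c_prep_spec d tape Y0 (data_small iN) (fun k => @data_cross i k iN) f1 v5 iY.
move: (run _ t1) => u [p1 p2 p3 p4 p5]; split => //; last first.
  by rewrite mulSn; move: p4 c1 h2; rewrite /prep_cost; clear; lia.
move=> j; rewrite ltnS leq_eqVlt => /orP[/eqP -> //|ji] k kj.
have [e1 e2] := h1 j ji k kj; have jn := ltn_trans ji iN.
have out : ~~ (i * m <= j * m + k < i * m + m)%N.
  rewrite negb_and -ltnNge; apply/orP; left.
  apply: (@leq_trans (j.+1 * m)); last by rewrite leq_mul2r ji orbT.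
  by rewrite mulSn addnC ltn_add2r; apply: leq_trans kj (data_small jn).
by rewrite p2// p3// v23 v22.
Qed.

Lemma c_preproc_spec :
  let s := run (c_preproc m d q a b lam B sc) (state0 R) in
  [/\ iv s 0 0 = 0%N, iv s 1 0 = T, iv s 2 0 = L & iv s 3 0 = K] /\
  [/\ loaded d q tape nb (L * K) s, forall i, (i < n)%N -> prepared m d i (obj i) s &
    bucketed d q B nb K L sc data tape (fun=> n) s] /\
  [/\ coins s = (L * K * BL)%N,
    (clock s <= 200 + n * 60 + L * K * gen_cost nb + n * (prep_cost + 10) +
      L * (10 + n * (100 + K * key_cost)))%N & fits Y s].
Proof.
cbv zeta; have nd : (n <= d)%N = false by rewrite leqNgt dn.
rewrite /c_preproc run_ifi !ievE (ifF _ _ nd) run_seq.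
move E0: (tick _ _) => s0.
have v0 k x : iv s0 k x = 0%N by rewrite -E0 iv_tick iv_state0.
have r0 k x : rv s0 k x = 0 by rewrite -E0 rv_tick rv_state0.
have f0 : fits Y s0 by rewrite -E0 fits_tick fits_state0.
have c0 : clock s0 = 3 by rewrite -E0.
have k0 : coins s0 = 0%N by rewrite -E0.
have := @c_size_spec R a b lam data tape Y Y0 s0 b0 f0.
have fi1 := @frame_iv R data tape (c_size R a b lam) s0.
have fr1 := @frame_rv R data tape (c_size R a b lam) s0.
move: fi1 fr1; move: (run (c_size _ _ _ _) s0) => s1 fi1 fr1 [a1 a2 a3 a4 [a5 a6 a7]].
rewrite -expnM in a1; rewrite run_seq.
have z1 : forall x, rv s1 21 x = 0 by move=> x; rewrite fr1// r0.
have H23 : (iv s1 2 0 * iv s1 3 0)%N = (L * K)%N by rewrite a2 a3.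
have := @c_gen_spec R d q data tape Y Y0 nb (L * K) s1 a7 a4 H23 (etrans a5 k0) z1 LKD.
have fi2 := @frame_iv R data tape (c_gen R d q) s1.
move: fi2; move: (run (c_gen _ _ _) s1) => s2 fi2 [b1 b2 b3 b4]; rewrite run_seq.
have := prep_all_spec b4.
have fi3 := @frame_iv R data tape (For (INat 5) IObjects (c_prep R m d)) s2.
have fr3 := @frame_rv R data tape (For (INat 5) IObjects (c_prep R m d)) s2.
have fc3 := @frame_coins R data tape (For (INat 5) IObjects (c_prep R m d)) s2.
move: fi3 fr3 fc3; move: (run (For _ _ _) s2) => s3 fi3 fr3 fc3 [d1 d2 d3].
have ld3 : loaded d q tape nb (L * K) s3.
  by apply: loaded_ext b1 => x; [rewrite fi3|rewrite fr3|rewrite fr3].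
have g1 : iv s3 1 0 = T by rewrite fi3// fi2.
have g2 : iv s3 2 0 = L by rewrite fi3// fi2.
have g3 : iv s3 3 0 = K by rewrite fi3// fi2.
have g20 : forall x, iv s3 20 x = 0%N by move=> x; rewrite fi3// fi2// fi1// v0.
have := c_insert_spec Y0 d0 data_small range LT Ln d3 ld3 d1 g1 g2 g3 g20.
have fi4 := @frame_iv R data tape (c_insert m d B sc) s3.
have fr4 := @frame_rv R data tape (c_insert m d B sc) s3.
have fc4 := @frame_coins R data tape (c_insert m d B sc) s3.
move: fi4 fr4 fc4; move: (run (c_insert _ _ _ _) s3) => s4 fi4 fr4 fc4 [e1 e2 e3].
split; [|split].
- by split; rewrite fi4// fi3// fi2// fi1// v0.
- split => //.
    by apply: loaded_ext ld3 => x; [rewrite fi4|rewrite fr4|rewrite fr4].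
  move=> i iN; apply: prepared_ext (d1 i iN) => x; [by rewrite fi4|by rewrite fr4].
- split => //; first by rewrite fc4// fc3.
  move: e2 d2 b3 a6 c0; rewrite /gen_cost /key_cost /prep_cost; clear.
  move: (L * _)%N (L * K * _)%N (n * (_ + 10))%N => u v w; lia.
Qed.

End Build.

Lemma iv_counter (R : realType) (s : state R) k i k' x : (k < stride)%N -> (k' < stride)%N ->
  k' != k -> iv (tick 1 (wi k 0 i s)) k' x = iv s k' x.
Proof. by move=> kA kA' kk; rewrite iv_tick iv_wi// (negPf kk). Qed.

(** * Correctness and cost of a query *)

Section Query.
Variables (R : realType) (m d q a b lam B nb K L : nat) (sc cr : R).
Variables (data : seq (pgon R)) (Q : pgon R) (tape : nat -> bool) (Y : nat).
Local Notation env := (rcons data Q).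
Local Notation run := (exec env tape).
Local Notation iev := (ieval env).
Local Notation n := (size data).
Local Notation T := (2 ^ nb)%N.
Local Notation M := ((2 ^ B)%:R : R).
Local Notation obj i := (nth (pgon0 R) data i).
Local Notation key_cost := (key_cost m B).
Implicit Types s t : state R.

(** Preserved by every later step, since cell 0 only receives objects that passed the distance
    test. *)
Definition valid s : bool := (iv s 0 0 < n)%N && (D2 (obj (iv s 0 0)) Q <= cr).

Lemma valid_ext s t : iv t 0 0 = iv s 0 0 -> valid t = valid s.
Proof. by rewrite /valid => ->. Qed.

Lemma obj_env i : (i < n)%N -> nth (pgon0 R) env i = obj i.
Proof. by move=> iN; rewrite nth_rcons iN. Qed.

Lemma query_env : nth (pgon0 R) env n = Q.
Proof. by rewrite nth_rcons ltnn eqxx. Qed.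

Lemma ev_nobj s : iev s nobj = n.
Proof. by rewrite /nobj !ievE size_rcons subn1. Qed.

Hypotheses (Y0 : (0 < Y)%N).

Lemma c_brute_spec s : fits Y s ->
  let s' := run (c_brute cr) s in
  [/\ (exists2 i, (i < n)%N & D2 (obj i) Q <= cr) -> valid s',
    (clock s' <= clock s + 10 + n * 40)%N, fits Y s' & coins s' = coins s].
Proof.
move=> fs.
pose I (k : nat) (t : state R) := [/\ (exists2 i, (i < k)%N & D2 (obj i) Q <= cr) -> valid t,
  (clock t <= clock s + 10 + k * 40)%N & fits Y t].
have fc := @frame_coins R env tape (c_brute cr) s.
suff : I n (run (c_brute cr) s) by move=> [h1 h2 h3]; split => //; rewrite fc.
apply: (@for_rule_eq _ _ _ n I) => //; first exact: ev_nobj.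
  by rewrite /I; sx; split => //; [case|lia].
move=> k t kn _ _ [h1 h2 h3]; rewrite run_ifr; move E: (tick 1 _) => t1.
have v5 : iv t1 5 0 = k by rewrite -E; sx.
have v0 : iv t1 0 0 = iv t 0 0 by rewrite -E; sx.
have c1 : clock t1 = (clock t + 1)%N by rewrite -E; sx.
have f1 : fits Y t1 by rewrite -E; fx.
rewrite !revE ev_nobj !ievE v5 obj_env// query_env; case: ifP => Dk.
  rewrite run_seti !ievE; split; last by fx.
    by move=> _; rewrite /valid !stE iv_wi//= v5 kn.
  by rewrite !stE /= c1; move: h2; clear; lia.
rewrite run_skip; split; last by fx.
  move=> [i]; rewrite ltnS leq_eqVlt => /orP[/eqP ->|ik Di]; first by rewrite Dk.
  by rewrite /valid !stE v0; apply: h1; exists i.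
by rewrite !stE /= c1; move: h2; clear; lia.
Qed.

Hypotheses (d0 : (0 < d)%N) (Qm : (nverts Q <= m)%N) (nm : (n * m + m <= Y)%N).
Hypothesis Qcross : forall k, (k < nverts Q)%N -> cross (edge Q k) (edge Q k.+1) != 0.
Hypothesis rangeQ : forall sh, (sh <= d)%N -> \sum_(j < d) `|vec d sc Q sh j| + 2 <= M.

Definition ready s : Prop :=
  [/\ iv s 1 0 = T, iv s 2 0 = L, iv s 3 0 = K & iv s 5 0 = n] /\
  [/\ loaded d q tape nb (L * K) s, prepared m d n Q s &
    bucketed d q B nb K L sc data tape (fun=> n) s].

Lemma ready_ext s t :
  (forall k x, k \in [:: 1; 2; 3; 5; 20; 21; 22; 23]%N -> iv t k x = iv s k x) ->
  (forall k x, k \in [:: 20; 21; 22]%N -> rv t k x = rv s k x) -> ready s -> ready t.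
Proof.
move=> hi hr [[r1 r2 r3 r4] [r5 r6 r7]]; split; first by split; rewrite hi.
split.
- by apply: loaded_ext r5 => x; [rewrite hi|rewrite hr|rewrite hr].
- by apply: prepared_ext r6 => x; [rewrite hi|rewrite hr].
- move=> l c lL cT; rewrite hi//; apply: is_list_ext (r7 l c lL cT) => i _.
  by rewrite hi.
Qed.

Definition qkey (sh l : nat) : nat :=
  key d q nb M K (vec d sc Q sh) (table_tape d q nb K l tape).
Definition qbucket (sh l : nat) : seq nat :=
  bucket d q B nb K sc data tape l (qkey sh l) n.

Lemma qkey_lt sh l : (qkey sh l < T)%N.
Proof. by rewrite ltn_mod expn_gt0. Qed.

Definition walk s (xs : seq nat) : Prop :=
  [/\ is_list n s (iv s 6 0).-1 xs (iv s 12 0), all (fun i => i < n)%N xs &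
    (iv s 6 0 <= L)%N].

Lemma step_frame s k x : (k < stride)%N -> k \notin [:: 0; 6; 9; 10; 11; 12; 14; 15]%N ->
  iv (run (c_step m d B sc cr) s) k x = iv s k x.
Proof. by move=> kA kn; apply: frame_iv => //; apply: contra kn; inx. Qed.

Lemma c_lookup_spec sh l s : (sh <= d)%N -> (l < L)%N -> fits Y s -> ready s ->
  iv s 7 0 = sh -> iv s 6 0 = l ->
  let s' := run (c_lookup m d B sc) s in
  [/\ (clock s' <= clock s + 100 + K * key_cost)%N, fits Y s', iv s' 0 0 = iv s 0 0,
    iv s' 6 0 = l.+1 & iv s' 12 0 = iv s 20 (l * T + qkey sh l)].
Proof.
move=> shd lL fs [[r1 r2 r3 r4] [r5 r6 r7]] v7 v6; rewrite /c_lookup run_seq.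
have r6' : prepared m d n (nth (pgon0 R) env n) s by rewrite query_env.
have Qm' : (nverts (nth (pgon0 R) env n) <= m)%N by rewrite query_env.
have rg : \sum_(j < d) `|vec d sc (nth (pgon0 R) env n) sh j| + 2 <= M.
  by rewrite query_env; exact: rangeQ.
have := c_key_spec Y0 d0 Qm' shd rg lL fs r5 r6' v6 r4 v7 r3 r1.
have f1 := @c_key_frame R m d B sc env tape s.
move: f1; move: (run (c_key _ _ _ _) s) => u f1 [u1 u2 u3].
rewrite query_env -/(qkey sh l) in u1.
have h : iev u head_ix = (l * T + qkey sh l)%N by rewrite /head_ix !ievE u1 f1// f1// v6 r1.
rewrite run_seq run_seti run_seti ev_arr h.
split; [|by fx|by sx; rewrite f1|by sx; rewrite f1// v6 addn1|by sx; rewrite f1].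
by sx; move: u2; rewrite /key_cost; clear; lia.
Qed.

Lemma c_visit_spec l i s : fits Y s -> (i < n)%N -> iv s 12 0 = i.+1 -> iv s 6 0 = l ->
  let s' := run (c_visit cr) s in
  [/\ (clock s' <= clock s + 100)%N, fits Y s', valid s || (D2 (obj i) Q <= cr) -> valid s',
    iv s' 6 0 = l & iv s' 12 0 = iv s 21 (l.-1 * n + i)].
Proof.
move=> fs iN v12 v6; rewrite /c_visit run_seq run_seti !ievE v12 subn1.
move E: (tick _ _) => t.
have e k x : (k < stride)%N -> k != 15%N -> iv t k x = iv s k x.
  by move=> kA k15; rewrite -E; sx; rewrite (negPf k15).
have e15 : iv t 15 0 = i by rewrite -E; sx.
have ec : (clock t <= clock s + 20)%N by rewrite -E; sx; clear; lia.
have ef : fits Y t by rewrite -E; fx.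
rewrite run_seq; move E2: (run _ t) => u.
have [g1 g2 g3 g4] : [/\ (clock u <= clock t + 40)%N, fits Y u,
    valid s || (D2 (obj i) Q <= cr) -> valid u &
    forall k x, (k < stride)%N -> k != 0%N -> iv u k x = iv t k x].
  rewrite -E2 run_ifr !revE ev_nobj !ievE e15 obj_env// query_env; case: ifP => Dk.
    rewrite run_seti !ievE; split.
    - by sx; clear; lia.
    - by fx.
    - by move=> _; rewrite /valid !iv_tick iv_wi// iv_tick e15 iN.
    - by move=> k x kA k0; sx; rewrite (negPf k0).
  rewrite orbF run_skip; split.
  - by sx; clear; lia.
  - by fx.
  - by rewrite /valid iv_tick e.
  - by move=> k x kA k0; sx.
have h : iev u (IAdd (IMul (ISub (V 6) (INat 1)) nobj) (V 15)) = (l.-1 * n + i)%N.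
  by rewrite ev_add ev_mul ev_sub ev_nobj !ievE !g4// e// e15 v6 subn1.
rewrite run_seti ev_arr h; split.
- by sx; move: g1 ec; clear; lia.
- by fx.
- by rewrite /valid iv_tick iv_wi.
- by sx; rewrite g4// e.
- by sx; rewrite g4// e.
Qed.

Lemma c_step_spec sh s xs : (sh <= d)%N -> fits Y s -> ready s -> iv s 7 0 = sh -> walk s xs ->
  let s' := run (c_step m d B sc cr) s in
  [/\ (clock s' <= clock s + 200 + K * key_cost)%N, fits Y s', valid s -> valid s' &
    exists2 xs', walk s' xs' &
    if xs is i :: xs1 then
      [/\ iv s' 6 0 = iv s 6 0, xs' = xs1 & D2 (obj i) Q <= cr -> valid s']
    else (iv s 6 0 < L)%N -> iv s' 6 0 = (iv s 6 0).+1 /\ xs' = qbucket sh (iv s 6 0)].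
Proof.
move=> shd fs rs v7 [w1 w2 w3]; have [[r1 r2 r3 r4] [r5 r6 r7]] := rs.
have := step_frame s; rewrite /c_step run_ifi !ievE.
move E: (tick _ s) => t.
have e k x : iv t k x = iv s k x by rewrite -E !stE.
have er k x : rv t k x = rv s k x by rewrite -E !stE.
have ec : (clock t <= clock s + 20)%N by rewrite -E !stE; clear; rewrite /=; lia.
have ef : fits Y t by rewrite -E; fx.
have vt : valid t = valid s by apply: valid_ext; exact: e.
case: xs w1 w2 => [|i xs1].
  move=> w1 _; rewrite [iv s 12 0]w1 leqnn run_ifi !ievE !e r2 addn1.
  move E2: (tick _ t) => t2.
  have e2 k x : iv t2 k x = iv s k x by rewrite -E2 !stE e.
  have er2 k x : rv t2 k x = rv s k x by rewrite -E2 !stE er.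
  have ec2 : (clock t2 <= clock s + 40)%N.
    by rewrite -E2 !stE; move: ec; clear; rewrite /=; lia.
  have ef2 : fits Y t2 by rewrite -E2; fx.
  have vt2 : valid t2 = valid s by apply: valid_ext; exact: e2.
  have r2t : ready t2 by apply: ready_ext rs => k x _; [exact: e2|exact: er2].
  case: ltnP => [lL|Ll].
    have := c_lookup_spec shd lL ef2 r2t (etrans (e2 _ _) v7) (e2 _ _).
    move: (run _ t2) => u [u1 u2 u3 u4 u5] fr; split.
    - by move: u1 ec2; clear; lia.
    - exact: u2.
    - by rewrite /valid u3 e2.
    exists (qbucket sh (iv s 6 0)); last by move=> _; rewrite u4; split; reflexivity.
    split; last by rewrite u4; exact: lL.
      rewrite u4 u5 e2 -[_.+1.-1]/(iv s 6 0); apply: is_list_ext (r7 _ _ lL (qkey_lt sh _)) => j _.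
      by apply: fr.
    by apply/allP => j /mem_bucket.
  rewrite run_skip => _; split.
  - by move: ec2; clear; lia.
  - exact: ef2.
  - by rewrite vt2.
  exists [::]; last by [].
  by split; [rewrite !e2; exact: w1|exact: isT|rewrite e2; exact: w3].
move=> [w0 w1] /andP[iN w2].
have h0 : (iv s 12 0 <= 0)%N = false by rewrite w0.
rewrite (ifF _ _ h0).
have := c_visit_spec ef iN (etrans (e _ _) w0) (e _ _).
move: (run _ t) => u [u1 u2 u3 u4 u5] fr; split.
- by move: u1 ec; clear; lia.
- exact: u2.
- by move=> vs; apply: u3; rewrite vt vs.
exists xs1; last by split; [exact: u4|reflexivity|move=> Di; apply: u3; rewrite Di orbT].
split; [|exact: w2|by rewrite u4; exact: w3].
by rewrite u4 u5 e; apply: is_list_ext w1 => j _; apply: fr.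
Qed.

Definition far_obj (i : nat) : bool := ~~ (D2 (obj i) Q <= cr).

(* The number of steps that remain to be made, as long as only far objects are visited. *)
Definition pending (sh v : nat) (xs : seq nat) : nat :=
  count far_obj xs + \sum_(v <= l < L) (1 + count far_obj (qbucket sh l)).

Lemma pending_lookup sh v : (v < L)%N ->
  pending sh v [::] = (pending sh v.+1 (qbucket sh v)).+1.
Proof. by move=> vL; rewrite /pending big_ltn// -addnA add0n. Qed.

Lemma pending_visit sh v i xs : far_obj i -> pending sh v (i :: xs) = (pending sh v xs).+1.
Proof. by move=> fi; rewrite /pending /= fi. Qed.

Definition reachable (sh i l : nat) : Prop :=
  [/\ (l < L)%N, D2 (obj i) Q <= cr & i \in qbucket sh l].

Let step_loop := For (INat 8) (IMul (INat 9) (V 2)) (c_step m d B sc cr).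

Let kept_iv k : k \in [:: 1; 2; 3; 5; 20; 21; 22; 23]%N ->
  [/\ (k < stride)%N, k != 8%N & k \notin imods step_loop].
Proof. by rewrite !inE; repeat (case/orP; [by move/eqP=> ->|]); move/eqP=> ->. Qed.

Let kept_rv k : k \in [:: 20; 21; 22]%N -> (k < stride)%N /\ k \notin rmods (c_step m d B sc cr).
Proof. by rewrite !inE; repeat (case/orP; [by move/eqP=> ->|]); move/eqP=> ->. Qed.

(** A potential argument: until a valid answer is found, every step lowers [pending] by at least
    one, being the lookup of a further table or the visit of a far object, and the reachable object
    is still ahead. *)
Lemma c_shift_spec sh s : (sh <= d)%N -> fits Y s -> ready s -> iv s 7 0 = sh ->
  let s' := run (c_shift m d B sc cr) s in
  [/\ (clock s' <= clock s + 20 + L * (9 * (210 + K * key_cost)))%N, fits Y s',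
    valid s -> valid s' &
    forall i l, reachable sh i l -> (\sum_(l < L) count far_obj (qbucket sh l) < 8 * L)%N ->
      valid s'].
Proof.
move=> shd fs rs v7; rewrite /c_shift !run_seq !run_seti !ievE.
move E: (tick _ _) => t.
have e k x : (k < stride)%N -> k \notin [:: 6; 12]%N -> iv t k x = iv s k x.
  move=> kA; rewrite !inE negb_or => /andP[k6 k12].
  by rewrite -E; sx; rewrite (negPf k6) (negPf k12).
have e6 : iv t 6 0 = 0%N by rewrite -E; sx.
have e12 : iv t 12 0 = 0%N by rewrite -E; sx.
have er k x : rv t k x = rv s k x by rewrite -E; sx.
have ec : (clock t <= clock s + 6)%N by rewrite -E; sx; clear; lia.
have ef : fits Y t by rewrite -E; fx.
have vt : valid t = valid s by apply: valid_ext; exact: e.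
have rt : ready t.
  apply: ready_ext rs => k x; last by [].
  by rewrite !inE; repeat (case/orP; [by move/eqP=> ->; apply: e|]); move/eqP=> ->; apply: e.
have e2 : iv t 2 0 = L by case: rt => -[].
(* The object i is in the rest of the current list or in a table not yet opened. In the latter case
   l witnesses that a table is left, so that an empty list is followed by a real lookup. *)
pose I (x : nat) (u : state R) := [/\ (clock u <= clock t + 10 + x * (210 + K * key_cost))%N,
  fits Y u, valid t -> valid u & exists2 xs, walk u xs & forall i l, reachable sh i l ->
    valid u \/ (i \in xs \/ (iv u 6 0 <= l)%N) /\
      (x + pending sh (iv u 6 0) xs <= pending sh 0 [::])%N].
set p := For _ _ _; have : I (9 * L)%N (run p t).
  apply: (@for_rule_eq _ _ _ _ I); [by rewrite !ievE e2|exact: isT| |].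
    rewrite /I !stE; split.
    - by rewrite /=; clear; lia.
    - by fx.
    - by rewrite /valid stE.
    exists [::]; first by split; [rewrite !stE e12; reflexivity|exact: isT|rewrite stE e6].
    by move=> i l _; right; rewrite e6; split; [right|].
  move=> x u xL fi fr [i1 i2 i3 [xs w h]]; move E2: (tick 1 _) => u1.
  have g k y : (k < stride)%N -> k != 8%N -> iv u1 k y = iv u k y.
    by move=> kA k8; rewrite -E2; exact: iv_counter.
  have gr k y : rv u1 k y = rv u k y by rewrite -E2 rv_tick rv_wi.
  have gc : clock u1 = (clock u + 1)%N by rewrite -E2 clock_tick clock_wi.
  have gf : fits Y u1 by rewrite -E2 fits_tick; exact: fits_wi.
  have vu : valid u1 = valid u by apply: valid_ext; exact: g.
  have ru : ready u1.
    apply: ready_ext rt => k y.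
      by move=> /kept_iv[kA k8 kn]; rewrite (g _ _ kA k8); exact: fi kA kn.
    by move=> /kept_rv[kA kn]; rewrite gr; exact: fr kA kn.
  have u7 : iv u1 7 0 = sh.
    by rewrite (g 7%N _ isT isT) (fi 7%N _ isT isT) (e 7%N _ isT isT); exact: v7.
  have u6 : iv u1 6 0 = iv u 6 0 by exact: g.
  have wu : walk u1 xs.
    case: w => w1 w2 w3; split; [|exact: w2|by rewrite u6; exact: w3].
    rewrite u6 (g 12%N _ isT isT); apply: is_list_ext w1 => j _; exact: g.
  have := c_step_spec shd gf ru u7 wu.
  rewrite u6; move: (run _ u1) => v [v1 v2 v3 [xs' w' hx]]; split.
  - by rewrite mulSn; move: v1 i1 gc; clear; lia.
  - exact: v2.
  - by move=> vt'; apply: v3; rewrite vu; exact: i3.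
  exists xs'; first exact: w'.
  move=> i l reach; have [vv|[mem pen]] := h i l reach; first by left; apply: v3; rewrite vu.
  have [lL Di ib] := reach.
  move: h w wu mem pen hx; clear - lL Di ib; case: xs => [|j xs1] h w wu mem pen.
    have vl : (iv u 6 0 <= l)%N by case: mem.
    have vL := leq_ltn_trans vl lL.
    move=> /(_ vL)[n6 xs'E]; right; rewrite n6 xs'E; split.
      by have := vl; rewrite (leq_eqVlt _ l) => /orP[/eqP vE|vl']; [left; rewrite vE|right].
    by rewrite addSnnS -pending_lookup.
  move=> [n6 -> hj]; have [Dj|Dj] := boolP (D2 (obj j) Q <= cr); first by left; exact: hj.
  right; rewrite n6; split; last by rewrite addSnnS -(pending_visit sh _ _ Dj).
  case: mem; last by right.
  by rewrite inE => /orP[/eqP ij|]; [rewrite -ij Di in Dj|left].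
move: (run p t) => v [v1 v2 v3 [xs w h]]; split.
- by move: v1 ec; rewrite mulnCA mulnA; clear; lia.
- exact: v2.
- by rewrite -vt.
move=> i l reach few; have [vv|[_ pen]] := h i l reach; first exact: vv.
(* Initially [pending] is L plus the number of far objects, hence below 9 L; so 9 L steps without
   success are impossible. *)
exfalso; move: pen few; clear => pen few.
suff : (9 * L < 9 * L)%N by rewrite ltnn.
apply: leq_ltn_trans (leq_trans (leq_addr _ _) pen) _.
rewrite /pending /= add0n big_mkord big_split /= sum1_card card_ord.
by move: few; clear; move: (\sum_(l < L) _)%N => S; lia.
Qed.

Let shift_loop := For (INat 7) (INat d.+1) (c_shift m d B sc cr).

Let kept_iv7 k : k \in [:: 1; 2; 3; 5; 20; 21; 22; 23]%N ->
  [/\ (k < stride)%N, k != 7%N & k \notin imods shift_loop].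
Proof. by rewrite !inE; repeat (case/orP; [by move/eqP=> ->|]); move/eqP=> ->. Qed.

Let kept_rv7 k : k \in [:: 20; 21; 22]%N -> (k < stride)%N /\ k \notin rmods (c_shift m d B sc cr).
Proof. by rewrite !inE; repeat (case/orP; [by move/eqP=> ->|]); move/eqP=> ->. Qed.

Definition shift_cost : nat := 30 + L * (9 * (210 + K * key_cost)).

Lemma shifts_spec s : fits Y s -> ready s ->
  let s' := run shift_loop s in
  [/\ (clock s' <= clock s + 10 + d.+1 * shift_cost)%N, fits Y s' &
    forall sh i l, (sh <= d)%N -> reachable sh i l ->
      (\sum_(l < L) count far_obj (qbucket sh l) < 8 * L)%N -> valid s'].
Proof.
move=> fs rs.
pose I (x : nat) (u : state R) := [/\ (clock u <= clock s + 10 + x * shift_cost)%N,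
  fits Y u & forall sh i l, (sh < x)%N -> reachable sh i l ->
      (\sum_(l < L) count far_obj (qbucket sh l) < 8 * L)%N -> valid u].
suff : I d.+1 (run shift_loop s) by [].
apply: (@for_rule_eq _ _ _ _ I); [by []|exact: isT| |].
  by split; [rewrite stE /=; clear; lia|fx|].
move=> x u xd fi fr [i1 i2 i3]; move E2: (tick 1 _) => u1.
have g k y : (k < stride)%N -> k != 7%N -> iv u1 k y = iv u k y.
  by move=> kA k8; rewrite -E2; exact: iv_counter.
have gr k y : rv u1 k y = rv u k y by rewrite -E2 rv_tick rv_wi.
have gc : clock u1 = (clock u + 1)%N by rewrite -E2 clock_tick clock_wi.
have gf : fits Y u1 by rewrite -E2 fits_tick; exact: fits_wi.
have u7 : iv u1 7 0 = x by rewrite -E2 iv_tick iv_wi.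
have vu : valid u1 = valid u by apply: valid_ext; exact: g.
have ru : ready u1.
  apply: ready_ext rs => k y.
    by move=> /kept_iv7[kA k8 kn]; rewrite (g _ _ kA k8); exact: fi kA kn.
  by move=> /kept_rv7[kA kn]; rewrite gr; exact: fr kA kn.
have := c_shift_spec xd gf ru u7.
move: (run _ u1) => v [v1 v2 v3 v4]; split; [|exact: v2|].
  by rewrite mulSn /shift_cost; move: v1 i1 gc; rewrite /shift_cost; clear; lia.
move=> sh i l; rewrite ltnS leq_eqVlt => /orP[/eqP ->|shx] reach few; first exact: v4 reach few.
by apply: v3; rewrite vu; exact: i3 shx reach few.
Qed.

Lemma c_query_spec s : (d < n)%N -> fits Y s ->
  [/\ iv s 1 0 = T, iv s 2 0 = L & iv s 3 0 = K] ->
  loaded d q tape nb (L * K) s -> bucketed d q B nb K L sc data tape (fun=> n) s ->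
  let s' := run (c_query m d B sc cr) s in
  [/\ (clock s' <= clock s + 40 + prep_cost m d + d.+1 * shift_cost)%N, fits Y s',
    coins s' = coins s &
    forall sh i l, (sh <= d)%N -> reachable sh i l ->
      (\sum_(l < L) count far_obj (qbucket sh l) < 8 * L)%N -> valid s'].
Proof.
move=> dn fs [r1 r2 r3] ld bk; have fc := @frame_coins R env tape (c_query m d B sc cr) s isT.
move: fc; rewrite /c_query run_ifi ev_nobj ev_nat.
have nd : (n <= d)%N = false by rewrite leqNgt dn.
rewrite (ifF _ _ nd) run_seq run_seti ev_nobj; move E: (tick _ (wi _ _ _ _)) => t.
have e k y : (k < stride)%N -> k != 5%N -> iv t k y = iv s k y.
  by move=> kA kk; rewrite -E iv_tick iv_wi// (negPf kk) iv_tick.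
have er k y : rv t k y = rv s k y by rewrite -E !rv_tick rv_wi rv_tick.
have ec : (clock t <= clock s + 20)%N.
  by rewrite -E !stE /=; clear; lia.
have ef : fits Y t by rewrite -E fits_tick; apply: fits_wi.
have e5 : iv t 5 0 = n by rewrite -E iv_tick iv_wi.
rewrite run_seq.
have Qm' : (nverts (nth (pgon0 R) env n) <= m)%N by rewrite query_env.
have Qc' k : (k < nverts (nth (pgon0 R) env n))%N ->
    cross (edge (nth (pgon0 R) env n) k) (edge (nth (pgon0 R) env n) k.+1) != 0.
  by rewrite query_env; exact: Qcross.
have := c_prep_spec d tape Y0 Qm' Qc' ef e5 nm.
have fi := @frame_iv R env tape (c_prep R m d) t.
have fr := @frame_rv R env tape (c_prep R m d) t.
move: fi fr; move: (run (c_prep _ _ _) t) => u fi fr [u1 _ _ u4 u5] fc.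
rewrite query_env in u1.
have hi k y : (k < stride)%N -> k != 5%N -> k \notin imods (c_prep R m d) -> iv u k y = iv s k y.
  by move=> kA k5 kn; rewrite fi// e.
have ru : ready u.
  split.
    split; [rewrite hi; [exact: r1|by []..]|rewrite hi; [exact: r2|by []..]|
      rewrite hi; [exact: r3|by []..]|rewrite fi; [exact: e5|by []..]].
  split; last 1 first.
  - move=> l c lL cT; rewrite hi; [|by []..].
    by apply: is_list_ext (bk l c lL cT) => j _; apply: hi.
  - by apply: loaded_ext ld => y; [apply: hi|rewrite fr; [exact: er|by []..]|
      rewrite fr; [exact: er|by []..]].
  - exact: u1.
have := shifts_spec u5 ru; rewrite -/shift_loop in fc *.
move: (run shift_loop u) fc => v fc [v1 v2 v3]; split; [|exact: v2|exact: fc|exact: v3].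
by move: v1 u4 ec; rewrite /prep_cost; clear; lia.
Qed.

End Query.

(** * The complete structure and its guarantee *)

Section LSH.
Variables (R : realType) (m d q a b lam B : nat) (sc r c : R).
Local Notation M := ((2 ^ B)%:R : R).
Implicit Types (P Q : pgon R) (data : seq (pgon R)) (tape : nat -> bool).

Definition lsh : structure R :=
  Structure (c_preproc m d q a b lam B sc) (c_query m d B sc (c * r)).

Definition levels (n : nat) : nat := up_log (2 ^ b) n.
Definition addr_bits (n : nat) : nat := b * levels n.
Definition key_bits (n : nat) : nat := a * levels n.
Definition tables (n : nat) : nat := lam ^ levels n.

Definition mem_bound (n : nat) : nat :=
  (n * m + m + tables n * 2 ^ addr_bits n + tables n * n +
   tables n * key_bits n * (2 * d + 1)).+1.

Definition preproc_bound (n : nat) : nat :=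
  200 + n * 60 + tables n * key_bits n * gen_cost d q (addr_bits n) + n * (prep_cost m d + 10) +
  tables n * (10 + n * (100 + key_bits n * key_cost m B)).

Definition query_bound (n : nat) : nat :=
  40 + prep_cost m d + d.+1 * shift_cost m B (key_bits n) (tables n).

Hypotheses (d0 : (0 < d)%N) (b0 : (0 < b)%N) (lam0 : (0 < lam)%N).
Hypothesis range : forall P sh, (nverts P <= m)%N -> (sh <= d)%N ->
  \sum_(j < d) `|vec d sc P sh j| + 2 <= M.

Section Instance.
Variables (data : seq (pgon R)) (Q : pgon R).
Local Notation n := (size data).
Hypothesis data_ok : forall i, (i < n)%N -> polygon_upto m (nth (pgon0 R) data i).
Hypothesis Q_ok : polygon_upto m Q.

Let data_small i : (i < n)%N -> (nverts (nth (pgon0 R) data i) <= m)%N.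
Proof. by move=> /data_ok[]. Qed.

Let data_cross i k : (i < n)%N -> (k < nverts (nth (pgon0 R) data i))%N ->
  cross (edge (nth (pgon0 R) data i) k) (edge (nth (pgon0 R) data i) k.+1) != 0.
Proof. by move=> /data_ok[[_ _ h _ _] _]; exact: h. Qed.

Let Qm : (nverts Q <= m)%N. Proof. by case: Q_ok. Qed.

Let Qcross k : (k < nverts Q)%N -> cross (edge Q k) (edge Q k.+1) != 0.
Proof. by case: Q_ok => -[_ _ h _ _] _; exact: h. Qed.

Lemma answer_valid tape :
  answer_within lsh data Q (c * r) tape = valid (c * r) data Q (answered lsh data Q tape).
Proof. exact: erefl. Qed.

Lemma brute_case tape : (n <= d)%N ->
  [/\ (exists2 i, (i < n)%N & D2 (nth (pgon0 R) data i) Q <= c * r) ->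
        answer_within lsh data Q (c * r) tape,
    (extra_space lsh data Q tape <= 64 * mem_bound n)%N,
    preproc_time lsh data tape = 3,
    (query_time lsh data Q tape <= 20 + n * 40)%N & coins (answered lsh data Q tape) = 0%N].
Proof.
move=> nd; have bE : built lsh data tape = tick 3 (state0 R).
  by rewrite /built -[preproc _]/(c_preproc m d q a b lam B sc) /c_preproc run_ifi !ievE (ifT _ _ nd).
have f1 : fits (mem_bound n) (tick 5 (reset_clock (tick 3 (state0 R)))).
  exact: isT.
have := @c_brute_spec R (c * r) data Q tape (mem_bound n) (ltn0Sn _) _ f1.
have aE : answered lsh data Q tape = exec (rcons data Q) tape (c_brute (c * r))
    (tick 5 (reset_clock (tick 3 (state0 R)))).
  by rewrite /answered bE -[query _]/(c_query m d B sc (c * r)) /c_query run_ifi ev_nobj ev_nat (ifT _ _ nd).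
rewrite answer_valid /extra_space /query_time /preproc_time bE aE.
move: (exec _ _ _ _) => s [h1 h2 h3 h4]; split; [exact: h1|exact: cells_fits| | |].
- by rewrite clock_tick.
- by apply: leq_trans h2 _; rewrite clock_tick /=; clear; lia.
- by rewrite h4.
Qed.

Lemma reset_view (s : state R) k x :
  (iv (reset_clock s) k x = iv s k x) * (rv (reset_clock s) k x = rv s k x).
Proof. split; exact: erefl. Qed.

(** All clauses hold for each single tape; the last one reduces correctness to the combinatorial
    event whose probability [avg_good_tape] estimates. *)
Lemma hash_case tape : (d < n)%N ->
  [/\ (extra_space lsh data Q tape <= 64 * mem_bound n)%N,
    (preproc_time lsh data tape <= preproc_bound n)%N,
    (query_time lsh data Q tape <= query_bound n)%N,
    coins (answered lsh data Q tape) =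
      (tables n * (key_bits n * hash_coins d q (addr_bits n)))%N &
    forall sh i l, (sh <= d)%N ->
      reachable d q B (addr_bits n) (key_bits n) (tables n) sc (c * r) data Q tape sh i l ->
      (\sum_(l < tables n) count (far_obj (c * r) data Q)
          (qbucket d q B (addr_bits n) (key_bits n) sc data Q tape sh l) < 8 * tables n)%N ->
      answer_within lsh data Q (c * r) tape].
Proof.
move=> dn; set Y := mem_bound n.
have LT : (tables n * 2 ^ addr_bits n <= Y)%N by rewrite /Y /mem_bound; clear; lia.
have Ln : (tables n * n <= Y)%N by rewrite /Y /mem_bound; clear; lia.
have nmY : (n * m + m <= Y)%N by rewrite /Y /mem_bound; clear; lia.
have nmY' : (n * m <= Y)%N by apply: leq_trans nmY; exact: leq_addr.
have LK : (tables n * key_bits n * (2 * d + 1) <= Y)%N by rewrite /Y /mem_bound; clear; lia.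
have rg i : (i < n)%N -> \sum_(j < d) `|vec d sc (nth (pgon0 R) data i) 0 j| + 2 <= M.
  by move=> iN; apply: range; [exact: data_small|].
have := @c_preproc_spec R m d q a b lam B sc data tape Y (ltn0Sn _) d0 b0 dn data_small
  data_cross rg LT Ln nmY' LK.
rewrite answer_valid /extra_space /preproc_time /query_time /answered.
rewrite -[exec data tape _ _]/(built lsh data tape) -[query _]/(c_query m d B sc (c * r)).
move: (built lsh data tape) => s [[_ g1 g2 g3] [[ld _ bk] [cs ts fs]]].
have rgQ sh : (sh <= d)%N -> \sum_(j < d) `|vec d sc Q sh j| + 2 <= M.
  by move=> shd; exact: range.
have e k x : iv (reset_clock s) k x = iv s k x by rewrite reset_view.
have er k x : rv (reset_clock s) k x = rv s k x by rewrite reset_view.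
have f0 : fits Y (reset_clock s) by exact: fs.
have ld' : loaded d q tape (addr_bits n) (tables n * key_bits n) (reset_clock s).
  by apply: loaded_ext ld => x; [exact: e|exact: er|exact: er].
have bk' : bucketed d q B (addr_bits n) (key_bits n) (tables n) sc data tape (fun=> n)
    (reset_clock s).
  move=> l u lL uT; rewrite e; apply: is_list_ext (bk l u lL uT) => j _; exact: e.
have regs : [/\ iv (reset_clock s) 1 0 = (2 ^ addr_bits n)%N, iv (reset_clock s) 2 0 = tables n &
    iv (reset_clock s) 3 0 = key_bits n].
  by split; rewrite e; [exact: g1|exact: g2|exact: g3].
have := c_query_spec (c * r) (ltn0Sn _) d0 Qm nmY Qcross rgQ dn f0 regs ld' bk'.
move: (exec _ _ _ _) => u [u1 u2 u3 u4]; split; [exact: cells_fits|exact: ts| | |exact: u4].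
  exact: u1.
exact: etrans u3 (etrans cs (esym (mulnA _ _ _))).
Qed.

Section Guarantee.
Variables p1 p2 : R.
Hypotheses (p1_01 : 0 < p1 < 1) (p2_01 : 0 < p2 < 1) (r_cr : r <= c * r).
Hypotheses (p2_a : p2 ^+ a <= (2 ^ b)%:R^-1) (p1_lam : 1 <= lam%:R * p1 ^+ a).
Hypothesis near_bits : forall P Q, (nverts P <= m)%N -> (nverts Q <= m)%N -> D2 P Q <= r ->
  exists2 sh, (sh <= d)%N & diff_prob d q M (vec d sc P 0) (vec d sc Q sh) <= 1 - p1.
Hypothesis far_bits : forall P Q sh, (nverts P <= m)%N -> (nverts Q <= m)%N -> (sh <= d)%N ->
  c * r < D2 P Q -> 1 - p2 <= diff_prob d q M (vec d sc P 0) (vec d sc Q sh).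

Lemma diff_prob_le1 (x y : nat -> R) : diff_prob d q M x y <= 1.
Proof.
by rewrite -[leRHS](avg_cst (q.+1 + d)); apply: avg_le => w; rewrite lern1; case: (_ != _).
Qed.

Let X (i : nat) : nat -> R := vec d sc (nth (pgon0 R) data i) 0.

Lemma far_count sh tape :
  (\sum_(l < tables n) count (far_obj (c * r) data Q)
     (qbucket d q B (addr_bits n) (key_bits n) sc data Q tape sh l))%N =
  far_collisions d q (addr_bits n) M (key_bits n) (tables n) n X
    (vec d sc Q sh) (far_obj (c * r) data Q) tape.
Proof.
apply: eq_bigr => l _; rewrite /qbucket /bucket count_filter count_rev -sum1_count.
rewrite -[in iota 0 n](subn0 n) -/(index_iota 0 n) big_mkord big_mkcondr.
by apply: eq_bigr => i _; rewrite /tkey /qkey /X; case: (_ == _).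
Qed.

Let levels_ge : (n <= 2 ^ addr_bits n)%N.
Proof. by rewrite expnM; apply: up_logP; rewrite -{1}(expn0 2) ltn_exp2l. Qed.

Lemma lsh_guaranteed : lsh_guarantee (1 / 4) r c lsh data Q.
Proof.
move=> [i0 i0n near].
have n0 : (0 < n)%N by apply: leq_trans i0n.
have nearc : D2 (nth (pgon0 R) data i0) Q <= c * r by exact: le_trans r_cr.
have [nd|dn] := leqP n d.
  exists 0%N; first by move=> tape; have [_ _ _ _ ->] := brute_case tape nd.
  rewrite coin_prob_avg [avg _ _]/(_%:R).
  have [h _ _ _ _] := brute_case (fun=> false) nd.
  rewrite h; last by exists i0.
  have q4 : 1 / 4 <= 1 :> R by lra.
  exact: q4.
exists (tables n * (key_bits n * hash_coins d q (addr_bits n)))%N.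
  by move=> tape; have [_ _ _ -> _] := hash_case tape dn.
(* This shift is fixed before any coin is considered, and only its collisions are analysed. *)
have [sh shd nearb] := near_bits (data_small i0n) Qm near.
have L0 : (0 < tables n)%N by rewrite expn_gt0 lam0.
have [/andP[p10 p11] /andP[p20 p21]] := (p1_01, p2_01).
(* L and K share the exponent [levels n], so this is a power of the hypothesis [p1_lam]. *)
have Lp1 : 1 <= (tables n)%:R * p1 ^+ key_bits n.
  by rewrite natrX exprM -exprMn exprn_ege1.
have nR : 0 < n%:R :> R by rewrite ltr0n.
have p2K : p2 ^+ key_bits n <= n%:R^-1.
  rewrite exprM; apply: (@le_trans _ _ ((2 ^ b)%:R^-1 ^+ levels n)).
    by apply: lerXn2r => //; rewrite nnegrE ?exprn_ge0 ?invr_ge0 ?ltW.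
  rewrite exprVn -natrX -expnM lef_pV2 ?posrE ?ltr0n ?expn_gt0// ler_nat.
  exact: levels_ge.
have farb i : (i < n)%N -> far_obj (c * r) data Q i ->
    0 <= 1 - diff_prob d q M (X i) (vec d sc Q sh) <= p2.
  move=> iN; rewrite /far_obj -ltNge => fi; rewrite subr_ge0 diff_prob_le1 /=.
  by rewrite lerBlDr -lerBlDl; exact: far_bits (data_small iN) Qm shd fi.
have p1c : 0 <= p1 <= 1 by rewrite !ltW.
have := avg_good_tape (X := X) (i0 := i0) n0 L0 levels_ge p1c Lp1 p2K nearb farb.
rewrite coin_prob_avg => h; apply: le_trans h _; apply: avg_le => w.
rewrite ler_nat; case Eg: (good_tape _ _ _ _ _ _ _ _ _ _ _ w) => //.
move: Eg => /andP[/existsP[l sb] few].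
have [_ _ _ _ ok] := hash_case w dn.
rewrite (ok sh i0 l) //; last by rewrite far_count.
split => //; rewrite mem_filter mem_rev mem_iota add0n i0n !andbT.
apply/eqP; exact: same_bits_key sb.
Qed.

End Guarantee.
End Instance.
End LSH.

(** * Complexity bounds *)

Section Constants.
Variable R : realType.
Implicit Types (P Q : pgon R).

Lemma vec_diff (d : nat) (sc : R) P Q (sh : nat) :
  \sum_(j < d) (vec d sc P 0 j - vec d sc Q sh j) ^+ 2 = sc ^+ 2 * centred_dist2 P Q d sh.
Proof.
by rewrite /centred_dist2 mulr_sumr; apply: eq_bigr => j _; rewrite /vec -mulrBr exprMn.
Qed.

Lemma sample_bound P (m d n : nat) : (nverts P <= m)%N ->
  - (m%:R * pi) <= sample P d n <= (m%:R + 4) * pi.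
Proof.
move=> Pm; have pi0 : (0 : R) <= pi := pi_ge0 R.
have h : (nverts P)%:R * pi <= m%:R * pi :> R by rewrite ler_wpM2r// ler_nat.
rewrite /sample; case: ifP => _.
  by have /andP[h1 h2] := turning_range P (n%:R / d%:R); apply/andP; split; lra.
by have /andP[h1 h2] := turning_range P ((n - d)%N%:R / d%:R); apply/andP; split; lra.
Qed.

Lemma centre_bound P (m d sh j : nat) : (nverts P <= m)%N -> (0 < d)%N ->
  `|centre d (shifted P d sh) j| <= osc_bound R m.
Proof.
move=> Pm d0; have pi0 : (0 : R) <= pi := pi_ge0 R.
have m0 : 0 <= m%:R * pi :> R by rewrite mulr_ge0.
have dR : 0 < d%:R :> R by rewrite ltr0n.
have hs n := sample_bound d n Pm.
have /andP[m1 m2] : - (m%:R * pi) <= mean d (shifted P d sh) <= (m%:R + 4) * pi.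
  rewrite /mean ler_pdivlMr// ler_pdivrMr//; apply/andP; split.
    rewrite mulr_natr -[X in _ *+ X](card_ord d) -sumr_const; apply: ler_sum => i _.
    by have /andP[] := hs (i + sh)%N.
  rewrite mulr_natr -[X in _ *+ X](card_ord d) -sumr_const; apply: ler_sum => i _.
  by have /andP[] := hs (i + sh)%N.
have /andP[s1 s2] := hs (j + sh)%N.
rewrite /centre /shifted ler_norml /osc_bound; apply/andP; split; lra.
Qed.

(** q, a, b, lam and A depend on c only. All that m and r influence is the dimension d, the scaling
    sc and the number B of halving rounds. *)
Lemma lsh_parameters (c : R) : 1 < c ->
  exists (q a b lam : nat) (A : R),
  [/\ (0 < b)%N, (0 < lam)%N, lam%:R <= (2 ^ b)%:R `^ rho c & 0 < A] /\
  forall (m d : nat) (r : R), (3 <= m)%N -> (0 < d)%N -> 0 < r ->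
  A * osc_bound R m ^+ 2 <= d%:R * r ^+ 2 ->
  let B := up_log 2 (3 * d) in
  exists sc : R,
  (forall P sh, (nverts P <= m)%N -> (sh <= d)%N ->
    \sum_(j < d) `|vec d sc P sh j| + 2 <= (2 ^ B)%:R) /\
  forall data Q, (forall i, (i < size data)%N -> polygon_upto m (nth (pgon0 R) data i)) ->
    polygon_upto m Q -> lsh_guarantee (1 / 4) r c (lsh m d q a b lam B sc r c) data Q.
Proof.
move=> c1; have [q [P0 [I [t [s0 [p1 [p2 [k [[qP IP t03 s0_0] [H H']]]]]]]]]] := hash_parameters c1.
move: H H' => [p1_01 p2_01 kc k1 kp] [nearG farG].
have krho : k^-1 < rho c.
  have k0 : 0 < k by apply: lt_trans k1.
  have s1 : 1 < Num.sqrt c by rewrite -[ltLHS]sqrtr1 ltr_sqrt// (lt_trans _ c1).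
  by rewrite /rho ltf_pV2// ?posrE//; lra.
have [a [b [lam [b0 lam0 p2a p1lam lamr]]]] := table_parameters p1_01 p2_01 k1 kp krho.
have /andP[t0 t3] := t03.
have pi0 : (0 : R) < pi := pi_gt0 R.
(* Three demands on d are collected in A: A1 bounds the discretisation error, A2 makes the angles
   small enough for the Gaussian comparison, and s0 keeps the coordinates of [vec] at most 1. *)
pose A1 : R := (1 + t^-1) / t; pose A2 : R := ((2 * I)%:R * pi) ^+ 2 * s0 / t.
have A10 : 0 < A1 by rewrite divr_gt0// addr_gt0// invr_gt0.
have A20 : 0 <= A2 by apply: divr_ge0; [apply: mulr_ge0; [exact: sqr_ge0|exact: ltW]|exact: ltW].
exists q, a, b, lam, (A1 + A2 + s0); split; first by split => //; lra.
move=> m d r m3 d0 r0 big B.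
have dR : 0 < d%:R :> R by rewrite ltr0n.
have Mr : 0 < d%:R * r ^+ 2 by rewrite mulr_gt0// exprn_gt0.
have o0 : 0 < osc_bound R m by rewrite mulr_gt0// addr_gt0// mulr_gt0// ltr0n; lia.
have osc2 : 0 < osc_bound R m ^+ 2 by rewrite exprn_gt0.
(* Rescales the squared near distance d r^2 to s0. *)
pose sc : R := Num.sqrt (s0 / (d%:R * r ^+ 2)).
have sc0 : 0 <= sc by exact: sqrtr_ge0.
have sc2 : sc ^+ 2 = s0 / (d%:R * r ^+ 2) by rewrite sqr_sqrtr// divr_ge0// ltW.
have sc2M : sc ^+ 2 * (d%:R * r ^+ 2) = s0 by rewrite sc2 divfK// gt_eqF.
have le_part X : X <= A1 + A2 + s0 -> X * osc_bound R m ^+ 2 <= d%:R * r ^+ 2.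
  by move=> h; apply: le_trans big; rewrite ler_pM2r.
have near_d : (1 + t^-1) * (osc_bound R m ^+ 2 / d%:R) <= t * r ^+ 2.
  have h : A1 * osc_bound R m ^+ 2 <= d%:R * r ^+ 2 by apply: le_part; lra.
  rewrite mulrA ler_pdivrMr// -mulrA -ler_pdivrMl// mulrA (mulrC t^-1).
  by rewrite [X in _ <= X]mulrC.
have sc_osc2 X : 0 <= X -> X <= A1 + A2 + s0 -> X / s0 * (sc * osc_bound R m) ^+ 2 <= 1.
  move=> X0 hX; rewrite exprMn sc2.
  have cancel (x y u o : R) : y != 0 -> u != 0 -> x / y * (y / u * o) = x * o / u.
    by move=> *; field; apply/andP.
  rewrite cancel ?(lt0r_neq0 s0_0) ?(lt0r_neq0 Mr)// ler_pdivrMr// mul1r.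
  exact: le_part.
have sc_osc : sc * osc_bound R m <= 1.
  have h : s0 / s0 * (sc * osc_bound R m) ^+ 2 <= 1 by apply: sc_osc2; [exact: ltW|lra].
  rewrite -(@expr_le1 _ 2)//; last by rewrite mulr_ge0// ltW.
  by move: h; rewrite divff ?lt0r_neq0// mul1r.
have a_small P Q sh j : (nverts P <= m)%N -> (nverts Q <= m)%N ->
    (2 * I)%:R ^+ 2 * (pi * (vec d sc P 0 j - vec d sc Q sh j)) ^+ 2 <= t.
  move=> Pm Qm; rewrite /vec -mulrBr; set D := _ - _.
  have hD : (sc * D) ^+ 2 <= (sc * osc_bound R m) ^+ 2.
    rewrite !(exprMn _ sc); apply: ler_wpM2l; first exact: sqr_ge0.
    rewrite -[D ^+ 2]real_normK ?num_real//.
    apply: lerXn2r; rewrite ?nnegrE; [exact: normr_ge0|exact: ltW|].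
    exact: (centred_diff_bound sh j Pm Qm (ltn_trans (ltn0Sn 1) m3) d0).
  have h : A2 / s0 * (sc * osc_bound R m) ^+ 2 <= 1 by apply: sc_osc2; [exact: A20|lra].
  rewrite exprMn mulrA -exprMn; apply: le_trans (ler_wpM2l (sqr_ge0 _) hD) _.
  rewrite (_ : A2 / s0 = ((2 * I)%:R * pi) ^+ 2 / t) in h; last first.
    rewrite /A2; move: (lt0r_neq0 s0_0) (lt0r_neq0 t0); clear.
    by move: (_ ^+ 2) => u *; field; apply/andP.
  by move: h; rewrite mulrAC ler_pdivrMr// mul1r.
have range : forall P sh, (nverts P <= m)%N -> (sh <= d)%N ->
    \sum_(j < d) `|vec d sc P sh j| + 2 <= (2 ^ B)%:R :> R.
  move=> P sh Pm _; have h1 : d%:R + 2 <= (2 ^ B)%:R :> R.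
    rewrite -natrD ler_nat; apply: (@leq_trans (3 * d)); first by clear -d0; lia.
    exact: up_logP.
  apply: le_trans h1; rewrite lerD2r.
  rewrite -[d in leRHS]card_ord -sumr_const; apply: ler_sum => j _.
  rewrite /vec normrM ger0_norm//; apply: le_trans sc_osc.
  by rewrite ler_wpM2l// centre_bound.
exists sc; split; first exact: range.
move=> data Q data_ok Q_ok.
have rangeM P sh : (nverts P <= m)%N -> (sh <= d)%N ->
    \sum_(j < d) `|vec d sc P sh j| <= (2 ^ B)%:R :> R.
  move=> Pm shd; apply: le_trans (range P sh Pm shd); rewrite lerDl; exact: ler0n.
have t01 : 0 <= t <= 1 by rewrite (ltW t0) (le_trans t3)//; clear; lra.
apply: (@lsh_guaranteed R m d q a b lam B sc r c d0 b0 lam0 range data Q data_ok Q_ok p1 p2 p1_01 p2_01 _ p2a p1lam).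
- by rewrite ler_peMl// ltW.
- move=> P P' Pm Pm' near.
  have [sh shd h] := near_centred Pm Pm' d0 r0 t03 near_d near.
  exists sh => //.
  have := @diff_prob_le R d q (2 ^ B)%:R P0 I t (vec d sc P 0) (vec d sc P' sh) qP IP t01
    (fun j _ => a_small P P' sh j Pm Pm') (rangeM _ _ Pm (leq0n d)) (rangeM _ _ Pm' shd).
  move/le_trans; apply; apply: nearG.
  by rewrite vec_diff -sc2M mulrCA ler_wpM2l ?sqr_ge0.
- move=> P P' sh Pm Pm' shd far.
  have h := far_centred Pm Pm' d0 r0 c1 t03 near_d far shd.
  have := @diff_prob_ge R d q (2 ^ B)%:R P0 I t (vec d sc P 0) (vec d sc P' sh) qP IP t01
    (fun j _ => a_small P P' sh j Pm Pm') (rangeM _ _ Pm (leq0n d)) (rangeM _ _ Pm' shd).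
  apply: le_trans; apply: farG.
  by rewrite vec_diff -sc2M mulrCA [leRHS]mulrCA ler_wpM2l ?sqr_ge0.
Qed.

End Constants.

(** * Costs as monomials in W, l = 1 + ln n, x = n^rho and nu = n_rc *)

Section CostBounds.
Variables (R : realType) (m d q B n L K nb T : nat) (x l nu W : R).
Local Notation M := ((m + 2)%:R : R).
Hypotheses (n1 : (0 < n)%N) (d1 : (0 < d)%N).
Hypotheses (W1 : 1 <= W) (l1 : 1 <= l) (x1 : 1 <= x) (xn : x <= n%:R).
Hypotheses (LW : L%:R <= W * x) (TW : T%:R <= W * n%:R).
Hypotheses (KW : K%:R <= W * l) (nbW : nb%:R <= W * l) (BW : (d < n)%N -> B%:R <= W * l)
  (qW : q%:R <= W).
Hypotheses (MW : M <= W * nu) (dMW : d%:R * M <= W * nu).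

Let y : R := W * nu.
Let mM : m%:R <= M. Proof. by rewrite ler_nat leq_addr. Qed.
Let M1 : 1 <= M. Proof. by rewrite ler1n addn2. Qed.
Let n1R : 1 <= n%:R :> R. Proof. by rewrite ler1n. Qed.
Let d1R : 1 <= d%:R :> R. Proof. by rewrite ler1n. Qed.
Let y1 : 1 <= y. Proof. exact: le_trans M1 MW. Qed.
Let dy : d%:R <= y. Proof. by apply: le_trans dMW; rewrite ler_peMr. Qed.
Let mdy : m%:R * d%:R <= y.
Proof. by apply: le_trans dMW; rewrite mulrC ler_wpM2l. Qed.
Let nu0 : 0 <= nu.
Proof. by have := le_trans ler01 y1; rewrite pmulr_rge0// (lt_le_trans ltr01). Qed.

Let ge0 (z : R) : 1 <= z -> 0 <= z. Proof. exact: le_trans ler01. Qed.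

Let scale_le (u k v : R) : 0 <= u -> 1 <= k -> v = u * k -> u <= v.
Proof. by move=> u0 k1 ->; rewrite ler_peMr. Qed.

Ltac pos := repeat first [exact: ler0n | exact: ge0 | exact: nu0 | apply: mulr_ge0 | apply: exprn_ge0].
Ltac one := repeat first [exact: W1 | exact: l1 | exact: x1 | exact: M1 | exact: n1R | exact: y1 |
  apply: mulr_ege1 | apply: exprn_ege1].
(* [up k]: the goal u <= v holds since v = u * k, with k a product of factors >= 1. *)
Ltac up k := apply: (@scale_le _ k); [by pos|by one|by rewrite /y; ring].
Ltac prod := repeat apply: ler_pM; try by pos.

(** All factors are at least 1, so every summand can be padded to a common monomial. The same factor
    W^5 l^2 is used for space, preprocessing and query; l^2 arises in time from K times B or the
    number of address bits. *)
Lemma space_le : (64 * (n * m + m + L * T + L * n + L * K * (2 * d + 1)).+1)%:R <=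
  1000 * (W ^+ 5 * l ^+ 2) * (x * (n%:R * M) + nu * (n%:R * M)).
Proof.
set Z := W ^+ 5 * l ^+ 2; set t1 := x * (n%:R * M); set t2 := nu * (n%:R * M).
have h1 : 1 <= Z * t1 by rewrite /Z /t1; one.
have h2 : n%:R * m%:R <= Z * t1.
  apply: (@le_trans _ _ (n%:R * M)); first by rewrite ler_wpM2l.
  by rewrite /Z /t1; up (W ^+ 5 * l ^+ 2 * x).
have h3 : m%:R <= Z * t1.
  by apply: le_trans mM _; rewrite /Z /t1; up (W ^+ 5 * l ^+ 2 * x * n%:R).
have h4 : L%:R * T%:R <= Z * t1.
  apply: (@le_trans _ _ (W * x * (W * n%:R))); first by prod.
  by rewrite /Z /t1; up (W ^+ 3 * l ^+ 2 * M).
have h5 : L%:R * n%:R <= Z * t1.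
  apply: (@le_trans _ _ (W * x * n%:R)); first by prod.
  by rewrite /Z /t1; up (W ^+ 4 * l ^+ 2 * M).
have h6 : L%:R * K%:R * d%:R <= Z * t2.
  apply: (@le_trans _ _ (W * n%:R * (W * l) * (W * nu))).
    by prod; apply: le_trans LW _; rewrite ler_wpM2l//; apply: ge0.
  by rewrite /Z /t2; up (W ^+ 2 * l * M).
have h7 : L%:R * K%:R <= L%:R * K%:R * d%:R :> R by rewrite ler_peMr// mulr_ge0.
rewrite natrM -[(_ + _).+1%:R]natr1 !(natrD, natrM).
move: h1 h2 h3 h4 h5 h6 h7.
have t1_ge : 0 <= t1 by rewrite /t1; pos.
have t2_ge : 0 <= t2 by rewrite /t2; pos.
have Z0 : 0 <= Z by rewrite /Z; pos.
rewrite mulrDr -!(mulrA 1000).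
have : 0 <= Z * t1 by exact: mulr_ge0.
have : 0 <= Z * t2 by exact: mulr_ge0.
lra.
Qed.
Lemma brute_query_le : (n <= d)%N ->
  (20 + n * 40)%:R <= 1000 * (W ^+ 5 * l ^+ 2) * (nu * M * x).
Proof.
move=> nd; set Z := W ^+ 5 * l ^+ 2; set t := nu * M * x.
have h : n%:R <= Z * t.
  apply: (@le_trans _ _ (W * nu)); first by apply: le_trans dy; rewrite ler_nat.
  by rewrite /Z /t; up (W ^+ 4 * l ^+ 2 * M * x).
have Zt : 1 <= Z * t by apply: le_trans h.
rewrite natrD natrM -mulrA; move: h Zt; move: (Z * t) => u; lra.
Qed.

Lemma preproc_le : (d < n)%N ->
  (200 + n * 60 + L * K * gen_cost d q nb + n * (prep_cost m d + 10) +
    L * (10 + n * (100 + K * key_cost m B)))%:R <=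
  40 * 100 * (W ^+ 5 * l ^+ 2) * (nu * (n%:R * M * x)).
Proof.
move=> dn; have BW' := BW dn; rewrite /gen_cost /prep_cost /key_cost.
set Z := W ^+ 5 * l ^+ 2; set t := nu * _.
have E : Z * t = W ^+ 4 * l ^+ 2 * (n%:R * M * x) * y by rewrite /Z /t /y; ring.
have [v Ev] : exists v, v = Z * t by eexists.
rewrite -Ev in E.
have h1 : 1 <= v by rewrite E; one.
have h2 : n%:R <= v by rewrite E; up (W ^+ 4 * l ^+ 2 * M * x * y).
have h3 : L%:R * K%:R <= v.
  apply: (@le_trans _ _ (W * x * (W * l))); first by prod.
  by rewrite E; up (W ^+ 2 * l * (n%:R * M) * y).
have h4 : L%:R * K%:R * nb%:R <= v.
  apply: (@le_trans _ _ (W * x * (W * l) * (W * l))); first by prod.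
  by rewrite E; up (W * (n%:R * M) * y).
have h5 : L%:R * K%:R * q%:R <= v.
  apply: (@le_trans _ _ (W * x * (W * l) * W)); first by prod.
  by rewrite E; up (W * l * (n%:R * M) * y).
have h6 : L%:R * K%:R * d%:R <= v.
  apply: (@le_trans _ _ (W * x * (W * l) * y)); first by prod.
  by rewrite E; up (W ^+ 2 * l * (n%:R * M)).
have h7 : n%:R * m%:R <= v.
  apply: (@le_trans _ _ (n%:R * M)); first by prod.
  by rewrite E; up (W ^+ 4 * l ^+ 2 * x * y).
have h8 : n%:R * (m%:R * d%:R) <= v.
  apply: (@le_trans _ _ (n%:R * y)); first by apply: ler_wpM2l.
  by rewrite E; up (W ^+ 4 * l ^+ 2 * x * M).
have h9 : L%:R <= v.
  by apply: le_trans LW _; rewrite E; up (W ^+ 3 * l ^+ 2 * (n%:R * M) * y).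
have h10 : L%:R * n%:R <= v.
  apply: (@le_trans _ _ (W * x * n%:R)); first by prod.
  by rewrite E; up (W ^+ 3 * l ^+ 2 * M * y).
have h11 : L%:R * n%:R * K%:R <= v.
  apply: (@le_trans _ _ (W * x * n%:R * (W * l))); first by prod.
  by rewrite E; up (W ^+ 2 * l * M * y).
have h12 : L%:R * n%:R * K%:R * m%:R <= v.
  apply: (@le_trans _ _ (W * x * n%:R * (W * l) * M)); first by prod.
  by rewrite E; up (W ^+ 2 * l * y).
have h13 : L%:R * n%:R * K%:R * B%:R <= v.
  apply: (@le_trans _ _ (W * x * n%:R * (W * l) * (W * l))); first by prod.
  by rewrite E; up (W * M * y).
move: h1 h2 h3 h4 h5 h6 h7 h8 h9 h10 h11 h12 h13.
rewrite -[q.+1]addn1 -[d.+1]addn1 !(natrD, natrM) -(mulrA (40 * 100)) -Ev.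
lra.
Qed.

Lemma query_le : (d < n)%N ->
  (40 + prep_cost m d + d.+1 * shift_cost m B K L)%:R <=
  200 * 100 * (W ^+ 5 * l ^+ 2) * (nu * M * x).
Proof.
move=> dn; have BW' := BW dn; rewrite /shift_cost /prep_cost /key_cost.
set Z := W ^+ 5 * l ^+ 2; set t := nu * _ * _.
have E : Z * t = W ^+ 4 * l ^+ 2 * (M * x) * y by rewrite /Z /t /y; ring.
have [v Ev] : exists v, v = Z * t by eexists.
rewrite -Ev in E.
have h1 : 1 <= v by rewrite E; one.
have h2 : m%:R <= v by apply: le_trans mM _; rewrite E; up (W ^+ 4 * l ^+ 2 * x * y).
have h3 : m%:R * d%:R <= v by apply: le_trans mdy _; rewrite E; up (W ^+ 4 * l ^+ 2 * (M * x)).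
have h4 : d%:R <= v by apply: le_trans dy _; rewrite E; up (W ^+ 4 * l ^+ 2 * (M * x)).
have h5 : d%:R * L%:R <= v.
  apply: (@le_trans _ _ (y * (W * x))); first by prod.
  by rewrite E; up (W ^+ 3 * l ^+ 2 * M).
have h6 : d%:R * L%:R * K%:R <= v.
  apply: (@le_trans _ _ (y * (W * x) * (W * l))); first by prod.
  by rewrite E; up (W ^+ 2 * l * M).
have h7 : m%:R * d%:R * L%:R * K%:R <= v.
  apply: (@le_trans _ _ (y * (W * x) * (W * l))).
    by apply: ler_pM => //; apply: ler_pM => //; pos.
  by rewrite E; up (W ^+ 2 * l * M).
have h8 : d%:R * L%:R * K%:R * B%:R <= v.
  apply: (@le_trans _ _ (y * (W * x) * (W * l) * (W * l))); first by prod.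
  by rewrite E; up (W * M).
have h9 : L%:R <= d%:R * L%:R :> R by rewrite ler_peMl.
have h10 : L%:R * K%:R <= d%:R * L%:R * K%:R :> R by rewrite ler_wpM2r// ler_peMl.
have h11 : L%:R * K%:R * m%:R <= m%:R * d%:R * L%:R * K%:R :> R.
  by rewrite mulrC mulrA !ler_wpM2r// ler_peMr.
have h12 : L%:R * K%:R * B%:R <= d%:R * L%:R * K%:R * B%:R :> R.
  by rewrite !ler_wpM2r// ler_peMl.
move: h1 h2 h3 h4 h5 h6 h7 h8 h9 h10 h11 h12.
rewrite -[d.+1]addn1 !(natrD, natrM) -(mulrA (200 * 100)) -Ev.
lra.
Qed.

End CostBounds.

(** * Factors of order n^o(1), and rounding *)

Section Growth.
Variable R : realType.

Lemma inv_ln_cvg : (ln (N%:R : R))^-1 @[N --> \oo] --> (0 : R).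
Proof.
apply/cvgrPdist_lt => e e0; near=> N.
have N1 : expR e^-1 < N%:R :> R by near: N; exact: nbhs_infty_gtr.
have N0 : 0 < N%:R :> R by apply: lt_trans N1; exact: expR_gt0.
have lnN : e^-1 < ln (N%:R : R) by rewrite -ltr_expR lnK// posrE.
have lnN0 : 0 < ln (N%:R : R) by apply: lt_trans lnN; rewrite invr_gt0.
by rewrite sub0r normrN gtr0_norm ?invr_gt0// invf_plt// posrE.
Unshelve. all: by end_near. Qed.

(* A power N^eps with eps -> 0 absorbs constants and powers of ln N:
   N^eps = C expR (4 sqrt (1 + ln N)) for the exponent chosen here. *)
Lemma polylog_exponent (C : R) : 0 < C ->
  exists2 eps : nat -> R, eps @ \oo --> (0 : R) &
  forall N : nat, (1 < N)%N -> C * (1 + ln (N%:R : R)) ^+ 2 <= N%:R `^ eps N.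
Proof.
move=> C0; pose z (N : nat) : R := (ln N%:R)^-1.
exists (fun N => ln C * z N + 4 * Num.sqrt (z N + z N * z N)).
  have zc : z @ \oo --> (0 : R) by exact: inv_ln_cvg.
  have -> : (0 : R) = ln C * 0 + 4 * Num.sqrt (0 + 0 * 0).
    by rewrite !mulr0 addr0 sqrtr0 mulr0 addr0.
  apply: cvgD; first exact: cvgMr.
  apply: cvgMr; apply: (continuous_cvg _ (h := Num.sqrt)); first exact: sqrt_continuous.
  by apply: cvgD => //; exact: cvgM.
move=> N N1; have NR : 1 < N%:R :> R by rewrite ltr1n.
have y0 : 0 < ln (N%:R : R) by rewrite ln_gt0.
rewrite -[X in X `^ _]lnK ?posrE ?(lt_trans _ NR)// -expRM /z.
set y := ln _ in y0 *.
have -> : y * (ln C * y^-1 + 4 * Num.sqrt (y^-1 + y^-1 * y^-1)) = ln C + Num.sqrt (1 + y) *+ 4.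
  have -> : Num.sqrt (y^-1 + y^-1 * y^-1) = Num.sqrt (1 + y) * y^-1.
    rewrite -[y^-1 in RHS](ger0_norm (x := y^-1)) ?invr_ge0 1?ltW// -sqrtr_sqr -sqrtrM ?addr_ge0// 1?ltW//.
    by congr Num.sqrt; field; rewrite gt_eqF.
  by rewrite -mulr_natr; field; rewrite gt_eqF.
rewrite expRD lnK// ler_pM2l// -mulr_natl expRM_natl.
have s0 : 0 <= Num.sqrt (1 + y) by exact: sqrtr_ge0.
have sE : Num.sqrt (1 + y) ^+ 2 = 1 + y by rewrite sqr_sqrtr// addr_ge0// ltW.
(* Its fourth power gives (1 + y)^2 <= expR (4 sqrt (1 + y)). *)
have es : Num.sqrt (1 + y) <= expR (Num.sqrt (1 + y)).
  by apply: le_trans (expR_ge1Dx _); rewrite lerDr.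
rewrite -[in leLHS]sE -exprM; apply: lerXn2r => //; rewrite nnegrE//; exact: expR_ge0.
Qed.

Lemma up_log_pow_le (p n : nat) : (1 < p)%N -> (0 < n)%N -> (p ^ up_log p n <= p * n)%N.
Proof.
move=> p1 n0; have [n1|n1] := ltnP 1 n; last first.
  by rewrite (_ : n = 1)%N ?up_log1 ?muln1 ?expn0 ?(ltnW p1)//; apply/eqP; rewrite eqn_leq n1.
have := up_log_gtn p1 n1; case: (up_log p n) => [|u] /= h; first by rewrite expn0 muln_gt0 (ltnW p1).
by rewrite expnS leq_mul2l ltnW ?orbT.
Qed.

Lemma up_log_le_ln (p n : nat) : (1 < p)%N -> (0 < n)%N ->
  (up_log p n)%:R <= (1 + (ln p%:R)^-1) * (1 + ln (n%:R : R)).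
Proof.
move=> p1 n0; have pR : 1 < p%:R :> R by rewrite ltr1n.
have lp : 0 < ln (p%:R : R) by rewrite ln_gt0.
have p0 : 0 < p%:R :> R by exact: lt_trans pR.
have nR : 0 < n%:R :> R by rewrite ltr0n.
have ln0 : 0 <= ln (n%:R : R) by rewrite ln_ge0// ler1n.
have : (up_log p n)%:R * ln (p%:R : R) <= ln p%:R + ln n%:R.
  rewrite -lnM ?posrE// mulr_natl -lnXn// ler_ln ?posrE ?mulr_gt0 ?exprn_gt0//.
  rewrite -natrX -natrM ler_nat.
  exact: up_log_pow_le.
rewrite -ler_pdivlMr// mulrDl divff ?gt_eqF// => h; apply: le_trans h _.
rewrite mulrDl mul1r mulrDr mulr1 mulrC addrCA -addrA.
have : 0 <= (ln (p%:R : R))^-1 by rewrite invr_ge0 ltW.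
lra.
Qed.

(** As (2^b)^U <= 2^b n and lam <= (2^b)^e, the common exponent makes rounding cost only a constant
    factor in T and in L. The constant W precedes d, and ln d is paid for by l since d < n. *)
Lemma hash_sizes (a b lam : nat) (e : R) : (0 < b)%N -> 0 < e <= 1 ->
  lam%:R <= (2 ^ b)%:R `^ e ->
  exists2 W : R, 1 <= W & forall n, (0 < n)%N -> let l : R := 1 + ln n%:R in
  [/\ (tables b lam n)%:R <= W * n%:R `^ e, (2 ^ addr_bits b n)%:R <= W * n%:R,
    (key_bits a b n)%:R <= W * l, (addr_bits b n)%:R <= W * l &
    forall d, (0 < d)%N -> (d < n)%N -> (up_log 2 (3 * d))%:R <= W * l].
Proof.
move=> b0 /andP[e0 e1] lamb.
have b1 : (1 < 2 ^ b)%N by rewrite -{1}(expn0 2) ltn_exp2l.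
pose w : R := 1 + (ln (2 ^ b)%:R)^-1; pose w2 : R := 1 + (ln 2%:R)^-1.
have w0 : 0 <= w by rewrite addr_ge0// invr_ge0 ln_ge0// ler1n ltnW.
have w20 : 0 <= w2 by rewrite addr_ge0// invr_ge0 ln_ge0// ler1n.
have l30 : 0 <= ln (3 : R) by rewrite ln_ge0// ler1n.
have aw : 0 <= a%:R * w by exact: mulr_ge0.
have bw : 0 <= b%:R * w by exact: mulr_ge0.
have w3 : 0 <= w2 * (1 + ln 3) by rewrite mulr_ge0// addr_ge0.
have c0 : 0 <= (2 ^ b)%:R :> R by exact: ler0n.
pose W : R := 1 + (2 ^ b)%:R + (a%:R * w + b%:R * w) + w2 * (1 + ln 3).
exists W; first by rewrite /W -!addrA lerDl !addr_ge0.
move=> n n0 l; have nR : 0 < n%:R :> R by rewrite ltr0n.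
have ln0 : 0 <= ln (n%:R : R) by rewrite ln_ge0// ler1n.
have l0 : 0 <= l by rewrite addr_ge0.
have ul : (levels b n)%:R <= w * l by exact: up_log_le_ln.
have Wl (v : R) : v <= W -> v * l <= W * l by move=> h; rewrite ler_wpM2r.
split.
- rewrite /tables natrX; apply: (@le_trans _ _ (((2 ^ b)%:R * n%:R) `^ e)).
    apply: (@le_trans _ _ (((2 ^ b)%:R `^ e) ^+ levels b n)).
      by apply: lerXn2r; rewrite ?nnegrE// powR_ge0.
    rewrite -powR_mulrn ?powR_ge0// -powRrM mulrC powRrM powR_mulrn//.
    apply: ge0_ler_powR; rewrite ?nnegrE ?exprn_ge0 ?mulr_ge0//; first exact: ltW.
    by rewrite -natrX -natrM ler_nat up_log_pow_le.
  rewrite powRM// ler_wpM2r ?powR_ge0//; apply: (@le_trans _ _ (2 ^ b)%:R).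
    rewrite -[leRHS]powRr1//; apply: ler_powR => //; by rewrite ler1n ltnW.
  by rewrite /W; lra.
- rewrite /addr_bits expnM; apply: (@le_trans _ _ ((2 ^ b)%:R * n%:R)).
    by rewrite -natrM ler_nat up_log_pow_le.
  by rewrite ler_wpM2r// /W; lra.
- rewrite /key_bits natrM; apply: (@le_trans _ _ (a%:R * w * l)); last by apply: Wl; rewrite /W; lra.
  by rewrite -mulrA ler_wpM2l.
- rewrite /addr_bits natrM; apply: (@le_trans _ _ (b%:R * w * l)); last by apply: Wl; rewrite /W; lra.
  by rewrite -mulrA ler_wpM2l.
move=> d d0 dn; apply: (@le_trans _ _ (w2 * (1 + ln 3) * l)); last by apply: Wl; rewrite /W; lra.
have d3 : (0 < 3 * d)%N by rewrite muln_gt0.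
have := @up_log_le_ln 2 (3 * d) isT d3; rewrite -/w2 => h; apply: le_trans h _.
rewrite -mulrA ler_wpM2l// natrM lnM ?posrE ?ltr0n//.
have : ln (d%:R : R) <= ln n%:R by rewrite ler_ln ?posrE ?ltr0n// ler_nat ltnW.
have : 0 <= ln (3 : R) * ln n%:R by exact: mulr_ge0.
rewrite /l; lra.
Qed.

End Growth.

Section Dimension.
Variable R : realType.

Lemma omega_ge (m : nat) : (m%:R + 5) / 2 * pi <= omega R m.
Proof.
have pi0 : (0 : R) <= pi := pi_ge0 R.
have h : m%:R + 1 <= (2 * (m %/ 2) + 2)%N%:R :> R.
  by rewrite -[1]/(1%:R) -natrD ler_nat; have := ltn_pmod m (ltn0Sn 1); have := divn_eq m 2; lia.
have := ler_wpM2r pi0 h; rewrite /omega /lambda_; move: (_%N%:R * pi) => u; lra.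
Qed.

(** Below the trivial bound on distances r is at most 4 omega, so n_rc is at least of order m + 2
    and can also pay for rounding d up to a positive integer. *)
Lemma dimension (c A : R) : 1 < c -> 0 < A ->
  exists2 V : R, 1 <= V & forall (m : nat) (r : R), 0 < r -> c * r < (2 * m%:R + 6) * pi ->
  exists d : nat, [/\ (0 < d)%N, A * osc_bound R m ^+ 2 <= d%:R * r ^+ 2,
    (m + 2)%:R <= V * n_rc m r c & d%:R * (m + 2)%:R <= V * n_rc m r c].
Proof.
move=> c1 A0; have pi0 : (0 : R) < pi := pi_gt0 R.
have s0 : 0 < Num.sqrt c - 1.
  by rewrite subr_gt0 -[ltLHS]sqrtr1 ltr_sqrt// (lt_trans _ c1).
(* In the proof 50 = 400 / 8 and 2 = 16 / 8: these come from osc_bound^2 <= 400 omega^2 and r^2 <=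
   16 omega^2 against the factor 8 of [n_rc]. The summand 1 gives 1 <= V. *)
exists (1 + 2 * (Num.sqrt c - 1) + 50 * A * (Num.sqrt c - 1)).
  by rewrite -addrA lerDl addr_ge0// !mulr_ge0// ltW.
move=> m r r0 rc; rewrite /n_rc; set s := Num.sqrt c - 1 in s0 *.
have om := omega_ge m; set w := omega R m in om *.
have r2 : 0 < r ^+ 2 by rewrite exprn_gt0.
have m0 : 0 <= m%:R :> R by exact: ler0n.
have mp : 0 <= m%:R * pi :> R by rewrite mulr_ge0// ltW.
have osc_w : osc_bound R m <= 20 * w by rewrite /osc_bound; lra.
have rw : r <= 4 * w.
  have : r <= c * r by rewrite ler_peMl// ltW.
  lra.
have w0 : 0 < w by lra.
have osc0 : 0 <= osc_bound R m by rewrite /osc_bound; lra.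
have osc2 : osc_bound R m ^+ 2 <= 400 * w ^+ 2.
  have -> : 400 * w ^+ 2 = (20 * w) ^+ 2 by ring.
  by apply: lerXn2r; rewrite ?nnegrE// mulr_ge0// ltW.
have rw2 : r ^+ 2 <= 16 * w ^+ 2.
  have -> : 16 * w ^+ 2 = (4 * w) ^+ 2 by ring.
  by apply: lerXn2r; rewrite ?nnegrE ?mulr_ge0// ltW.
have M0 : 0 < (m + 2)%:R :> R by rewrite ltr0n addn2.
set M := (m + 2)%:R in M0 *.
set g := 8 * M * w ^+ 2 / (s * r ^+ 2).
have gE : s * g * r ^+ 2 = 8 * M * w ^+ 2.
  by rewrite /g; field; rewrite !gt_eqF.
have g0 : 0 <= g by rewrite divr_ge0// ?mulr_ge0// ?sqr_ge0// ltW.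
have sg0 : 0 <= s * g by rewrite mulr_ge0// ltW.
have Mg : M <= 2 * (s * g).
  rewrite -(ler_pM2r r2) -mulrA gE; apply: (@le_trans _ _ (M * (16 * w ^+ 2))).
    by rewrite ler_pM2l.
  by rewrite le_eqVlt; apply/orP; left; apply/eqP; ring.
pose e := A * osc_bound R m ^+ 2 / r ^+ 2.
have e0 : 0 <= e by rewrite divr_ge0// ?mulr_ge0// ?sqr_ge0// ltW.
have eM : e * M <= 50 * A * (s * g).
  rewrite -(ler_pM2r r2) -[leRHS]mulrA gE mulrAC divfK ?gt_eqF//.
  apply: (@le_trans _ _ (A * (400 * w ^+ 2) * M)).
    by rewrite ler_pM2r// ler_pM2l.
  by rewrite le_eqVlt; apply/orP; left; apply/eqP; ring.
have Ag : 0 <= A * (s * g) by rewrite mulr_ge0// ltW.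
have VE : (1 + 2 * s + 50 * A * s) * g = g + 2 * (s * g) + 50 * A * (s * g) by ring.
rewrite VE; exists (Num.truncn e).+1; split => //.
- by rewrite -ler_pdivrMr// ltW// truncnS_gt.
- by lra.
- rewrite -natr1 mulrDl mul1r; have : (Num.truncn e)%:R * M <= e * M.
    by rewrite ler_pM2r// truncn_le.
  lra.
Qed.

End Dimension.

Section Assembly.
Variable R : realType.

Lemma rho_bounds (c : R) : 1 < c -> 0 < rho c <= 1.
Proof.
move=> c1; have s1 : 1 < Num.sqrt c by rewrite -[ltLHS]sqrtr1 ltr_sqrt// (lt_trans _ c1).
by rewrite /rho invr_gt0 invf_le1; [apply/andP; split|]; lra.
Qed.

Lemma n_rc_ge0 (m : nat) (r c : R) : 1 < c -> 0 <= n_rc m r c.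
Proof.
move=> c1; have s0 : 0 <= Num.sqrt c - 1.
  by rewrite subr_ge0 -[leLHS]sqrtr1 ler_wsqrtr// ltW.
rewrite /n_rc; apply: divr_ge0; apply: mulr_ge0; [|exact: sqr_ge0|exact: s0|exact: sqr_ge0].
exact: mulr_ge0.
Qed.

(** The empty program answers object 0, the initial content of cell 0, at no cost. *)
Lemma trivial_answer (m : nat) (r c : R) data (q : pgon R) :
  (0 < size data)%N -> polygon_upto m (nth (pgon0 R) data 0) -> polygon_upto m q ->
  (2 * m%:R + 6) * pi <= c * r ->
  lsh_guarantee (1 / 4) r c (Structure (Skip R) (Skip R)) data q.
Proof.
move=> n0 [_ P0m] [_ qm] far _; exists 0%N; first by [].
have h : answer_within (Structure (Skip R) (Skip R)) data q (c * r) (fun=> false).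
  by apply/andP; split; [exact: n0|exact: le_trans (D2_le P0m qm) far].
rewrite coin_prob_avg [avg _ _]/(_%:R) h.
by have q4 : 1 / 4 <= 1 :> R by lra.
Qed.

Section Costs.
Variables (m d q a b lam B : nat) (sc r c W : R) (data : seq (pgon R)) (Q : pgon R).
Local Notation n := (size data).
Local Notation N := (n * (m + 2))%N.
Local Notation S := (lsh m d q a b lam B sc r c).
Hypotheses (c1 : 1 < c) (d0 : (0 < d)%N) (b0 : (0 < b)%N) (n0 : (0 < n)%N).
Hypothesis range : forall P sh, (nverts P <= m)%N -> (sh <= d)%N ->
  \sum_(j < d) `|vec d sc P sh j| + 2 <= (2 ^ B)%:R :> R.
Hypothesis data_ok : forall i, (i < n)%N -> polygon_upto m (nth (pgon0 R) data i).
Hypothesis Q_ok : polygon_upto m Q.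
Let l : R := 1 + ln n%:R.
Hypotheses (W1 : 1 <= W) (LW : (tables b lam n)%:R <= W * n%:R `^ rho c)
  (TW : (2 ^ addr_bits b n)%:R <= W * n%:R) (KW : (key_bits a b n)%:R <= W * l)
  (nbW : (addr_bits b n)%:R <= W * l) (BW : (d < n)%N -> B%:R <= W * l) (qW : q%:R <= W).
Hypotheses (MW : (m + 2)%:R <= W * n_rc m r c) (dMW : d%:R * (m + 2)%:R <= W * n_rc m r c).
Variable E : R.
Hypothesis EW : 200 * 100 * W ^+ 5 * l ^+ 2 <= E.

Let n1R : 1 <= n%:R :> R. Proof. by rewrite ler1n. Qed.
Let l1 : 1 <= l. Proof. by rewrite lerDl ln_ge0. Qed.
Let x1 : 1 <= n%:R `^ rho c :> R.
Proof.
by have /andP[r1 _] := rho_bounds c1; rewrite -[leLHS](powRr0 n%:R); apply: ler_powR => //; exact: ltW.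
Qed.
Let xn : n%:R `^ rho c <= n%:R :> R.
Proof.
by have /andP[_ r1] := rho_bounds c1; rewrite -[leRHS]powRr1//; apply: ler_powR.
Qed.

Let absorb (k t t' : R) : 0 <= k <= 200 * 100 -> 0 <= t -> t <= t' ->
  k * (W ^+ 5 * l ^+ 2) * t <= E * t'.
Proof.
move=> /andP[k0 kk] t0 tt.
have Z0 : 0 <= W ^+ 5 * l ^+ 2 by rewrite mulr_ge0 ?sqr_ge0// exprn_ge0// (le_trans ler01).
apply: ler_pM => //; first exact: mulr_ge0.
by apply: le_trans EW; rewrite -mulrA ler_wpM2r.
Qed.

Let nu0 : 0 <= n_rc m r c. Proof. exact: n_rc_ge0. Qed.

Lemma lsh_cost tape :
  [/\ (extra_space S data Q tape)%:R <=
        E * (N%:R `^ (1 + rho c) + n_rc m r c * N%:R),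
      (preproc_time S data tape)%:R <= E * (n_rc m r c * N%:R `^ (1 + rho c))
    & (query_time S data Q tape)%:R <=
        E * (n_rc m r c * (m + 2)%:R `^ (1 + rho c) * n%:R `^ rho c)].
Proof.
have /andP[r0 _] := rho_bounds c1.
have NE : N%:R = n%:R * (m + 2)%:R :> R by rewrite natrM.
have M1 : 1 <= (m + 2)%:R :> R by rewrite ler1n addn2.
have N1 : 1 <= N%:R :> R by rewrite NE mulr_ege1.
have M0 : 0 <= (m + 2)%:R :> R by exact: ler0n.
have nM0 : 0 <= n%:R * (m + 2)%:R :> R by exact: mulr_ge0.
have x0 : 0 <= n%:R `^ rho c :> R by exact: powR_ge0.
have pow1 (u : R) : 1 <= u -> u `^ (1 + rho c) = u * u `^ rho c.
  move=> u1; rewrite powRD ?powRr1 ?(le_trans ler01)//.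
  by apply/implyP => _; rewrite gt_eqF// (lt_le_trans ltr01).
have Nx : n%:R `^ rho c * (n%:R * (m + 2)%:R) <= N%:R `^ (1 + rho c) :> R.
  rewrite pow1// -NE mulrC ler_wpM2l//.
  apply: ge0_ler_powR; [exact: ltW|by rewrite nnegrE|by rewrite nnegrE|].
  by rewrite NE ler_peMr.
have Mx : (m + 2)%:R <= (m + 2)%:R `^ (1 + rho c) :> R.
  by rewrite -[leLHS]powRr1//; apply: ler_powR => //; rewrite lerDl ltW.
have space_ok (u : nat) : (u <= 64 * mem_bound m d a b lam n)%N ->
    u%:R <= E * (N%:R `^ (1 + rho c) + n_rc m r c * N%:R).
  move=> h; apply: (@le_trans _ _ (64 * mem_bound m d a b lam n)%:R); first by rewrite ler_nat.
  apply: (le_trans (space_le n0 d0 W1 l1 x1 xn LW TW KW MW dMW)).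
  apply: absorb; [by apply/andP; split; lra|by apply: addr_ge0; apply: mulr_ge0|].
  by apply: lerD; [exact: Nx|rewrite NE].
have query_ok (u : R) : u <= 200 * 100 * (W ^+ 5 * l ^+ 2) *
    (n_rc m r c * (m + 2)%:R * n%:R `^ rho c) ->
    u <= E * (n_rc m r c * (m + 2)%:R `^ (1 + rho c) * n%:R `^ rho c).
  move=> h; apply: le_trans h _; apply: absorb; [by apply/andP; split; lra|by apply: mulr_ge0 => //; apply: mulr_ge0|].
  by rewrite ler_wpM2r// ler_wpM2l.
have pre_ok (u : R) : u <= 40 * 100 * (W ^+ 5 * l ^+ 2) *
    (n_rc m r c * (n%:R * (m + 2)%:R * n%:R `^ rho c)) ->
    u <= E * (n_rc m r c * N%:R `^ (1 + rho c)).
  move=> h; apply: le_trans h _; apply: absorb; [by apply/andP; split; lra|by apply: mulr_ge0 => //; apply: mulr_ge0|].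
  by rewrite ler_wpM2l// mulrC.
have [nd|dn] := leqP n d.
  have [_ s_ok p_ok q_ok _] := @brute_case R m d q a b lam B sc r c data Q tape nd.
  have qb := brute_query_le n0 W1 l1 x1 MW dMW nd.
  have Z0 : 0 <= W ^+ 5 * l ^+ 2.
    by rewrite mulr_ge0 ?sqr_ge0// exprn_ge0// (le_trans ler01).
  split; first exact: space_ok.
    rewrite p_ok; apply: pre_ok; apply: (@le_trans _ _ (20 + n * 40)%:R).
      by rewrite ler_nat; apply: leq_trans (leq_addr _ _).
    apply: (le_trans qb); apply: ler_pM.
    - by apply: mulr_ge0; [exact: ler0n|exact: Z0].
    - by apply: mulr_ge0 => //; exact: mulr_ge0.
    - by apply: ler_wpM2r; [exact: Z0|lra].
    - rewrite -mulrA; apply: ler_wpM2l => //; rewrite -mulrA ler_peMl//; exact: mulr_ge0.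
  apply: query_ok; apply: (@le_trans _ _ (20 + n * 40)%:R); first by rewrite ler_nat.
  apply: (le_trans qb); apply: ler_wpM2r; first by apply: mulr_ge0 => //; exact: mulr_ge0.
  by apply: ler_wpM2r; [exact: Z0|lra].
have [s_ok p_ok q_ok _ _] := hash_case q a lam r c d0 b0 range data_ok Q_ok tape dn.
split; first exact: space_ok.
  apply: pre_ok; apply: (@le_trans _ _ (preproc_bound m d q a b lam B n)%:R).
    by rewrite ler_nat.
  exact: (preproc_le n0 W1 l1 x1 LW KW nbW BW qW MW dMW dn).
apply: query_ok; apply: (@le_trans _ _ (query_bound m d a b lam B n)%:R); first by rewrite ler_nat.
exact: (query_le d0 W1 l1 x1 LW KW BW MW dMW dn).
Qed.

End Costs.
End Assembly.

Theorem theoremC5 (R : realType) :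
  exists K delta : R, [/\ 0 < K, 0 < delta &
  forall c : R, 1 < c ->
  exists2 eps : nat -> R, eps @ \oo --> (0 : R) &
  forall (m : nat) (r : R), (3 <= m)%N -> 0 < r ->
  exists S : structure R,
  forall (n : nat) (data : seq (pgon R)), (0 < n)%N -> size data = n ->
    (forall i, (i < n)%N -> polygon_upto m (nth (pgon0 R) data i)) ->
  forall q : pgon R, polygon_upto m q ->
  let N := (n * (m + 2))%N in
  let B := K * N%:R `^ eps N in
  lsh_guarantee delta r c S data q /\
  forall tape : nat -> bool,
  [/\ (extra_space S data q tape)%:R <=
        B * (N%:R `^ (1 + rho c) + n_rc m r c * N%:R),
      (preproc_time S data tape)%:R <=
        B * (n_rc m r c * N%:R `^ (1 + rho c))
    & (query_time S data q tape)%:R <=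
        B * (n_rc m r c * (m + 2)%:R `^ (1 + rho c) * n%:R `^ rho c)]].
Proof.
(* All constants go into the factor N^eps, so K = 1 suffices. *)
exists 1, (1 / 4); split => // c c1.
have [q [a [b [lam [A [[b0 lam0 lamW A0] param]]]]]] := lsh_parameters c1.
have [W0 W01 sizes] := hash_sizes a b0 (rho_bounds c1) lamW.
have [V V1 dims] := dimension c1 A0.
(* W depends on c alone, as it must: eps is fixed before m and r. *)
pose W : R := W0 + V + q%:R.
have W0W : W0 <= W by rewrite /W -addrA lerDl addr_ge0// (le_trans ler01).
have VW : V <= W by rewrite /W addrAC lerDr addr_ge0// (le_trans ler01).
have qW : q%:R <= W by rewrite /W lerDr addr_ge0// (le_trans ler01).
have W1 : 1 <= W by exact: le_trans W01 W0W.
have C0 : 0 < 200 * 100 * W ^+ 5.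
  apply: mulr_gt0; first by rewrite -natrM ltr0n muln_gt0.
  by apply: exprn_gt0; exact: lt_le_trans ltr01 W1.
have [eps eps0 epsN] := polylog_exponent C0.
exists eps => // m r m3 r0.
(* For large r, [n_rc] may be too small to pay for any work; the empty program meets every bound. *)
have [far|close] := leP ((2 * m%:R + 6) * pi) (c * r).
  exists (Structure (Skip R) (Skip R)) => n data n0 sn data_ok Q Q_ok N E; subst n.
  have E0 : 0 <= E by rewrite mulr_ge0// powR_ge0.
  split; first exact: trivial_answer (data_ok 0%N n0) Q_ok far.
  have nu0 := n_rc_ge0 m r c1.
  move=> tape; split; apply: mulr_ge0 => //; first by apply: addr_ge0; [exact: powR_ge0|exact: mulr_ge0].
    by apply: mulr_ge0 => //; exact: powR_ge0.
  by apply: mulr_ge0; [apply: mulr_ge0 => //; exact: powR_ge0|exact: powR_ge0].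
have [d [d0 big MV dV]] := dims m r r0 close.
have [sc [range guarantee]] := param m d r m3 d0 r0 big.
exists (lsh m d q a b lam (up_log 2 (3 * d)) sc r c) => n data n0 sn data_ok Q Q_ok N E; subst n.
split; first exact: guarantee.
have nu0 := n_rc_ge0 m r c1.
have nR : 1 <= (size data)%:R :> R by rewrite ler1n.
have l0 : 0 <= 1 + ln (size data)%:R :> R by rewrite addr_ge0// ln_ge0.
have [LW TW KW nbW BW] := sizes _ n0.
have up (u v : R) : 0 <= v -> u <= W0 * v -> u <= W * v.
  by move=> v0 h; apply: le_trans h _; apply: ler_wpM2r.
have upV (u : R) : u <= V * n_rc m r c -> u <= W * n_rc m r c.
  by move=> h; apply: le_trans h _; apply: ler_wpM2r.
have N1 : (1 < N)%N by apply: leq_trans (leq_pmull _ n0); rewrite addn2.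
move=> tape; apply: (lsh_cost (W := W) c1 d0 b0 n0 range data_ok Q_ok W1).
- by apply: up; [exact: powR_ge0|exact: LW].
- by apply: up; [exact: ler0n|exact: TW].
- by apply: up; [exact: l0|exact: KW].
- by apply: up; [exact: l0|exact: nbW].
- by move=> dn; apply: up; [exact: l0|exact: BW].
- exact: qW.
- exact: upV.
- exact: upV.
rewrite /E mul1r; apply: le_trans (epsN N N1); rewrite ler_pM2l//.
apply: lerXn2r; rewrite ?nnegrE//.
  by rewrite addr_ge0// ln_ge0// ler1n ltnW.
rewrite lerD2l ler_ln ?posrE ?ltr0n// ?(ltnW N1)//.
by rewrite ler_nat leq_pmulr// addn2.
Qed.
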